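(* \textsc{Unbounded SubsetSum} can be solved in time $$O\Big(a_n\log a_n\cdot \log\big(\min\{\tfrac{t}{a_n},\tfrac{F}{a_n}\}\big)\Big)=O\Big(a_n\log a_n\cdot\log\big(\tfrac{a_n}{n}\big)\Big),$$ where $F=F(a_0,\dots,a_n)$ is the Frobenius number of the instance.
   Context: \textsc{Unbounded SubsetSum}: given integers $1\le a_0<a_1<\dots<a_n$ with $\gcd(a_0,\dots,a_n)=1$ and a target $t\in\mathbb{Z}_{\ge0}$, decide whether there is $x\in\mathbb{Z}_{\ge 0}^{n+1}$ with $a_0x_0+\dots+a_nx_n=t$. The Frobenius number $F(a_0,\dots,a_n)$ is the largest nonnegative integer $t$ for which no such $x$ exists. *)

(* Defs.v *)
From mathcomp Require Import all_boot.
Set Implicit Arguments. Unset Strict Implicit. Unset Printing Implicit Defensive.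

Definition representable (n : nat) (a : nat -> nat) (t : nat) : Prop :=
  exists x : nat -> nat, \sum_(i < n.+1) a i * x i = t.

Definition valid_instance (n : nat) (a : nat -> nat) : Prop :=
  [/\ 0 < a 0,
      (forall i j, i < j <= n -> a i < a j) &
      \big[gcdn/0]_(i < n.+1) a i = 1].

(* Machine model: a word RAM with word size w.                         *)
(* Memory is nat -> nat; every arithmetic result is reduced mod 2^w,   *)
(* indirect addressing uses word values, every instruction costs 1.    *)

Inductive instr : Type :=
| Const of nat & nat
| Add of nat & nat & nat
| Sub of nat & nat & nat      (* Sub d s1 s2   : m[d] := max(m[s1]-m[s2],0) *)
| Mul of nat & nat & nat
| Div of nat & nat & nat      (* Div d s1 s2   : m[d] := m[s1] / m[s2] (0 if /0) *)
| Mod of nat & nat & nat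
| ReadInd of nat & nat
| WriteInd of nat & nat
| Jz of nat & nat
| Jmp of nat
| Halt.

Definition upd (m : nat -> nat) (d v : nat) : nat -> nat :=
  fun x => if x == d then v else m x.

Definition step (w : nat) (i : instr) (pc : nat) (m : nat -> nat)
  : nat * (nat -> nat) :=
  let W v := v %% 2 ^ w in
  match i with
  | Const d c => (pc.+1, upd m d (W c))
  | Add d s1 s2 => (pc.+1, upd m d (W (m s1 + m s2)))
  | Sub d s1 s2 => (pc.+1, upd m d (W (m s1 - m s2)))
  | Mul d s1 s2 => (pc.+1, upd m d (W (m s1 * m s2)))
  | Div d s1 s2 => (pc.+1, upd m d (W (m s1 %/ m s2)))
  | Mod d s1 s2 => (pc.+1, upd m d (W (m s1 %% m s2)))
  | ReadInd d s => (pc.+1, upd m d (m (m s)))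
  | WriteInd d s => (pc.+1, upd m (m d) (m s))
  | Jz s l => (if m s == 0 then l else pc.+1, m)
  | Jmp l => (l, m)
  | Halt => (pc, m)
  end.

Fixpoint exec (w : nat) (P : seq instr) (fuel : nat) (pc : nat)
  (m : nat -> nat) : option (nat -> nat) :=
  match fuel with
  | 0 => None
  | f.+1 =>
      match nth Halt P pc with
      | Halt => Some m
      | i => let '(pc', m') := step w i pc m in exec w P f pc' m'
      end
  end.

Definition init_mem (n : nat) (a : nat -> nat) (t : nat) : nat -> nat :=
  fun x => if x == 0 then n.+1 else if x == 1 then t
           else if x <= n.+2 then a (x - 2) else 0.

(* lg x = floor(log2 x) + 1  (>= 1; the usual "+1" convention inside O) *)
Definition lg (x : nat) : nat := (trunc_log 2 x).+1.

(* Main.v *)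
Require Import Defs.
From mathcomp Require Import all_boot.
From mathcomp Require Import all_order all_algebra zify complex realalg ring lra.
Set Implicit Arguments. Unset Strict Implicit. Unset Printing Implicit Defensive.

(* Write [M = a_n] and let [S] be the set of representable numbers.  Any element
   of [S] is a sum of two elements of [S] that differ by at most [M], so the
   window of [S] of length about [16 M] around [t / 2^j] determines the one around
   [t / 2^(j-1)] through a single sumset, and the window at [0] arises by
   doubling, since an element of [S] below [2 u] is the sum of two elements below
   [u] and at most one generator.  A window that contains [M] consecutive elements
   of [S] decides the instance, which happens above the Frobenius number [F], so
   [log (min (t, F) / M)] sumsets suffice.

   Sumsets come from squaring the Fourier transform of an indicator function.  A
   complex number is packed into one word as four digits in base [Z], the
   coefficients of [1, i, i^2, i^3], so that a product is one multiplication
   modulo [Z^4 - 1] and subtraction is never needed; the words are long enough to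
   absorb rounding.

   [F = O(M^3 / n^2)]: while a set of residues modulo [M] is not
   everything, its sumset with itself is at least [3/2] times as large. *)

(** * Structured programs on the word RAM *)

(** A fast transform over a finite field would first have to find a suitable prime. Complex roots of
    unity of order [2^K] need no search: they arise by bisecting angles, hence from integer square
    roots alone. The price is an error analysis, and words whose length exceeds [log2 (t + a n + 2)]
    by a large constant factor, which the exponent [c] provides.

    [F] is never computed. The descent runs from coarse to fine levels and stops by itself once a
    window begins with [M] consecutive elements of [S]; only the analysis mentions [F]. Two costs do
    not shrink with [min (t, F)]. Building the first window is a geometric series, dominated by its
    last doubling. Finding the coarsest level takes about [log (t / M)] steps, which could exceed
    the bound for huge [t]; so targets [t >= 2 M^3] are accepted outright, by the estimate on [F].

    Running times are proved for a small while language whose semantics counts the instructions of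
    the compiled code exactly. Since one running time must obey the bound for every admissible [F],
    it is taken to be the least fuel that lets the program halt. *)

Inductive bop := BAdd | BSub | BMul | BDiv | BMod.

Inductive expr :=
| Var of nat
| Cst of nat
| Bin of bop & expr & expr
| Get of nat & expr
| Raw of expr.

Inductive cmd :=
| Skip
| Assign of nat & expr
| Put of nat & expr & expr
| Seq of cmd & cmd
| Ite of expr & cmd & cmd
| While of expr & cmd.

Record state := State { rg : nat -> nat; ar : nat -> nat -> nat }.

Definition setr (s : state) (r v : nat) : state := State (upd (rg s) r v) (ar s).

Definition seta (s : state) (k x v : nat) : state :=
  State (rg s) (fun k' => if k' == k then upd (ar s k) x v else ar s k').

Definition evalop (o : bop) (x y : nat) : nat :=
  match o with
  | BAdd => x + y | BSub => x - y | BMul => x * y | BDiv => x %/ y | BMod => x %% y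
  end.

Fixpoint eval (raw : nat -> nat) (s : state) (e : expr) : nat :=
  match e with
  | Var r => rg s r
  | Cst c => c
  | Bin o a b => evalop o (eval raw s a) (eval raw s b)
  | Get k a => ar s k (eval raw s a)
  | Raw a => raw (eval raw s a)
  end.

(* [safe] says that evaluation with [w]-bit words never wraps around and that
   raw reads stay below the arrays. *)
Fixpoint safe (w : nat) (raw : nat -> nat) (s : state) (e : expr) : Prop :=
  match e with
  | Var _ => True
  | Cst c => c < 2 ^ w
  | Bin o a b => [/\ safe w raw s a, safe w raw s b &
      match o with
      | BAdd | BMul => evalop o (eval raw s a) (eval raw s b) < 2 ^ w
      | _ => True
      end]
  | Get k a => safe w raw s a /\ 8 * eval raw s a + k + rg s 0 < 2 ^ w
  | Raw a => safe w raw s a /\ 64 <= eval raw s a < rg s 0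
  end.

(* Cells below [nreg] hold the registers, cells [nreg] .. 63 are temporaries.
   Register 0 holds the base address of the arrays; the eight arrays are
   interleaved, entry [x] of array [k] being at [base + 8 x + k], so that they
   are unbounded and never overlap. *)
Definition nreg : nat := 40.

(** Three doublings multiply the index by 8; cell [d.+1] is scratch space for the constant [k]. *)
Definition addr_code (d k : nat) : seq instr :=
  [:: Add d d d; Add d d d; Add d d d; Const d.+1 k; Add d d d.+1; Add d d 0].

Definition instr_of (o : bop) (d a b : nat) : instr :=
  match o with
  | BAdd => Add d a b | BSub => Defs.Sub d a b | BMul => Mul d a b
  | BDiv => Div d a b | BMod => Mod d a b
  end.

(** Temporaries form a stack growing upwards from [d]: code for [d.+1] never disturbs cell [d]. As
    the machine has no move instruction, a register is copied by adding it to 0. *)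
Fixpoint cexp (d : nat) (e : expr) : seq instr :=
  match e with
  | Var r => [:: Const d 0; Add d d r]
  | Cst c => [:: Const d c]
  | Bin o a b => cexp d a ++ cexp d.+1 b ++ [:: instr_of o d d d.+1]
  | Get k a => cexp d a ++ addr_code d k ++ [:: ReadInd d d]
  | Raw a => cexp d a ++ [:: ReadInd d d]
  end.

(** Jump targets depend on code lengths, so the length has to be known independently of the position
    at which the code is placed. *)
Fixpoint csize (c : cmd) : nat :=
  match c with
  | Skip => 0
  | Assign r e => size (cexp nreg e) + 2
  | Put k a e => size (cexp nreg a) + 6 + size (cexp nreg.+1 e) + 1
  | Seq c1 c2 => csize c1 + csize c2
  | Ite e c1 c2 => size (cexp nreg e) + 1 + csize c1 + 1 + csize c2
  | While e c1 => size (cexp nreg e) + 1 + csize c1 + 1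
  end.

Fixpoint compile (pc : nat) (c : cmd) : seq instr :=
  match c with
  | Skip => [::]
  | Assign r e => cexp nreg e ++ [:: Const r 0; Add r r nreg]
  | Put k a e =>
      cexp nreg a ++ addr_code nreg k ++ cexp nreg.+1 e ++ [:: WriteInd nreg nreg.+1]
  | Seq c1 c2 => compile pc c1 ++ compile (pc + csize c1) c2
  | Ite e c1 c2 =>
      let pc1 := pc + size (cexp nreg e) + 1 in
      let pc2 := pc1 + csize c1 + 1 in
      cexp nreg e ++ [:: Jz nreg pc2] ++ compile pc1 c1
        ++ [:: Jmp (pc2 + csize c2)] ++ compile pc2 c2
  | While e c1 =>
      let pc1 := pc + size (cexp nreg e) + 1 in
      cexp nreg e ++ [:: Jz nreg (pc1 + csize c1 + 1)] ++ compile pc1 c1 ++ [:: Jmp pc]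
  end.

Lemma size_compile pc c : size (compile pc c) = csize c.
Proof.
elim: c pc => //= [r e|k a e|c1 IH1 c2 IH2|e c1 IH1 c2 IH2|e c1 IH1] pc;
  rewrite !size_cat //= ?size_cat //= ?IH1 ?IH2; lia.
Qed.

Fixpoint wfe (d : nat) (e : expr) : bool :=
  match e with
  | Var r => r < nreg
  | Cst _ => true
  | Bin _ a b => [&& wfe d a, wfe d.+1 b & d.+1 < 64]
  | Get k a => [&& wfe d a, k < 8 & d.+1 < 64]
  | Raw a => wfe d a
  end.

Fixpoint wfc (c : cmd) : bool :=
  match c with
  | Skip => true
  | Assign r e => (0 < r < nreg) && wfe nreg e
  | Put k a e => [&& k < 8, wfe nreg a & wfe nreg.+1 e]
  | Seq c1 c2 => wfc c1 && wfc c2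
  | Ite e c1 c2 => [&& wfe nreg e, wfc c1 & wfc c2]
  | While e c1 => wfe nreg e && wfc c1
  end.

Definition ce (e : expr) : nat := (size (cexp nreg e)).+1.

(** The number is the exact count of executed instructions: [ce] includes the conditional jump, the
    first branch of [Ite] pays one more for jumping over the second, and each iteration of [While]
    pays one for jumping back. *)
Inductive bs (w : nat) (raw : nat -> nat) : cmd -> state -> nat -> state -> Prop :=
| bs_skip s : bs w raw Skip s 0 s
| bs_assign s r e of safe w raw s e :
    bs w raw (Assign r e) s (csize (Assign r e)) (setr s r (eval raw s e))
| bs_put s k a e of safe w raw s a & safe w raw s e
    & 8 * eval raw s a + k + rg s 0 < 2 ^ w :
    bs w raw (Put k a e) s (csize (Put k a e)) (seta s k (eval raw s a) (eval raw s e))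
| bs_seq c1 c2 s s1 s2 t1 t2 of bs w raw c1 s t1 s1 & bs w raw c2 s1 t2 s2 :
    bs w raw (Seq c1 c2) s (t1 + t2) s2
| bs_ite e c1 c2 s s' t of safe w raw s e
    & bs w raw (if eval raw s e == 0 then c2 else c1) s t s' :
    bs w raw (Ite e c1 c2) s (ce e + t + (eval raw s e != 0)) s'
| bs_while0 e c s of safe w raw s e & eval raw s e = 0 :
    bs w raw (While e c) s (ce e) s
| bs_while1 e c s s1 s2 t1 t2 of safe w raw s e & eval raw s e != 0
    & bs w raw c s t1 s1 & bs w raw (While e c) s1 t2 s2 :
    bs w raw (While e c) s (ce e + t1 + 1 + t2) s2.

(** Quantifying over the remaining fuel makes execution segments compose by transitivity. *)
Definition reach (w : nat) (P : seq instr) (n pc : nat) (m : nat -> nat)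
    (pc' : nat) (m' : nat -> nat) : Prop :=
  forall f, exec w P (n + f) pc m = exec w P f pc' m'.

Definition code_at (P : seq instr) (pc : nat) (l : seq instr) : Prop :=
  forall k, k < size l -> nth Halt P (pc + k) = nth Halt l k.

Lemma code_at_cat P pc l1 l2 :
  code_at P pc (l1 ++ l2) -> code_at P pc l1 /\ code_at P (pc + size l1) l2.
Proof.
move=> h; split=> k hk.
  by rewrite h ?size_cat ?nth_cat ?hk // (leq_trans hk) // leq_addr.
rewrite -addnA h ?size_cat ?ltn_add2l // nth_cat ltnNge leq_addr /=.
by rewrite addKn.
Qed.

Lemma reach_trans w P n1 n2 pc m pc1 m1 pc2 m2 :
  reach w P n1 pc m pc1 m1 -> reach w P n2 pc1 m1 pc2 m2 ->
  reach w P (n1 + n2) pc m pc2 m2.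
Proof. by move=> h1 h2 f; rewrite -addnA h1 h2. Qed.

Definition straight (i : instr) : bool :=
  match i with Jz _ _ | Jmp _ | Halt => false | _ => true end.

Fixpoint smem (w : nat) (l : seq instr) (m : nat -> nat) : nat -> nat :=
  if l is i :: l' then smem w l' (step w i 0 m).2 else m.

Lemma reach_straight w P pc l m :
  all straight l -> code_at P pc l ->
  reach w P (size l) pc m (pc + size l) (smem w l m).
Proof.
elim: l pc m => [|i l IH] pc m; first by rewrite addn0.
case/andP=> hi hl /(@code_at_cat _ _ [:: i]) [h1 h2] f.
have hn : nth Halt P pc = i by have := h1 0 isT; rewrite addn0.
rewrite [size _]/= addSn addnS -addSn [LHS]/= hn.
rewrite /= addn1 in h2.
by case: i hi {h1} hn => //= *; rewrite (IH _ _ hl h2).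
Qed.

Lemma reach_jmp w P pc m l :
  code_at P pc [:: Jmp l] -> reach w P 1 pc m l m.
Proof. by move=> h f; have := h 0 isT; rewrite addn0 /= => ->. Qed.

Lemma reach_jz w P pc m s l :
  code_at P pc [:: Jz s l] -> reach w P 1 pc m (if m s == 0 then l else pc.+1) m.
Proof. by move=> h f; have := h 0 isT; rewrite addn0 /= => ->. Qed.

(** Between the temporaries and the arrays, cells 64 to [base - 1] keep the raw words left there,
    since compiled code only writes below 64 or at the arrays. The last clause makes every value
    read a word, so that copying never truncates. *)
Definition holds_in (w : nat) (raw : nat -> nat) (s : state) (m : nat -> nat) : Prop :=
  [/\ 64 <= rg s 0,
      (forall r, r < nreg -> m r = rg s r),
      (forall k x, k < 8 -> m (rg s 0 + 8 * x + k) = ar s k x),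
      (forall x, 64 <= x < rg s 0 -> m x = raw x) &
      (forall x, m x < 2 ^ w)].

Lemma holds_tmp w raw s m d v :
  holds_in w raw s m -> nreg <= d < 64 -> v < 2 ^ w -> holds_in w raw s (upd m d v).
Proof.
move=> [h0 h1 h2 h3 h4] hd hv; split=> //.
- by move=> r hr; rewrite /upd; case: eqP => [|_]; [lia | exact: h1].
- by move=> k x hk; rewrite /upd; case: eqP => [|_]; [lia | exact: h2].
- by move=> x hx; rewrite /upd; case: eqP => [|_]; [lia | exact: h3].
- by move=> x; rewrite /upd; case: eqP.
Qed.

Lemma updE m d v : upd m d v d = v.
Proof. by rewrite /upd eqxx. Qed.

Lemma updN m d v x : x != d -> upd m d v x = m x.
Proof. by rewrite /upd => /negbTE->. Qed.

Lemma holds_base w raw s m : holds_in w raw s m -> m 0 = rg s 0.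
Proof. by case=> _ -> //. Qed.

Lemma addr_mem w raw s m d k a :
  holds_in w raw s m -> nreg <= d -> d.+1 < 64 -> m d = a ->
  8 * a + k + rg s 0 < 2 ^ w ->
  [/\ holds_in w raw s (smem w (addr_code d k) m),
    smem w (addr_code d k) m d = rg s 0 + 8 * a + k &
    forall x, x < d -> smem w (addr_code d k) m x = m x].
Proof.
move=> hr hd1 hd2 hm hw; have h0 := holds_base hr.
have hlt v : v %% 2 ^ w < 2 ^ w by rewrite ltn_mod expn_gt0.
have hd : nreg <= d < 64 by rewrite hd1; lia.
have hd' : nreg <= d.+1 < 64 by rewrite hd2; lia.
split.
- by do 6 (apply: holds_tmp => //).
- rewrite /= !(updE, updN) ?hm ?h0 //; try by rewrite /nreg in hd1; lia.
  by rewrite !modn_small; lia.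
- by move=> x hx; rewrite /= !updN //; lia.
Qed.

Lemma cexp_straight d e : all straight (cexp d e).
Proof.
elim: e d => //= [[] a IHa b IHb|k a IHa|a IHa] d; by rewrite !all_cat /= ?IHa ?IHb.
Qed.

Lemma smem_cat w l1 l2 m : smem w (l1 ++ l2) m = smem w l2 (smem w l1 m).
Proof. by elim: l1 m => //= i l1 IH m. Qed.

Lemma cexp_mem w raw s e d m :
  nreg <= d < 64 -> wfe d e -> safe w raw s e -> holds_in w raw s m ->
  [/\ holds_in w raw s (smem w (cexp d e) m), smem w (cexp d e) m d = eval raw s e &
    forall x, x < d -> smem w (cexp d e) m x = m x].
Proof.
have hlt v : v %% 2 ^ w < 2 ^ w by rewrite ltn_mod expn_gt0.
elim: e d m => [r|c|o a IHa b IHb|k a IHa|a IHa] d m hd /=.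
- move=> hr _ hm; have [_ hrg _ _ hb] := hm.
  split.
  + by do 2 (apply: holds_tmp => //).
  + rewrite !(updE, updN) ?mod0n ?add0n; last by lia.
    by rewrite modn_small // hrg.
  + by move=> x hx; rewrite !updN //; lia.
- move=> _ hc hm; split.
  + exact: holds_tmp.
  + by rewrite updE modn_small.
  + by move=> x hx; rewrite updN //; lia.
- case/and3P=> wa wb hd1 [sa sb hv] hm.
  rewrite !smem_cat.
  have [ra va fa] := IHa d m hd wa sa hm.
  have hdS : nreg <= d.+1 < 64 by lia.
  have [rb vb fb] := IHb d.+1 _ hdS wb sb ra.
  set m2 := smem _ (cexp d.+1 b) _ in rb vb fb *.
  have e1 : m2 d = eval raw s a by rewrite fb.
  have [_ _ _ _ bb] := rb.
  have ba := bb d; have bb' := bb d.+1; rewrite e1 in ba; rewrite vb in bb'.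
  (* Truncated differences, quotients and remainders are at most their first operand, which is
     already a word; only sums and products rely on [safe]. *)
  have hval : evalop o (eval raw s a) (eval raw s b) < 2 ^ w.
    case: o hv => //= _; first by apply: leq_ltn_trans ba; exact: leq_subr.
      by apply: leq_ltn_trans ba; exact: leq_div.
    by apply: leq_ltn_trans ba; exact: leq_mod.
  have -> : smem w [:: instr_of o d d d.+1] m2 =
            upd m2 d (evalop o (eval raw s a) (eval raw s b)).
    by case: o {hv} hval => /= hv; rewrite e1 vb modn_small.
  split; [exact: holds_tmp | exact: updE |].
  by move=> x hx; rewrite updN; [rewrite fb ?fa //; lia | lia].
- case/and3P=> wa hk hd1 [sa hw] hm.
  rewrite smem_cat (smem_cat w (addr_code d k)).
  have [ra va fa] := IHa d m hd wa sa hm.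
  have [|rb vb fb] := addr_mem ra _ hd1 va hw; first by lia.
  set m2 := smem _ (addr_code _ _) _ in rb vb fb *.
  have [_ _ har _ bb] := rb.
  rewrite /= vb har //.
  split; [ | exact: updE |].
  + by apply: holds_tmp => //; rewrite -har.
  + by move=> x hx; rewrite updN ?fb ?fa //; lia.
- move=> wa [sa hw] hm; rewrite smem_cat /=.
  have [ra va fa] := IHa d m hd wa sa hm.
  have [_ _ _ hraw bb] := ra.
  rewrite va hraw //; split; [ | exact: updE |].
  + by apply: holds_tmp => //; rewrite -hraw.
  + by move=> x hx; rewrite updN ?fa //; lia.
Qed.

Lemma holds_setr w raw s m r v :
  holds_in w raw s m -> 0 < r < nreg -> v < 2 ^ w -> holds_in w raw (setr s r v) (upd m r v).
Proof.
move=> [h0 h1 h2 h3 h4] hr hv.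
have h64 : nreg < 64 by [].
have e0 : rg (setr s r v) 0 = rg s 0 by rewrite /= updN; lia.
split; rewrite ?e0 //.
- by move=> r' hr'; rewrite /= /upd h1.
- by move=> k x hk; rewrite updN; [exact: h2 | lia].
- by move=> x hx; rewrite updN; [exact: h3 | lia].
- by move=> x; rewrite /upd; case: eqP.
Qed.

Lemma holds_seta w raw s m k x v :
  holds_in w raw s m -> k < 8 -> v < 2 ^ w ->
  holds_in w raw (seta s k x v) (upd m (rg s 0 + 8 * x + k) v).
Proof.
move=> [h0 h1 h2 h3 h4] hk hv.
have h64 : nreg < 64 by [].
split=> //.
- by move=> r' hr'; rewrite /= updN ?h1 //; lia.
- move=> k' x' hk' /=; case: (k' =P k) => [->|hne].
    rewrite /upd eqn_add2r eqn_add2l eqn_mul2l /=.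
    by case: eqP => // _; exact: h2.
  by rewrite updN ?h2 //; lia.
- by move=> y hy; rewrite updN; [exact: h3 | move: hy => /=; lia].
- by move=> y; rewrite /upd; case: eqP.
Qed.

Lemma reach_cexp w P raw s e m pc :
  holds_in w raw s m -> wfe nreg e -> safe w raw s e -> code_at P pc (cexp nreg e) ->
  exists m', [/\ reach w P (size (cexp nreg e)) pc m (pc + size (cexp nreg e)) m',
    holds_in w raw s m' & m' nreg = eval raw s e].
Proof.
move=> hr hw hs hc; exists (smem w (cexp nreg e) m).
have [h1 h2 _] := cexp_mem (isT : nreg <= nreg < 64) hw hs hr.
split=> //; exact: reach_straight (cexp_straight _ _) hc.
Qed.

Lemma holds_ext w raw s m m' : m =1 m' -> holds_in w raw s m -> holds_in w raw s m'.
Proof.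
move=> he [h0 h1 h2 h3 h4]; split=> // *; rewrite -he; auto.
Qed.

(** The machine takes exactly as many steps as the derivation records, so cost bounds for commands
    are running times of the compiled code. *)
Lemma compile_correct w P raw c s t s' :
  bs w raw c s t s' -> forall pc m,
  wfc c -> holds_in w raw s m -> code_at P pc (compile pc c) ->
  exists m', reach w P t pc m (pc + csize c) m' /\ holds_in w raw s' m'.
Proof.
elim=> {c s t s'}.
- by move=> s pc m _ hr _; exists m; rewrite addn0; split.
- move=> s r e hs pc m /= /andP[hr he] hm hc.
  have [h1 h2 _] := cexp_mem (isT : nreg <= nreg < 64) he hs hm.
  exists (smem w (cexp nreg e ++ [:: Const r 0; Add r r nreg]) m); split.
    have -> : size (cexp nreg e) + 2 = size (cexp nreg e ++ [:: Const r 0; Add r r nreg]).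
      by rewrite size_cat.
    by apply: reach_straight => //; rewrite all_cat cexp_straight.
  have [_ _ _ _ hb] := h1; have hb' := hb nreg.
  rewrite smem_cat /= updE mod0n add0n updN ?h2; last by lia.
  rewrite h2 in hb'; rewrite modn_small //.
  apply: holds_ext (holds_setr h1 hr hb') => x.
  by rewrite /upd; case: eqP.
- move=> s k a e ha he hw pc m /= /and3P[hk wa we] hm hc.
  exists (smem w (compile pc (Put k a e)) m); split.
    rewrite [X in reach _ _ X](_ : _ = size (compile pc (Put k a e))); last first.
      by rewrite size_compile.
    rewrite [X in reach _ _ _ _ _ X](_ : _ = pc + size (compile pc (Put k a e))); last first.
      by rewrite size_compile.
    apply: reach_straight => //.
    by rewrite /compile !all_cat !cexp_straight.
  rewrite /compile !smem_cat.
  have [h1 h2 _] := cexp_mem (isT : nreg <= nreg < 64) wa ha hm.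
  have [//|h3 h4 _] := addr_mem h1 (leqnn _) _ h2 hw.
  have [h5 h6 h7] := cexp_mem (isT : nreg <= nreg.+1 < 64) we he h3.
  set m2 := smem _ (cexp nreg.+1 e) _ in h5 h6 h7 *.
  have [_ _ _ _ hb] := h5; have hb' := hb nreg.+1; rewrite h6 in hb'.
  rewrite /= h7 // h4 h6.
  exact: holds_seta.
- move=> c1 c2 s s1 s2 t1 t2 _ IH1 _ IH2 pc m /= /andP[w1 w2] hm /code_at_cat[hc1 hc2].
  rewrite size_compile in hc2.
  have [m1 [r1 hm1]] := IH1 _ _ w1 hm hc1.
  have [m2 [r2 hm2]] := IH2 _ _ w2 hm1 hc2.
  exists m2; split=> //; rewrite addnA; exact: reach_trans r1 r2.
- move=> e c1 c2 s s' t hs _ IH pc m /= /and3P[we w1 w2] hm.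
  case/code_at_cat=> hce /(@code_at_cat _ _ [:: _]) [hjz] /code_at_cat[hc1].
  case/(@code_at_cat _ _ [:: _])=> hjmp hc2.
  rewrite size_compile /= in hjmp hc2.
  have [m1 [r1 hm1 v1]] := reach_cexp hm we hs hce.
  have r2 := reach_jz w m1 hjz; rewrite v1 in r2.
  have r12 := reach_trans r1 r2; rewrite addn1 -/(ce e) in r12.
  case: (eval raw s e == 0) IH r12 => [] IH r12.
    have [m2 [r3 hm2]] := IH _ _ w2 hm1 hc2.
    exists m2; split=> //; rewrite addn0.
    rewrite [X in reach _ _ _ _ _ X](_ : _ =
      pc + size (cexp nreg e) + 1 + csize c1 + 1 + csize c2); last by lia.
    exact: reach_trans r12 r3.
  rewrite -addn1 in r12.
  have [m2 [r3 hm2]] := IH _ _ w1 hm1 hc1.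
  exists m2; split=> //.
  rewrite [X in reach _ _ _ _ _ X](_ : _ =
      pc + size (cexp nreg e) + 1 + csize c1 + 1 + csize c2); last by lia.
  apply: reach_trans (reach_trans r12 r3) (reach_jmp _ _ hjmp).
- move=> e c s hs h0 pc m /= /andP[we wc] hm.
  case/code_at_cat=> hce /(@code_at_cat _ _ [:: _]) [hjz] /code_at_cat[hc1] hjmp.
  have [m1 [r1 hm1 v1]] := reach_cexp hm we hs hce.
  have r2 := reach_jz w m1 hjz; rewrite v1 h0 /= in r2.
  exists m1; split=> //; rewrite /ce -addn1.
  rewrite [X in reach _ _ _ _ _ X](_ : _ =
      pc + size (cexp nreg e) + 1 + csize c + 1); last by lia.
  exact: reach_trans r1 r2.
- move=> e c s s1 s2 t1 t2 hs h0 _ IH1 _ IH2 pc m /= /andP[we wc] hm hc.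
  have := hc.
  case/code_at_cat=> hce /(@code_at_cat _ _ [:: _]) [hjz] /code_at_cat[hc1] hjmp.
  rewrite size_compile in hjmp.
  have [m1 [r1 hm1 v1]] := reach_cexp hm we hs hce.
  have r2 := reach_jz w m1 hjz; rewrite v1 (negbTE h0) /= -[(_ + _).+1]addn1 in r2.
  have [m2 [r3 hm2]] := IH1 _ _ wc hm1 hc1.
  have r4 := reach_jmp w m2 hjmp.
  have [|m3 [r5 hm3]] := IH2 pc _ _ hm2 hc; first by rewrite /= we wc.
  exists m3; split=> //; rewrite /ce -[(size _).+1]addn1.
  exact: reach_trans (reach_trans (reach_trans (reach_trans r1 r2) r3) r4) r5.
Qed.

(** * A program logic with running times *)

Definition runs (w : nat) (raw : nat -> nat) (c : cmd) (s : state) (T : nat)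
    (Q : state -> Prop) : Prop :=
  exists t s', [/\ t <= T, bs w raw c s t s' & Q s'].

Lemma runs_weak w raw c s T T' (Q Q' : state -> Prop) :
  runs w raw c s T Q -> T <= T' -> (forall s', Q s' -> Q' s') -> runs w raw c s T' Q'.
Proof.
move=> [t [s' [h1 h2 h3]]] hT hQ; exists t, s'; split; auto; exact: leq_trans hT.
Qed.

Lemma runs_skip w raw s T (Q : state -> Prop) : Q s -> runs w raw Skip s T Q.
Proof. by exists 0, s; split=> //; constructor. Qed.

Lemma runs_assign w raw r e s T (Q : state -> Prop) :
  csize (Assign r e) <= T -> safe w raw s e -> Q (setr s r (eval raw s e)) ->
  runs w raw (Assign r e) s T Q.
Proof. by move=> hT hs hq; exists (csize (Assign r e)), (setr s r (eval raw s e)); split => //; constructor. Qed.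

Lemma runs_put w raw k a e s T (Q : state -> Prop) :
  csize (Put k a e) <= T -> safe w raw s a -> safe w raw s e ->
  8 * eval raw s a + k + rg s 0 < 2 ^ w ->
  Q (seta s k (eval raw s a) (eval raw s e)) ->
  runs w raw (Put k a e) s T Q.
Proof.
move=> hT h1 h2 h3 hq.
by exists (csize (Put k a e)), (seta s k (eval raw s a) (eval raw s e)); split => //; constructor.
Qed.

Lemma runs_seq w raw c1 c2 s T1 T2 (Q1 Q2 : state -> Prop) :
  runs w raw c1 s T1 Q1 -> (forall s1, Q1 s1 -> runs w raw c2 s1 T2 Q2) ->
  runs w raw (Seq c1 c2) s (T1 + T2) Q2.
Proof.
move=> [t1 [s1 [h1 b1 q1]]] /(_ _ q1) [t2 [s2 [h2 b2 q2]]].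
exists (t1 + t2), s2; split=> //; [exact: leq_add | exact: bs_seq b1 b2].
Qed.

Lemma runs_ite w raw e c1 c2 s T (Q : state -> Prop) :
  safe w raw s e -> runs w raw (if eval raw s e == 0 then c2 else c1) s T Q ->
  runs w raw (Ite e c1 c2) s (ce e + T + 1) Q.
Proof.
move=> hs [t [s' [h b q]]]; exists (ce e + t + (eval raw s e != 0)), s'; split=> //.
  by rewrite !leq_add // leq_b1.
exact: bs_ite.
Qed.

(** The index of the invariant bounds the iterations still to come. The guard may fail earlier,
    which is why the conclusion leaves the final index open; the descent through the levels relies
    on this. *)
Lemma runs_while w raw e c (I : nat -> state -> Prop) (T : nat -> nat) k s :
  (forall j s, I j s -> safe w raw s e) ->
  (forall s, I 0 s -> eval raw s e = 0) ->
  (forall j s, I j.+1 s -> eval raw s e != 0 -> runs w raw c s (T j) (I j)) ->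
  I k s ->
  runs w raw (While e c) s (\sum_(j < k) (ce e + T j + 1) + ce e)
    (fun s' => eval raw s' e = 0 /\ exists j, I j s').
Proof.
move=> hs h0 hstep; elim: k s => [|k IH] s hI.
  exists (ce e), s; split; [by rewrite big_ord0 | |].
    by apply: bs_while0; [exact: hs hI | exact: h0].
  by split; [exact: h0 | exists 0].
case: (eqVneq (eval raw s e) 0) => he.
  exists (ce e), s; split; [exact: leq_addl | |].
    by apply: bs_while0 => //; exact: hs hI.
  by split=> //; exists k.+1.
have [t1 [s1 [l1 b1 q1]]] := hstep _ _ hI he.
have [t2 [s2 [l2 b2 q2]]] := IH _ q1.
exists (ce e + t1 + 1 + t2), s2; split=> //.
  rewrite big_ord_recr /=; move: l2; set A := \sum_(j < k) _.
  by rewrite -/A; clear -l1; lia.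
by apply: bs_while1 b1 b2 => //; exact: hs hI.
Qed.

Definition For (i : nat) (n : expr) (c : cmd) : cmd :=
  Seq (Assign i (Cst 0))
    (While (Bin BSub n (Var i)) (Seq c (Assign i (Bin BAdd (Var i) (Cst 1))))).

Definition for_cost (n : expr) : nat := ce n + 30.

Lemma runs_for w raw i n c (I : nat -> state -> Prop) T k s :
  1 < 2 ^ w -> k < 2 ^ w ->
  (forall j s, I j s -> j <= k ->
     [/\ safe w raw s n, eval raw s n = k & rg s i = j]) ->
  (forall j s, I j s -> j < k ->
     runs w raw c s T (fun s' => rg s' i = j /\ I j.+1 (setr s' i j.+1))) ->
  I 0 (setr s i 0) ->
  runs w raw (For i n c) s (k * (T + for_cost n) + for_cost n) (I k).
Proof.
move=> h1 hk hI hstep h0.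
have e0 : csize (Assign i (Cst 0)) = 3 by [].
have e1 : csize (Assign i (Bin BAdd (Var i) (Cst 1))) = 6 by [].
have e2 : ce (Bin BSub n (Var i)) = ce n + 3.
  by rewrite /ce /= size_cat /=; lia.
have hT : 3 + (\sum_(j < k) (ce (Bin BSub n (Var i)) + (T + 6) + 1) + ce (Bin BSub n (Var i)))
   <= k * (T + for_cost n) + for_cost n.
  rewrite sum_nat_const card_ord e2 /for_cost; nia.
apply: (runs_weak _ hT (fun s' h => h)).
apply: (@runs_seq _ _ _ _ _ _ _ (I 0)).
  by apply: runs_assign => //=; apply: ltn_trans h1.
move=> s1 hs1.
(* [runs_while] counts the iterations left, [I] those already made, hence the reversal [k - m]. *)
pose J m s' := (m <= k) /\ I (k - m) s'.
apply: runs_weak (@runs_while _ _ _ _ J (fun=> T + 6) k s1 _ _ _ _) (leqnn _) _.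
- by move=> j s' [hj hIj]; have [|hn _ _] := hI _ _ hIj; [lia | split].
- move=> s' [hj hIj] /=; have [| _ -> ->] := hI _ _ hIj; lia.
- move=> j s' [hj hIj] _; apply: (runs_seq (hstep _ _ hIj _)); first by lia.
  move=> s2 [hi2 hI2]; apply: runs_assign => //=; rewrite hi2.
    by split=> //; lia.
  by split; [lia | rewrite addn1 [k - j](_ : _ = (k - j.+1).+1) //; lia].
- by split=> //; rewrite subnn.
- move=> s' [/= he [j [hj hIj]]].
  have [|_ e3 e4] := hI _ _ hIj; first by lia.
  by move: hIj; rewrite [k - j](_ : _ = k) //; lia.
Qed.

(** * Fixed-point complex numbers *)

Definition pack (Z c0 c1 c2 c3 : nat) : nat := c0 + c1 * Z + c2 * Z ^ 2 + c3 * Z ^ 3.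

Definition dig (Z k x : nat) : nat := x %/ Z ^ k %% Z.

(** Reduction modulo [Z^4 - 1] carries the digits 4 to 6 of the product back to 0 to 2, as [i^4 = 1]
    demands. A product of two values of scale [S] has scale [S^2], so every digit is divided by
    [S]. *)
Definition cmul (S Z x y : nat) : nat :=
  let r := (x * y) %% (Z ^ 4 - 1) in
  pack Z (dig Z 0 r %/ S) (dig Z 1 r %/ S) (dig Z 2 r %/ S) (dig Z 3 r %/ S).

(** Since [i^2 = -1], digits [k] and [k + 2] cancel. Truncated subtraction leaves one of each
    opposite pair at 0 and does not change the represented number. *)
Definition cnorm (Z x : nat) : nat :=
  pack Z (dig Z 0 x - dig Z 2 x) (dig Z 1 x - dig Z 3 x)
         (dig Z 2 x - dig Z 0 x) (dig Z 3 x - dig Z 1 x).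

Lemma dig_pack Z c0 c1 c2 c3 : c0 < Z -> c1 < Z -> c2 < Z -> c3 < Z ->
  let x := pack Z c0 c1 c2 c3 in
  [/\ dig Z 0 x = c0, dig Z 1 x = c1, dig Z 2 x = c2 & dig Z 3 x = c3].
Proof.
move=> h0 h1 h2 h3 x; have Z0 : 0 < Z by lia.
have e0 : x = (c1 + (c2 + c3 * Z) * Z) * Z + c0 by rewrite /x /pack !expnS expn0; lia.
have d a b : b < Z -> (a * Z + b) %/ Z = a by move=> hb; rewrite divnMDl // divn_small ?addn0.
have r a b : b < Z -> (a * Z + b) %% Z = b by move=> hb; rewrite modnMDl modn_small.
have q1 : x %/ Z = (c2 + c3 * Z) * Z + c1 by rewrite e0 d // addnC.
have q2 : x %/ Z ^ 2 = c3 * Z + c2 by rewrite -mulnn divnMA q1 d // addnC.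
have q3 : x %/ Z ^ 3 = 0 * Z + c3.
  by rewrite expnSr divnMA q2 d // mul0n add0n.
by split; rewrite /dig ?expn0 ?expn1 ?divn1 ?q1 ?q2 ?q3 ?r // e0 r.
Qed.

Lemma pack_lt Z c0 c1 c2 c3 : c0 < Z -> c1 < Z -> c2 < Z -> c3 < Z ->
  pack Z c0 c1 c2 c3 < Z ^ 4.
Proof.
move=> h0 h1 h2 h3; rewrite /pack.
have : c1.+1 * Z <= Z * Z by rewrite leq_mul2r h1 orbT.
have : c2.+1 * Z ^ 2 <= Z * Z ^ 2 by rewrite leq_mul2r h2 orbT.
have : c3.+1 * Z ^ 3 <= Z * Z ^ 3 by rewrite leq_mul2r h3 orbT.
by rewrite -!expnS mulnn !mulSn; lia.
Qed.

(** Each cyclic coefficient is at most [4 * D1 * D2 < Z - 1], so no digit carries into the next and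
    the packed result stays below the modulus [Z^4 - 1]. *)
Lemma cmul_pack S Z a0 a1 a2 a3 b0 b1 b2 b3 D1 D2 :
  a0 <= D1 -> a1 <= D1 -> a2 <= D1 -> a3 <= D1 ->
  b0 <= D2 -> b1 <= D2 -> b2 <= D2 -> b3 <= D2 -> 4 * D1 * D2 + 1 < Z ->
  cmul S Z (pack Z a0 a1 a2 a3) (pack Z b0 b1 b2 b3) =
  pack Z ((a0 * b0 + a1 * b3 + a2 * b2 + a3 * b1) %/ S)
         ((a0 * b1 + a1 * b0 + a2 * b3 + a3 * b2) %/ S)
         ((a0 * b2 + a1 * b1 + a2 * b0 + a3 * b3) %/ S)
         ((a0 * b3 + a1 * b2 + a2 * b1 + a3 * b0) %/ S).
Proof.
move=> ha0 ha1 ha2 ha3 hb0 hb1 hb2 hb3 hZ; rewrite /cmul.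
set p0 := a0 * b0 + _ + _ + _; set p1 := a0 * b1 + _ + _ + _.
set p2 := a0 * b2 + _ + _ + _; set p3 := a0 * b3 + _ + _ + _.
have hm a b : a <= D1 -> b <= D2 -> a * b <= D1 * D2 by exact: leq_mul.
have k0 : p0 + 1 < Z.
  by have := (hm _ _ ha0 hb0, hm _ _ ha1 hb3, hm _ _ ha2 hb2, hm _ _ ha3 hb1);
     rewrite /p0; case; case; case; lia.
have k1 : p1 + 1 < Z.
  by have := (hm _ _ ha0 hb1, hm _ _ ha1 hb0, hm _ _ ha2 hb3, hm _ _ ha3 hb2);
     rewrite /p1; case; case; case; lia.
have k2 : p2 + 1 < Z.
  by have := (hm _ _ ha0 hb2, hm _ _ ha1 hb1, hm _ _ ha2 hb0, hm _ _ ha3 hb3);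
     rewrite /p2; case; case; case; lia.
have k3 : p3 + 1 < Z.
  by have := (hm _ _ ha0 hb3, hm _ _ ha1 hb2, hm _ _ ha2 hb1, hm _ _ ha3 hb0);
     rewrite /p3; case; case; case; lia.
have hP : pack Z p0 p1 p2 p3 < Z ^ 4 - 1.
  have := @pack_lt Z p0.+1 p1 p2 p3; rewrite /pack; lia.
have Z4 : 0 < Z ^ 4 by rewrite expn_gt0; lia.
(* The quotient collects the digits that wrap around; adding it to both sides avoids truncated
   subtraction and leaves a polynomial identity. *)
have hE : pack Z a0 a1 a2 a3 * pack Z b0 b1 b2 b3 =
  ((a1 * b3 + a2 * b2 + a3 * b1) + (a2 * b3 + a3 * b2) * Z + a3 * b3 * Z ^ 2)
    * (Z ^ 4 - 1) + pack Z p0 p1 p2 p3.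
  rewrite mulnBr muln1.
  set q := a1 * b3 + a2 * b2 + a3 * b1 + _ + _.
  have hq : q <= q * Z ^ 4 by rewrite leq_pmulr.
  suff : pack Z a0 a1 a2 a3 * pack Z b0 b1 b2 b3 + q = q * Z ^ 4 + pack Z p0 p1 p2 p3 by lia.
  rewrite /q /pack /p0 /p1 /p2 /p3 !expnS expn0 !muln1; clear; ring.
rewrite hE modnMDl modn_small //.
by have [|||| -> -> -> ->] := @dig_pack Z p0 p1 p2 p3; lia.
Qed.

Section Approx.
Import Order.TTheory GRing.Theory Num.Theory ComplexField.Normc.
Variable R : rcfType.
Local Open Scope ring_scope.

Definition cval (S c0 c1 c2 c3 : nat) : R[i] :=
  Complex ((c0%:R - c2%:R) / S%:R) ((c1%:R - c3%:R) / S%:R).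

(* The word [x] packs four digits, the [k]-th being the coefficient of i^k, each
   at most [D]; divided by the scale [S] it is within [e] of [z]. *)
Definition apx (S Z D x : nat) (z : R[i]) (e : R) : Prop :=
  exists c0 c1 c2 c3, [/\ x = pack Z c0 c1 c2 c3,
    [/\ (c0 <= D)%N, (c1 <= D)%N, (c2 <= D)%N & (c3 <= D)%N] &
    normc (cval S c0 c1 c2 c3 - z) <= e].

Lemma normc_ge0 (z : R[i]) : 0 <= normc z.
Proof. by case: z => a b; exact: sqrtr_ge0. Qed.

Lemma normc_Re (z : R[i]) : `|complex.Re z| <= normc z.
Proof. by case: z => a b /=; rewrite -sqrtr_sqr ler_wsqrtr // lerDl sqr_ge0. Qed.

Lemma normc_Im (z : R[i]) : `|complex.Im z| <= normc z.
Proof. by case: z => a b /=; rewrite -sqrtr_sqr ler_wsqrtr // lerDr sqr_ge0. Qed.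

Lemma normc_le (z : R[i]) : normc z <= `|complex.Re z| + `|complex.Im z|.
Proof.
case: z => a b /=; have h : 0 <= `|a| + `|b| by rewrite addr_ge0.
rewrite -(ger0_norm h) -(sqrtr_sqr (`|a| + `|b|)) ler_wsqrtr //.
rewrite sqrrD !real_normK ?num_real // lerD2r lerDl.
by rewrite mulrn_wge0 // mulr_ge0.
Qed.

Lemma normc_triangle (x y z : R[i]) : normc (x - z) <= normc (x - y) + normc (y - z).
Proof. by have := le_normcD (x - y) (y - z); rewrite addrA subrK. Qed.

Lemma apx_weak S Z D D' x z (e e' : R) :
  apx S Z D x z e -> (D <= D')%N -> e <= e' -> apx S Z D' x z e'.
Proof.
move=> [c0 [c1 [c2 [c3 [-> [h0 h1 h2 h3] he]]]]] hD hE.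
by exists c0, c1, c2, c3; split=> //; [split; lia | exact: le_trans hE].
Qed.

Lemma apx_add S Z D D' x y z z' (e e' : R) :
  apx S Z D x z e -> apx S Z D' y z' e' -> apx S Z (D + D') (x + y) (z + z') (e + e').
Proof.
move=> [a0 [a1 [a2 [a3 [-> [h0 h1 h2 h3] he]]]]] [b0 [b1 [b2 [b3 [-> [g0 g1 g2 g3] ge]]]]].
exists (a0 + b0)%N, (a1 + b1)%N, (a2 + b2)%N, (a3 + b3)%N; split.
- by rewrite /pack !mulnDl; lia.
- by split; lia.
- apply: le_trans (lerD he ge); apply: le_trans (le_normcD _ _).
  rewrite le_eqVlt; apply/orP; left; apply/eqP; congr normc.
  case: z z' {he ge} => zr zi [zr' zi']; rewrite /cval /= !natrD.
  by congr Complex => /=; ring.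
Qed.

Lemma divn_approx (S p : nat) : (0 < S)%N ->
  exists2 d : R, 0 <= d <= 1 & (p %/ S)%:R = p%:R / S%:R - d.
Proof.
move=> S0; exists ((p %% S)%:R / S%:R).
  rewrite divr_ge0 ?ler0n //= ler_pdivrMr ?ltr0n // mul1r ler_nat.
  exact: ltnW (ltn_pmod _ S0).
have S1 : S%:R != 0 :> R by rewrite pnatr_eq0; lia.
by rewrite {2}(divn_eq p S) natrD natrM mulrDl mulfK // addrK.
Qed.

(** The first three error terms come from [AB - zz' = (A - z) z' + z (B - z') + (A - z)(B - z')];
    the last one covers the four digit divisions, each of which loses at most one unit. *)
Lemma apx_mul S Z D D' x y z z' (e e' : R) :
  (0 < S)%N -> (4 * D * D' + 1 < Z)%N ->
  apx S Z D x z e -> apx S Z D' y z' e' ->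
  apx S Z (4 * D * D' %/ S) (cmul S Z x y) (z * z')
    (e * normc z' + normc z * e' + e * e' + 4 / S%:R).
Proof.
move=> S0 hZ [a0 [a1 [a2 [a3 [-> [h0 h1 h2 h3] he]]]]].
move=> [b0 [b1 [b2 [b3 [-> [g0 g1 g2 g3] ge]]]]].
rewrite (@cmul_pack _ _ _ _ _ _ _ _ _ _ D D') //.
set p0 := (a0 * b0 + _ + _ + _)%N; set p1 := (a0 * b1 + _ + _ + _)%N.
set p2 := (a0 * b2 + _ + _ + _)%N; set p3 := (a0 * b3 + _ + _ + _)%N.
exists (p0 %/ S)%N, (p1 %/ S)%N, (p2 %/ S)%N, (p3 %/ S)%N; split=> //.
  have hm a b : (a <= D -> b <= D' -> a * b <= D * D')%N by exact: leq_mul.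
  by split; apply: leq_div2r;
    [have := (hm _ _ h0 g0, hm _ _ h1 g3, hm _ _ h2 g2, hm _ _ h3 g1)
    |have := (hm _ _ h0 g1, hm _ _ h1 g0, hm _ _ h2 g3, hm _ _ h3 g2)
    |have := (hm _ _ h0 g2, hm _ _ h1 g1, hm _ _ h2 g0, hm _ _ h3 g3)
    |have := (hm _ _ h0 g3, hm _ _ h1 g2, hm _ _ h2 g1, hm _ _ h3 g0)];
    case; case; case; lia.
set A := cval S a0 a1 a2 a3 in he *; set B := cval S b0 b1 b2 b3 in ge *.
have S1 : S%:R != 0 :> R by rewrite pnatr_eq0; lia.
have Sp : 0 < S%:R :> R by rewrite ltr0n.
apply: le_trans (normc_triangle _ (A * B) _) _.
have -> : e * normc z' + normc z * e' + e * e' + 4 / S%:R =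
   4 / S%:R + (e * normc z' + normc z * e' + e * e') by ring.
apply: lerD.
  apply: le_trans (normc_le _) _.
  have [d0 hd0 E0] := divn_approx p0 S0; have [d1 hd1 E1] := divn_approx p1 S0.
  have [d2 hd2 E2] := divn_approx p2 S0; have [d3 hd3 E3] := divn_approx p3 S0.
  have -> : cval S (p0 %/ S) (p1 %/ S) (p2 %/ S) (p3 %/ S) - A * B =
    Complex ((d2 - d0) / S%:R) ((d3 - d1) / S%:R).
    rewrite /A /B /cval E0 E1 E2 E3 /p0 /p1 /p2 /p3 !natrD !natrM.
    by congr Complex => /=; field.
  rewrite /= !normrM (ger0_norm (_ : 0 <= S%:R^-1)) ?invr_ge0 ?ler0n // -mulrDl.
  rewrite ler_pM2r ?invr_gt0 //.
  have : `|d2 - d0| <= 1 by rewrite ler_norml; lra.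
  have : `|d3 - d1| <= 1 by rewrite ler_norml; lra.
  lra.
have -> : A * B - z * z' = (A - z) * z' + z * (B - z') + (A - z) * (B - z') by ring.
apply: le_trans (le_normcD _ _) _; apply: lerD.
  apply: le_trans (le_normcD _ _) _; rewrite !normcM; apply: lerD.
    by rewrite ler_wpM2r ?normc_ge0.
  by rewrite ler_wpM2l ?normc_ge0.
by rewrite normcM ler_pM ?normc_ge0.
Qed.

(** After cancellation every digit is at most [S] times the modulus of the represented number. This
    resets the digit bound, which multiplication would otherwise enlarge at each step. *)
Lemma apx_norm S Z D D' x z (e : R) :
  (0 < S)%N -> (D < Z)%N -> S%:R * (normc z + e) <= D'%:R ->
  apx S Z D x z e -> apx S Z D' (cnorm Z x) z e.
Proof.
move=> S0 hD hD' [a0 [a1 [a2 [a3 [-> [h0 h1 h2 h3] he]]]]].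
rewrite /cnorm; have [|||| -> -> -> ->] := @dig_pack Z a0 a1 a2 a3; try lia.
have Sp : 0 < S%:R :> R by rewrite ltr0n.
have bsub (a b : nat) : ((a - b)%N%:R - (b - a)%N%:R = a%:R - b%:R :> R).
  case: (leqP a b) => h.
    by rewrite (eqP (h : (a - b)%N == 0)) natrB // sub0r opprB.
  by rewrite (eqP (ltnW h : (b - a)%N == 0)) natrB 1?ltnW // subr0.
have hn : normc (cval S a0 a1 a2 a3) <= normc z + e.
  have := le_normcD (cval S a0 a1 a2 a3 - z) z; rewrite subrK; lra.
have bnd (a b : nat) : `|(a%:R - b%:R) / S%:R : R| <= normc z + e -> (a - b <= D')%N.
  move=> h; case: (leqP a b) => hab; first by lia.
  rewrite -(ler_nat R); apply: le_trans hD'.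
  rewrite natrB 1?ltnW // mulrC -ler_pdivrMr //; apply: le_trans h.
  exact: ler_norm.
have hr := le_trans (normc_Re _) hn; have hi := le_trans (normc_Im _) hn.
rewrite /= in hr hi.
have hr' := hr; rewrite -normrN -mulNr opprB in hr'.
have hi' := hi; rewrite -normrN -mulNr opprB in hi'.
exists (a0 - a2)%N, (a1 - a3)%N, (a2 - a0)%N, (a3 - a1)%N; split=> //.
  by split; exact: bnd.
by rewrite /cval !bsub.
Qed.

End Approx.

(** * Stockham's fast Fourier transform *)

(* Stockham's self-sorting FFT: at stride [s], entry [q + s e + 2 s p] is fed by
   the two entries [q + s p] and [q + s p + N/2]. *)
Definition src (s o : nat) : nat := o %/ (2 * s) * s + o %% s.

Definition twid (s o : nat) : nat := s * (o %/ (2 * s)) * (o %/ s %% 2).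

(** The second input receives an additional exponent [N / 2] when the output bit is 1. For the roots
    used below this is the factor -1, so a butterfly consists of additions only. *)
Definition twid' (N s o : nat) : nat := (s * (o %/ (2 * s)) + N %/ 2) * (o %/ s %% 2).

Lemma src_split s p e q : q < s -> e < 2 ->
  let o := q + s * e + 2 * s * p in
  [/\ o %/ (2 * s) = p, o %/ s %% 2 = e, o %% s = q & src s o = q + s * p].
Proof.
move=> hq he o; have s0 : 0 < s by lia.
have d1 : o %/ (2 * s) = p.
  have -> : o = p * (2 * s) + (q + s * e) by rewrite /o; lia.
  by rewrite divnMDl ?muln_gt0 // divn_small ?addn0 //; nia.
have d2 : o %% s = q.
  have -> : o = (e + 2 * p) * s + q by rewrite /o; lia.
  by rewrite modnMDl modn_small.
have d3 : o %/ s = e + 2 * p.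
  have -> : o = (e + 2 * p) * s + q by rewrite /o; lia.
  by rewrite divnMDl // divn_small ?addn0.
split=> //; first by rewrite d3 addnC mulnC modnMDl modn_small.
by rewrite /src d1 d2; lia.
Qed.

Lemma src_bounds K l o : l < K -> o < 2 ^ K ->
  [/\ src (2 ^ l) o < 2 ^ K %/ 2, src (2 ^ l) o + 2 ^ K %/ 2 < 2 ^ K,
      twid (2 ^ l) o < 2 ^ K & twid' (2 ^ K) (2 ^ l) o < 2 ^ K].
Proof.
move=> hl ho.
have eK : 2 ^ K = 2 * 2 ^ l * 2 ^ (K - l.+1).
  by rewrite -expnS -expnD; congr expn; lia.
have s0 : 0 < 2 ^ l by rewrite expn_gt0.
have hp : o %/ (2 * 2 ^ l) < 2 ^ (K - l.+1).
  by rewrite ltn_divLR ?muln_gt0 // mulnC -eK.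
have hm : o %% 2 ^ l < 2 ^ l by rewrite ltn_mod.
have he : o %/ 2 ^ l %% 2 < 2 by rewrite ltn_mod.
have h2 : 2 ^ K %/ 2 = 2 ^ l * 2 ^ (K - l.+1).
  by rewrite eK -mulnA mulKn.
rewrite /src /twid /twid' h2 eK.
set s := 2 ^ l in s0 hp hm he *; set n := 2 ^ (K - l.+1) in hp *.
set p := o %/ (2 * s) in hp *; set q := o %% s in hm *.
move: (o %/ s %% 2) he => e he.
have h : p.+1 * s <= n * s by rewrite leq_mul2r hp orbT.
by case: e he => [|[|e]] // _; split; clear -s0 hp hm h; nia.
Qed.

Section Exact.
Import Order.TTheory GRing.Theory Num.Theory ComplexField.Normc.
Variable F : fieldType.
Local Open Scope ring_scope.

Definition xlev (w : F) (N s : nat) (x : nat -> F) (o : nat) : F :=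
  x (src s o) * w ^+ twid s o + x (src s o + N %/ 2)%N * w ^+ twid' N s o.

Fixpoint xfft (w : F) (N l : nat) (x : nat -> F) : nat -> F :=
  if l is l'.+1 then xlev w N (2 ^ l') (xfft w N l' x) else x.

Definition dft (w : F) (N : nat) (x : nat -> F) (k : nat) : F :=
  \sum_(0 <= p < N) x p * w ^+ (p * k).

(** After [l] levels, the entries [q + 2^l p] for fixed [q] form a sequence whose transform of
    length [2^(K-l)], with root [w^(2^l)], is the part of the output congruent to [q] modulo [2^l].
    The inductive step folds the sum over [p] in half and drops a multiple of [2^K] from the
    exponent. *)
Lemma xfft_partial (w : F) K l x q k :
  w ^+ (2 ^ K) = 1 -> (l <= K)%N -> (q < 2 ^ l)%N -> (k < 2 ^ (K - l))%N ->
  \sum_(0 <= p < 2 ^ (K - l)) xfft w (2 ^ K) l x (q + 2 ^ l * p) * w ^+ (2 ^ l * p * k)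
  = dft w (2 ^ K) x (q + 2 ^ l * k).
Proof.
move=> hw; elim: l q k => [|l IH] q k hl hq hk.
  rewrite subn0 expn0 mul1n in hk *; rewrite expn0 in hq.
  have -> : q = 0%N by lia.
  rewrite /dft; apply: eq_bigr => p _; rewrite add0n mul1n /=.
  by congr (_ * _).
set s := (2 ^ l)%N; set n := (2 ^ (K - l.+1))%N in hk *.
have en : (2 ^ (K - l) = n + n)%N.
  by rewrite addnn -mul2n -expnS; congr expn; lia.
have eN : (2 ^ K = 2 * s * n)%N.
  by rewrite /s /n -expnS -expnD; congr expn; lia.
have h2 : (2 ^ K %/ 2 = s * n)%N by rewrite eN -mulnA mulKn.
have [q0 [e [hq0 he eq]]] : exists q0 e, [/\ (q0 < s)%N, (e < 2)%N & q = (q0 + s * e)%N].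
  exists (q %% s)%N, (q %/ s)%N; split.
  - by rewrite ltn_mod expn_gt0.
  - by rewrite ltn_divLR ?expn_gt0 // -expnS.
  - by rewrite addnC mulnC -divn_eq.
have hk' : (e + 2 * k < 2 ^ (K - l))%N by rewrite en; lia.
have := IH q0 (e + 2 * k)%N (ltnW hl) hq0 hk'.
rewrite (_ : q0 + _ * _ = q + 2 ^ l.+1 * k)%N; last by rewrite eq expnS; lia.
move<-; rewrite en (@big_cat_nat _ _ _ n 0 (n + n)) //=; last exact: leq_addr.
rewrite -{3}[n]add0n big_addn addnK -big_split /=.
apply: eq_bigr => p _; rewrite expnS -/s.
rewrite eq; have [d1 d2 d3 d4] := src_split p hq0 he.
rewrite /xlev /twid /twid' d1 d2 d4 h2 mulrDl -!mulrA -!exprD.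
congr (_ * _ ^+ _ + _); first by lia.
rewrite mulnDr addnA; congr (_ * _).
have -> : ((s * p + s * n) * (e + 2 * k) = (s * p + s * n) * e + 2 * s * p * k + 2 ^ K * k)%N.
  by rewrite eN; lia.
by rewrite [RHS]exprD exprM hw expr1n mulr1.
Qed.

Lemma xfft_dft (w : F) K x o : w ^+ (2 ^ K) = 1 -> (o < 2 ^ K)%N ->
  xfft w (2 ^ K) K x o = dft w (2 ^ K) x o.
Proof.
move=> hw ho; have := @xfft_partial w K K x o 0 hw (leqnn _) ho.
rewrite subnn expn0 big_nat1 !muln0 addn0 expr0 mulr1; exact.
Qed.

(** The order of [w] divides [2^K]; were it smaller, it would divide [2^K / 2] and force
    [-1 = 1]. *)
Lemma prim_root_of_half (w : F) K : (0 < K)%N -> (-1 != 1 :> F) ->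
  w ^+ (2 ^ K %/ 2) = -1 -> (2 ^ K).-primitive_root w.
Proof.
case: K => // K _ hn; rewrite {1}expnS mulKn // => hw.
have h1 : w ^+ (2 ^ K.+1) = 1 by rewrite expnS mulnC exprM hw sqrrN expr1n.
have [m hm] := prim_order_exists (expn_gt0 2 K.+1) h1.
case/(dvdn_pfactor _ _ (isT : prime 2)) => j hj em; rewrite em in hm.
move: hj; rewrite leq_eqVlt => /orP[/eqP e|hj]; first by rewrite e in hm.
have : w ^+ (2 ^ K) == 1.
  by rewrite -(prim_order_dvd hm) dvdn_exp2l.
by rewrite hw (negbTE hn).
Qed.

Lemma sum_prim_root (w : F) N m : N.-primitive_root w ->
  \sum_(0 <= k < N) w ^+ (k * m) = if (N %| m)%N then N%:R else 0.
Proof.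
move=> hw; case: ifP => hd.
  rewrite (eq_bigr (fun=> 1)).
    by rewrite big_const_nat subn0 iter_addr_0.
  by move=> k _; apply/eqP; rewrite -(prim_order_dvd hw) dvdn_mull.
have : (w ^+ m - 1) * \sum_(0 <= k < N) w ^+ (k * m) = 0.
  rewrite big_mkord (eq_bigr (fun k : 'I_N => (w ^+ m) ^+ k)); last first.
    by move=> k _; rewrite -exprM mulnC.
  rewrite -subrX1 -exprM mulnC exprM (prim_expr_order hw) expr1n subrr //.
by move/eqP; rewrite mulf_eq0 subr_eq0 -(prim_order_dvd hw) hd => /eqP.
Qed.

(** A second forward transform takes the place of an inverse one: it returns [N] times the cyclic
    self-convolution, read at the negated index. *)
Lemma dft_sqr_dft (w : F) N x m : N.-primitive_root w ->
  dft w N (fun k => dft w N x k * dft w N x k) m =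
  \sum_(0 <= p < N) \sum_(0 <= q < N)
     x p * x q * (if (N %| p + q + m)%N then N%:R else 0).
Proof.
move=> hw; rewrite /dft.
transitivity (\sum_(0 <= k < N) \sum_(0 <= p < N) \sum_(0 <= q < N)
   x p * x q * w ^+ (k * (p + q + m))).
  apply: eq_bigr => k _; rewrite mulr_suml mulr_suml; apply: eq_bigr => p _.
  rewrite mulr_sumr mulr_suml; apply: eq_bigr => q _.
  rewrite !mulnDr !exprD ![(_ * k)%N]mulnC; ring.
rewrite exchange_big /=; apply: eq_bigr => p _.
rewrite exchange_big /=; apply: eq_bigr => q _.
by rewrite -mulr_sumr sum_prim_root.
Qed.

End Exact.

(** * Roots of unity by bisecting angles *)

Section Roots.
Import Order.TTheory GRing.Theory Num.Theory ComplexField.Normc.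
Variable R : rcfType.
Local Open Scope ring_scope.

(** For [z] on the unit circle, [1 + z] bisects the angle between 1 and [z], so normalizing it gives
    a square root of [z]. Starting from [i], [zeta k] has order [2^(k+2)]. *)
Fixpoint zeta (k : nat) : R[i] :=
  if k is k'.+1 then (1 + zeta k') / Complex (normc (1 + zeta k')) 0
  else Complex 0 1.

Lemma normc_one_add (z : R[i]) : 0 <= complex.Re z -> 1 <= normc (1 + z).
Proof.
move=> hz; apply: (le_trans _ (normc_Re _)); case: z hz => a b /= ha.
by rewrite ger0_norm; lra.
Qed.

Lemma normc_sqr (z : R[i]) : normc z ^+ 2 = complex.Re z ^+ 2 + complex.Im z ^+ 2.
Proof. by case: z => a b /=; rewrite sqr_sqrtr // addr_ge0 ?sqr_ge0. Qed.

Lemma divc_real (a b d : R) : Complex a b / Complex d 0 = Complex (a / d) (b / d).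
Proof.
case: (eqVneq d 0) => [->|hd].
  rewrite (_ : Complex 0 0 = 0 :> R[i]) // !invr0 !mulr0 //.
apply: (@mulIf _ (Complex d 0)); first by apply/eqP => -[] /eqP; apply/negP.
rewrite divfK; last by apply/eqP => -[] /eqP; apply/negP.
by rewrite -[RHS]/(Complex _ _); congr Complex => /=; field.
Qed.

Lemma zeta_spec k :
  [/\ normc (zeta k) = 1, 0 <= complex.Re (zeta k) & 0 <= complex.Im (zeta k)].
Proof.
elim: k => [|k [h1 h2 h3]] /=; first by rewrite expr0n add0r expr1n sqrtr1; split.
set y := 1 + zeta k; have hy : 1 <= normc y by exact: normc_one_add.
have hy0 : normc y != 0 by lra.
have hd : normc (Complex (normc y) 0) = normc y.
  by rewrite /= expr0n addr0 sqrtr_sqr ger0_norm // normc_ge0.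
have hr : 0 <= complex.Re y by rewrite /y; case: (zeta k) h2 => a b /=; lra.
have hi : 0 <= complex.Im y by rewrite /y; case: (zeta k) h3 => a b /=; lra.
have hq : 0 <= normc y by lra.
rewrite normcM normcV hd divff //.
by move: (normc y) hq => d hd0; case: y hr hi {hy hy0 hd} => a b hr hi;
  rewrite divc_real; split=> //; exact: divr_ge0.
Qed.

(** If [z] has modulus 1 then the squared modulus of [1 + z] is [2 (1 + Re z)], and the division
    comes out as [z]. *)
Lemma zeta_sqr k : zeta k.+1 ^+ 2 = zeta k.
Proof.
have [h1 h2 h3] := zeta_spec k; have := normc_sqr (zeta k).
rewrite h1 expr1n [zeta k.+1]/=; have := normc_one_add h2.
have : 1 + zeta k = Complex (1 + complex.Re (zeta k)) (complex.Im (zeta k)).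
  by case: (zeta k) => a b; rewrite -[LHS]/(Complex (1 + a) (0 + b)) add0r.
case: (zeta k) h2 => a b; rewrite [complex.Re _]/= [complex.Im _]/= => ha.
move: (1 + _) => y -> hy hab.
have hd := normc_sqr (Complex (1 + a) b).
move: (normc _) hy hd => d /= hy hd.
have hd0 : d != 0 by lra.
rewrite divc_real expr2 -[LHS]/(Complex _ _); congr Complex => /=; last first.
  have -> : (1 + a) / d * (b / d) + b / d * ((1 + a) / d) = 2 * (1 + a) * b / d ^+ 2 by field.
  have -> : d ^+ 2 = 2 * (1 + a) by rewrite hd; lra.
  by field; lra.
have -> : (1 + a) / d * ((1 + a) / d) - b / d * (b / d) = ((1 + a) ^+ 2 - b ^+ 2) / d ^+ 2 by field.
have -> : d ^+ 2 = 2 * (1 + a) by rewrite hd; lra.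
have -> : (1 + a) ^+ 2 - b ^+ 2 = 2 * (1 + a) * a by lra.
by field; lra.
Qed.

Lemma zeta_pow k : zeta k ^+ (2 ^ k) = Complex 0 1.
Proof. by elim: k => [|k IH]; rewrite ?expr1 // expnS exprM zeta_sqr. Qed.

Lemma zeta_half K : (2 <= K)%N -> zeta (K - 2) ^+ (2 ^ K %/ 2) = -1.
Proof.
move=> hK; have -> : (2 ^ K %/ 2 = 2 ^ (K - 2) * 2)%N.
  by rewrite -{1}(subnK hK) expnD mulnA mulnK.
rewrite exprM zeta_pow expr2 -[LHS]/(Complex _ _) -[RHS]/(Complex _ _).
by congr Complex => /=; ring.
Qed.

End Roots.

(** * Rounding errors *)

Definition nlev (S Z N : nat) (W : nat -> nat) (s : nat) (x : nat -> nat) (o : nat) : nat :=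
  cmul S Z (x (src s o)) (W (twid s o)) +
  cmul S Z (x (src s o + N %/ 2)) (W (twid' N s o)).

Fixpoint nfft (S Z N : nat) (W : nat -> nat) (l : nat) (x : nat -> nat) : nat -> nat :=
  if l is l'.+1 then nlev S Z N W (2 ^ l') (nfft S Z N W l' x) else x.

(** One bisection as in [zeta], on real and imaginary parts in units of [1/S]. Starting from
    [(0, S)], that is [i], all angles stay in the first quadrant and no signs are needed. *)
Definition rstep (S : nat) (z : nat * nat) : nat * nat :=
  let u := S + z.1 in
  let d := Nat.sqrt (u * u + z.2 * z.2) in (u * S %/ d, z.2 * S %/ d).

Definition rootp (S k : nat) : nat * nat := iter k (rstep S) (0, S).

Fixpoint wtab (S Z r j : nat) : nat :=
  if j is j'.+1 then cnorm Z (cmul S Z (wtab S Z r j') r) else S.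

(** Put [N = 2^K]. Two transforms and a squaring accumulate an error of at most [65 N^8 / S], which
    [S = N^16] pushes below 1/4. The radix [N^48 = N^16 S^2] exceeds the largest coefficient that
    occurs, [32 N^12 S^2]. *)
Definition scale (K : nat) : nat := (2 ^ K) ^ 16.

Definition radix (K : nat) : nat := (2 ^ K) ^ 48.

Definition rtab (K : nat) : nat -> nat :=
  wtab (scale K) (radix K)
    ((rootp (scale K) (K - 2)).1 + (rootp (scale K) (K - 2)).2 * radix K).

Definition spectrum (K : nat) (B : nat -> nat) : nat -> nat :=
  nfft (scale K) (radix K) (2 ^ K) (rtab K) K (fun o => B o * scale K).

Definition conv_raw (K : nat) (B : nat -> nat) : nat -> nat :=
  nfft (scale K) (radix K) (2 ^ K) (rtab K) K
    (fun o => cmul (scale K) (radix K) (spectrum K B o) (spectrum K B o)).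

(** The index [2^K - m] undoes the negation caused by using the forward transform twice. Doubling
    and dividing by [S] compares the real part with 1/2, and [1 - (1 - v)] caps the outcome at 1. *)
Definition conv (K : nat) (B : nat -> nat) (m : nat) : nat :=
  let y := conv_raw K B ((2 ^ K - m) %% 2 ^ K) in
  1 - (1 - (dig (radix K) 0 y - dig (radix K) 2 y) * 2 %/ scale K).

Section Errors.
Import Order.TTheory GRing.Theory Num.Theory ComplexField.Normc.
Variable R : rcfType.
Local Open Scope ring_scope.

Lemma apx_real S Z D (x : nat) : (0 < S)%N -> (x * S <= D)%N ->
  apx S Z D (x * S) (x%:R : R[i]) 0.
Proof.
move=> S0 hx; exists (x * S)%N, 0%N, 0%N, 0%N; split; first by rewrite /pack; lia.
  by split; lia.
have S1 : S%:R != 0 :> R by rewrite pnatr_eq0; lia.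
rewrite /cval subr0 subrr mul0r natrM mulfK //.
rewrite (_ : Complex x%:R 0 = x%:R); first by rewrite subrr normc0.
by rewrite -[RHS](rmorph_nat (real_complex R)).
Qed.

(** Each level adds two products with table entries whose digits are at most [2 S]: a product
    multiplies digits by 8 and turns an error [E] into at most [2 E + c / 2]. Hence digits grow by
    16 per level, exact values by 2, and the closed form dominates the recursion [E -> 4 E + c]. *)
Lemma nfft_apx S Z K W (w : R[i]) delta X x D (e A : R) :
  (0 < S)%N -> (4 * (16 ^ K * D) * (2 * S) + 1 < Z)%N ->
  normc w = 1 -> 0 <= delta -> delta <= 1 -> 0 <= e ->
  (forall j, (j < 2 ^ K)%N -> apx S Z (2 * S) (W j) (w ^+ j) delta) ->
  (forall o, (o < 2 ^ K)%N -> apx S Z D (X o) (x o) e /\ normc (x o) <= A) ->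
  let c := 2 ^+ K.+1 * A * delta + 8 / S%:R in
  forall l, (l <= K)%N -> forall o, (o < 2 ^ K)%N ->
    apx S Z (16 ^ l * D) (nfft S Z (2 ^ K) W l X o) (xfft w (2 ^ K) l x o)
      (4 ^+ l * (e + c) - c) /\
    normc (xfft w (2 ^ K) l x o) <= 2 ^+ l * A.
Proof.
move=> S0 hZ hw hd0 hd1 he hW hX c.
have Sp : 0 < S%:R :> R by rewrite ltr0n.
have hA : 0 <= A.
  by have [_] := hX 0%N (expn_gt0 2 K); apply: le_trans; exact: normc_ge0.
have hc : 0 <= c by rewrite addr_ge0 ?mulr_ge0 ?exprn_ge0 ?invr_ge0 ?ler0n.
have hwj j : normc (w ^+ j) = 1.
  by elim: j => [|j IH]; rewrite ?expr0 ?normc1 // exprS normcM hw IH mulr1.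
elim=> [|l IH] hl o ho.
  by have [h1 h2] := hX o ho; rewrite !expr0 !mul1r mul1n addrK.
have [b1 b2 b3 b4] := src_bounds hl ho.
have [E eE] : exists E, E = 4 ^+ l * (e + c) - c by eexists.
rewrite -eE in IH.
have hE : 0 <= E.
  have : 1 <= 4 ^+ l :> R by apply: exprn_ege1; lra.
  by rewrite eE; nra.
have hlK : 2 ^+ l.+1 * A * delta <= 2 ^+ K * A * delta.
  rewrite !ler_wpM2r // ler_weXn2l //; lra.
have key i j : (i < 2 ^ K)%N -> (j < 2 ^ K)%N ->
    apx S Z (8 * (16 ^ l * D)) (cmul S Z (nfft S Z (2 ^ K) W l X i) (W j))
      (xfft w (2 ^ K) l x i * w ^+ j) (2 * E + c / 2) /\
    normc (xfft w (2 ^ K) l x i * w ^+ j) <= 2 ^+ l * A.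
  move=> hi hj; have [h1 h2] := IH (ltnW hl) i hi.
  split; last by rewrite normcM hwj mulr1.
  have hZl : (4 * (16 ^ l * D) * (2 * S) + 1 < Z)%N.
    apply: leq_ltn_trans hZ; rewrite leq_add2r leq_mul2r leq_mul2l leq_mul2r.
    by rewrite leq_exp2l // (ltnW hl) !orbT.
  apply: apx_weak (apx_mul S0 hZl h1 (hW j hj)) _ _.
    rewrite (_ : 4 * _ * _ = 8 * (16 ^ l * D) * S)%N ?mulnK //.
    by move: (16 ^ l * D)%N => y; clear; lia.
  rewrite hwj mulr1 /c.
  have : normc (xfft w (2 ^ K) l x i) * delta <= 2 ^+ l * A * delta by rewrite ler_wpM2r.
  have : E * delta <= E by rewrite ler_piMr.
  have : 0 <= 2 ^+ K * A * delta by rewrite !mulr_ge0 ?exprn_ge0.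
  move: hlK; rewrite !exprS; lra.
have [k1 n1] := key _ _ (leq_ltn_trans (leq_addr _ _) b2) b3.
have [k2 n2] := key _ _ b2 b4.
split; last by apply: le_trans (le_normcD _ _) _; rewrite exprS; lra.
apply: apx_weak (apx_add k1 k2) _ _.
  by rewrite expnS -mulnA; move: (16 ^ l * D)%N => y; clear; lia.
by rewrite exprS; lra.
Qed.

Lemma sqrt_bounds v : (Nat.sqrt v ^ 2 <= v < (Nat.sqrt v).+1 ^ 2)%N.
Proof. by have := PeanoNat.Nat.sqrt_spec v; rewrite -!mulnn; lia. Qed.

(* Rounding down the denominator and then the quotient moves [p S / d] by at
   most one unit, because [p] is at most the exact denominator. *)
Lemma round_div (S d p : nat) (t : R) :
  (0 < S)%N -> (S <= d)%N -> d%:R <= t * S%:R -> t * S%:R < d%:R + 1 ->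
  (p%:R : R) <= t * S%:R ->
  `|(p * S %/ d)%:R / S%:R - p%:R / S%:R / t| <= S%:R^-1.
Proof.
move=> S0 hd h1 h2 h3.
have Sp : 0 < S%:R :> R by rewrite ltr0n.
have dp : 0 < d%:R :> R by rewrite ltr0n; lia.
have hSd : S%:R <= d%:R :> R by rewrite ler_nat.
have tp : 0 < t by rewrite -(pmulr_lgt0 _ Sp); lra.
have d0 : (0 < d)%N by lia.
have [r /andP[hr0 hr1] ->] := @divn_approx R d (p * S) d0.
rewrite natrM.
have -> : (p%:R * S%:R / d%:R - r) / S%:R - p%:R / S%:R / t =
  (p%:R / (t * S%:R) * ((t * S%:R - d%:R) * (S%:R / d%:R)) - r) / S%:R.
  by field; rewrite !gt_eqF.
rewrite normrM (ger0_norm (_ : 0 <= S%:R^-1)) ?invr_ge0 ?ler0n //.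
rewrite ler_piMl ?invr_ge0 ?ler0n //.
have tS : 0 < t * S%:R by rewrite mulr_gt0.
have q1 : p%:R / (t * S%:R) <= 1 by rewrite ler_pdivrMr // mul1r.
have q0 : 0 <= p%:R / (t * S%:R) by rewrite divr_ge0 // ltW.
have u1 : S%:R / d%:R <= 1 :> R by rewrite ler_pdivrMr // mul1r.
have u0 : 0 <= S%:R / d%:R :> R by rewrite divr_ge0 // ltW.
have v0 : 0 <= (t * S%:R - d%:R) * (S%:R / d%:R) by rewrite mulr_ge0 //; lra.
have v1 : (t * S%:R - d%:R) * (S%:R / d%:R) <= 1 by rewrite mulr_ile1 //; lra.
have x0 := mulr_ge0 q0 v0; have x1 := mulr_ile1 q0 v0 q1 v1.
by rewrite ler_norml; lra.
Qed.

(** Outside the unit disc normalization is 2-Lipschitz: one [e] for moving the numerator and one for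
    the change of modulus, both divided by a modulus of at least 1. *)
Lemma normalize_close (y y' : R[i]) (e : R) :
  1 <= normc y -> 1 <= normc y' -> normc (y' - y) <= e ->
  normc (y' / Complex (normc y') 0 - y / Complex (normc y) 0) <= 2 * e.
Proof.
move=> hy hy' he.
set n := normc y in hy *; set n' := normc y' in hy' *.
have hC (d : R) : d != 0 -> Complex d 0 != 0 :> R[i].
  by move=> hd; apply/eqP => -[] /eqP; apply/negP.
have n0 : n != 0 by lra. have n0' : n' != 0 by lra.
have nC (d : R) : 0 <= d -> normc (Complex d 0) = d.
  by move=> hd; rewrite /= expr0n addr0 sqrtr_sqr ger0_norm.
have -> : y' / Complex n' 0 - y / Complex n 0 =
  (y' - y) / Complex n 0 + y' / Complex n' 0 * (Complex (n - n') 0 / Complex n 0).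
  have -> : Complex (n - n') 0 = Complex n 0 - Complex n' 0.
    by rewrite -[RHS]/(Complex _ _); congr Complex => /=; ring.
  by field; rewrite !hC.
have hnn : `|n - n'| <= e.
  rewrite ler_norml; have := normc_triangle y y' 0; have := normc_triangle y' y 0.
  by rewrite !subr0 -/n -/n' -(normcN (y - y')) opprB; lra.
apply: le_trans (le_normcD _ _) _.
rewrite !normcM !normcV (nC n) ?(nC n') ?normc_ge0 //.
have -> : normc (Complex (n - n') 0) = `|n - n'|.
  by rewrite /= expr0n addr0 sqrtr_sqr.
rewrite -/n' divff // mul1r.
have i1 : n^-1 <= 1 by rewrite invf_le1; lra.
have i0 : 0 <= n^-1 by rewrite invr_ge0; lra.
have := ler_pM (normc_ge0 _) i0 he i1; have := ler_pM (normr_ge0 _) i0 hnn i1.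
lra.
Qed.

(** A bisection doubles the inherited error and adds [2 / S] for rounding the two coordinates;
    [2^(k+1) - 2] solves this recursion. *)
Lemma rootp_close S k : (0 < S)%N ->
  normc (Complex ((rootp S k).1%:R / S%:R) ((rootp S k).2%:R / S%:R) - zeta R k)
    <= (2 ^+ k.+1 - 2) / S%:R.
Proof.
move=> S0; have Sp : 0 < S%:R :> R by rewrite ltr0n.
have S1 : S%:R != 0 :> R by rewrite gt_eqF.
elim: k => [|k IH].
  rewrite /rootp /= (_ : (0%N)%:R = 0) // mul0r subr0 divff // subrr !expr0n /= addr0.
  by rewrite sqrtr0 expr1 subrr mul0r.
rewrite /rootp iterS -/(rootp S k); case: (rootp S k) IH => a b.
rewrite [(a, b).1]/= [(a, b).2]/= => IH; rewrite /rstep [(a, b).1]/= [(a, b).2]/=.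
set u := (S + a)%N; set v := (u * u + b * b)%N; set d := Nat.sqrt v.
rewrite [(_, _).1]/= [(_, _).2]/=.
set y' : R[i] := Complex (u%:R / S%:R) (b%:R / S%:R).
set y : R[i] := 1 + zeta R k.
have [z1 z2 z3] := zeta_spec R k.
have hy : 1 <= normc y by exact: normc_one_add.
have ey' : y' = 1 + Complex (a%:R / S%:R) (b%:R / S%:R).
  rewrite -[RHS]/(Complex _ _) /y' /u natrD; congr Complex => /=; first by field.
  by rewrite add0r.
have hy' : 1 <= normc y'.
  by rewrite ey'; apply: normc_one_add; rewrite /= divr_ge0 ?ler0n.
have hyy : normc (y' - y) <= (2 ^+ k.+1 - 2) / S%:R.
  by rewrite ey' /y opprD addrACA subrr add0r.
have hclose := normalize_close hy hy' hyy.
have [/andP[hd1 hd2]] : (d ^ 2 <= v < d.+1 ^ 2)%N /\ True by split; first exact: sqrt_bounds.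
move=> _.
set t := normc y' in hy' hclose *.
have ht : (t * S%:R) ^+ 2 = v%:R.
  rewrite exprMn normc_sqr /= /v natrD !natrM; field.
  by rewrite S1.
have tS0 : 0 <= t * S%:R by rewrite mulr_ge0 ?ler0n // normc_ge0.
have t1 : d%:R <= t * S%:R.
  by rewrite -(ler_pXn2r (isT : (0 < 2)%N)) ?nnegrE ?ler0n // ht -natrX ler_nat.
have t2 : t * S%:R < d%:R + 1.
  rewrite natr1 -(ltr_pXn2r (isT : (0 < 2)%N)) ?nnegrE ?ler0n // ht -natrX ltr_nat //.
have hSd : (S <= d)%N.
  rewrite -ltnS -(ltn_exp2r _ _ (isT : (0 < 2)%N)); apply: leq_ltn_trans hd2.
  by rewrite /v -mulnn; apply: leq_trans (leq_addr _ _); rewrite leq_mul // leq_addr.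
have t3 : (u%:R : R) <= t * S%:R.
  rewrite -(ler_pXn2r (isT : (0 < 2)%N)) ?nnegrE ?ler0n // ht -natrX ler_nat /v -mulnn.
  exact: leq_addr.
have t4 : (b%:R : R) <= t * S%:R.
  rewrite -(ler_pXn2r (isT : (0 < 2)%N)) ?nnegrE ?ler0n // ht -natrX ler_nat /v -mulnn.
  exact: leq_addl.
have r1 := round_div S0 hSd t1 t2 t3; have r2 := round_div S0 hSd t1 t2 t4.
apply: le_trans (normc_triangle _ (y' / Complex t 0) _) _.
rewrite -[zeta R k.+1]/(y / Complex (normc y) 0).
have : normc (Complex ((u * S %/ d)%:R / S%:R) ((b * S %/ d)%:R / S%:R) - y' / Complex t 0) <= 2 / S%:R.
  apply: le_trans (normc_le _) _; rewrite /y' divc_real.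
  rewrite [complex.Re _]/= [complex.Im _]/=; lra.
rewrite [2 ^+ k.+2]exprS; move: hclose; lra.
Qed.

(** As long as the accumulated error is at most 1, one more factor adds at most [2 e + 4 / S], so
    the error grows linearly in [j]. Normalizing each power keeps its digits at [2 S]. *)
Lemma wtab_apx S Z r M (w : R[i]) (e : R) :
  (0 < S)%N -> (16 * S * S + 1 < Z)%N -> normc w = 1 -> 0 <= e ->
  M%:R * (2 * e + 4 / S%:R) <= 1 -> apx S Z (2 * S) r w e ->
  forall j, (j <= M)%N ->
  apx S Z (2 * S) (wtab S Z r j) (w ^+ j) (j%:R * (2 * e + 4 / S%:R)).
Proof.
move=> S0 hZ w1 he0 hM hrA; have Sp : 0 < S%:R :> R by rewrite ltr0n.
have h4S : 0 <= 4 / S%:R :> R by rewrite divr_ge0 // ltW.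
elim=> [_|i IH hi].
  rewrite mul0r expr0; have := @apx_real S Z (2 * S) 1 S0.
  by rewrite mul1n; apply; lia.
have hwi : normc (w ^+ i) = 1.
  by elim: (i) => [|m IHm]; rewrite ?expr0 ?normc1 // exprS normcM w1 IHm mulr1.
have ef : i.+1%:R * (2 * e + 4 / S%:R) = i%:R * (2 * e + 4 / S%:R) + (2 * e + 4 / S%:R).
  by rewrite -natr1; ring.
have hf : i.+1%:R * (2 * e + 4 / S%:R) <= 1.
  apply: le_trans hM; rewrite ler_wpM2r ?ler_nat //; lra.
have f0 : 0 <= i%:R * (2 * e + 4 / S%:R) by rewrite mulr_ge0 ?ler0n //; lra.
rewrite ef in hf *; move: (i%:R * _) {IH}(IH (ltnW hi)) f0 hf => f IH f0 hf.
have hm : (4 * (2 * S) * (2 * S) + 1 < Z)%N by apply: leq_ltn_trans hZ; lia.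
have := apx_mul S0 hm IH hrA; rewrite hwi w1 mulr1 mul1r => hx.
have hx' : apx S Z (16 * S) (cmul S Z (wtab S Z r i) r) (w ^+ i * w) (f + (2 * e + 4 / S%:R)).
  apply: apx_weak hx _ _.
    have -> : (4 * (2 * S) * (2 * S) = 16 * S * S)%N by lia.
    by rewrite mulnK.
  have : f * e <= e by rewrite ler_piMl //; lra.
  lra.
rewrite exprSr; apply: (apx_norm S0 _ _ hx').
  have : (16 * S <= 16 * S * S)%N by rewrite leq_pmulr.
  lia.
rewrite normcM hwi w1 mulr1 natrM mulrC ler_wpM2r ?ler0n //; lra.
Qed.

Lemma rtab_apx K j : (2 <= K)%N -> (j < 2 ^ K)%N ->
  apx (scale K) (radix K) (2 * scale K) (rtab K j) (zeta R (K - 2) ^+ j)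
    (4 * (2 ^+ K) ^+ 2 / (scale K)%:R).
Proof.
move=> hK; set S := scale K; set Z := radix K; set N : R := 2 ^+ K.
set w := zeta R (K - 2).
have hN4 : (4 <= 2 ^ K)%N by rewrite -[4%N]/(2 ^ 2)%N leq_exp2l.
have S0 : (0 < S)%N by rewrite /S /scale !expn_gt0.
have Sp : 0 < S%:R :> R by rewrite ltr0n.
have hNR : N = (2 ^ K)%N%:R by rewrite natrX.
have N4 : 4 <= N by rewrite hNR (ler_nat R 4).
have SN : S%:R = N ^+ 16 by rewrite hNR -natrX.
have NN : N ^+ 3 <= S%:R by rewrite SN ler_weXn2l //; lra.
have [w1 _ _] := zeta_spec R (K - 2); rewrite -/w in w1.
set e := N / S%:R.
have he0 : 0 <= e by rewrite divr_ge0 //; lra.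
have hr : normc (Complex ((rootp S (K - 2)).1%:R / S%:R) ((rootp S (K - 2)).2%:R / S%:R) - w) <= e.
  apply: le_trans (rootp_close _ S0) _; rewrite ler_pM2r ?invr_gt0 //.
  apply: le_trans (_ : 2 ^+ (K - 2).+1 <= _); first by lra.
  by rewrite ler_weXn2l //; [lra | lia].
set a := (rootp S (K - 2)).1 in hr *; set b := (rootp S (K - 2)).2 in hr *.
have hbound : N * (2 * e + 4 / S%:R) <= 4 * N ^+ 2 / S%:R.
  rewrite /e (_ : N * _ = (2 * N ^+ 2 + 4 * N) / S%:R); last by field; rewrite gt_eqF.
  by rewrite ler_pM2r ?invr_gt0 //; nra.
have hle1 : 4 * N ^+ 2 / S%:R <= 1.
  rewrite ler_pdivrMr // mul1r; apply: le_trans NN; rewrite [N ^+ 3]exprS.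
  by rewrite ler_wpM2r ?sqr_ge0.
have e1 : e <= 1.
  apply: le_trans hle1; apply: le_trans hbound.
  have : 0 <= 4 / S%:R :> R by rewrite divr_ge0 // ltW.
  nra.
have hS4 : (4 <= S)%N.
  by rewrite -(ler_nat R) SN; apply: (le_trans (N4)); rewrite ler_eXnr //; lra.
have hZ : (16 * S * S + 1 < Z)%N.
  have -> : Z = (S * S * S)%N by rewrite /Z /S /radix /scale -!expnD.
  have : (16 < S)%N.
    have h3 : (4 ^ 3 <= (2 ^ K) ^ 3)%N by rewrite leq_exp2r.
    have h16 : ((2 ^ K) ^ 3 <= (2 ^ K) ^ 16)%N by rewrite leq_exp2l //; lia.
    by have := leq_trans h3 h16; rewrite -/(scale K) -/S; apply: leq_trans.
  nia.
have hrA : apx S Z (2 * S) (a + b * Z) w e.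
  exists a, b, 0%N, 0%N; split; first by rewrite /pack; lia.
    have hn : normc (Complex (a%:R / S%:R) (b%:R / S%:R) : R[i]) <= 2.
      have := le_normcD (Complex (a%:R / S%:R) (b%:R / S%:R) - w) w; rewrite subrK; lra.
    have ha := le_trans (normc_Re _) hn; have hb := le_trans (normc_Im _) hn.
    rewrite /= ger0_norm ?divr_ge0 ?ler0n // ler_pdivrMr // -natrM ler_nat in ha.
    rewrite /= ger0_norm ?divr_ge0 ?ler0n // ler_pdivrMr // -natrM ler_nat in hb.
    by split.
  by rewrite /cval !subr0.
have hM : (2 ^ K)%N%:R * (2 * e + 4 / S%:R) <= 1.
  by rewrite -hNR; exact: le_trans hbound hle1.
move=> hj; apply: apx_weak (wtab_apx S0 hZ w1 he0 hM hrA (ltnW hj)) _ _ => //.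
apply: le_trans hbound; rewrite ler_wpM2r //.
  have : 0 <= 4 / S%:R :> R by rewrite divr_ge0 // ltW.
  lra.
by rewrite hNR ler_nat ltnW.
Qed.

End Errors.

(** * Sumsets from a rounded cyclic convolution *)

Section Convolution.
Import Order.TTheory GRing.Theory Num.Theory ComplexField.Normc.
Variable R : rcfType.
Local Open Scope ring_scope.

Lemma scale_facts K : (2 <= K)%N ->
  exists n S Z : nat, [/\ n = (2 ^ K)%N, S = scale K, Z = radix K, (4 <= n)%N &
   [/\ (0 < S)%N, Z = (n ^ 16 * S * S)%N, (n ^ 4 = 16 ^ K)%N, (256 <= n ^ 4)%N &
       (S%:R : R) = n%:R ^+ 16]].
Proof.
move=> hK; exists (2 ^ K)%N, (scale K), (radix K).
have hN4 : (4 <= 2 ^ K)%N by rewrite -[4%N]/(2 ^ 2)%N leq_exp2l.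
split=> //; split.
- by rewrite /scale !expn_gt0.
- by rewrite /radix /scale -!expnD.
- by rewrite -[16%N]/(2 ^ 4)%N -!expnM mulnC.
- by rewrite -[256%N]/(4 ^ 4)%N leq_exp2r.
- by rewrite /scale natrX.
Qed.

(** The input is represented without error. With [N = 2^K], the first transform brings the error to
    [16 N^5 / S], squaring values of modulus at most [N] to [49 N^6 / S], and the second transform
    contributes another factor [N^2]. *)
Lemma conv_raw_apx K (B : nat -> nat) m : (2 <= K)%N ->
  (forall o, B o <= 1)%N -> (m < 2 ^ K)%N ->
  let w := zeta R (K - 2) in let x p : R[i] := (B p)%:R in
  exists2 D, (D < radix K)%N &
  apx (scale K) (radix K) D (conv_raw K B m)
    (dft w (2 ^ K) (fun k => dft w (2 ^ K) x k * dft w (2 ^ K) x k) m) (1 / 4).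
Proof.
move=> hK hB hm w x.
have [w1 _ _] := zeta_spec R (K - 2); rewrite -/w in w1.
have hw : w ^+ (2 ^ K) = 1.
  have -> : (2 ^ K = 2 ^ K %/ 2 * 2)%N.
    by rewrite divnK // -{1}[K]subn0 -(subnSK (ltnW hK)) expnS dvdn_mulr.
  by rewrite exprM zeta_half // sqrrN expr1n.
have hW j : (j < 2 ^ K)%N -> apx (scale K) (radix K) (2 * scale K) (rtab K j) (w ^+ j)
    (4 * (2 ^+ K) ^+ 2 / (scale K)%:R) by exact: rtab_apx.
rewrite /conv_raw /spectrum.
have [n [S [Z [en eS eZ hn [S0 hZ hn4 h256 hS]]]]] := scale_facts hK.
rewrite -eS -eZ in hW *; move: (rtab K) hW => W hW.
set N : R := 2 ^+ K in hW.
have hN : N = n%:R by rewrite en natrX.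
have N4 : 4 <= N by rewrite hN (ler_nat R 4).
have SN : S%:R = N ^+ 16 by rewrite hN.
have Sp : 0 < S%:R :> R by rewrite ltr0n.
have N2K : 4 ^+ K = N ^+ 2 :> R by rewrite (_ : 4 = 2 ^+ 2) ?/N -?exprM 1?mulnC // -natrX.
clear eS eZ hS.
have N0 : 0 <= N by lra.
have hpow i j : (i <= j)%N -> N ^+ i <= N ^+ j by move=> hij; rewrite ler_weXn2l //; lra.
have hd0 : 0 <= 4 * N ^+ 2 / S%:R by rewrite divr_ge0 ?mulr_ge0 ?exprn_ge0 // ltW.
have big i j : (i <= j)%N -> 4 ^+ (j - i) * N ^+ i <= N ^+ j.
  move=> hij; rewrite -{2}(subnK hij) exprD ler_wpM2r ?exprn_ge0 //.
  by rewrite lerXn2r // nnegrE.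
have hd1 : 4 * N ^+ 2 / S%:R <= 1.
  rewrite ler_pdivrMr // mul1r SN; apply: le_trans (hpow 3 16 isT).
  by have := big 2%N 3%N isT; rewrite expr1.
have hZ1 : (32 * n ^ 12 * S * S + 1 < Z)%N.
  rewrite hZ (_ : 16 = 4 + 12)%N // expnD.
  have : (256 * n ^ 12 <= n ^ 4 * n ^ 12)%N by rewrite leq_mul2r h256 orbT.
  move: (n ^ 4 * _)%N => a ha.
  have hp : (0 < n ^ 12 * S * S)%N by rewrite 2!muln_gt0 expn_gt0 S0 !andbT; lia.
  have : (256 * n ^ 12 * S * S <= a * S * S)%N by rewrite !leq_mul.
  lia.
have hmono i j : (i <= j)%N -> (n ^ i * S * S <= n ^ j * S * S)%N.
  by move=> hij; rewrite !leq_mul // leq_exp2l //; lia.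
have m4 := hmono 4%N 12%N isT; have m8 := hmono 8%N 12%N isT.
have c1 : (4 * (16 ^ K * S) * (2 * S) + 1 < Z)%N by rewrite -hn4; lia.
have [first1 first2] : (forall o, (o < 2 ^ K)%N ->
   apx S Z (n ^ 4 * S) (nfft S Z (2 ^ K) W K (fun o => B o * S)%N o) (dft w (2 ^ K) x o)
     (16 * N ^+ 5 / S%:R)) /\
   forall o, (o < 2 ^ K)%N -> normc (dft w (2 ^ K) x o) <= N.
  have hX o : (o < 2 ^ K)%N -> apx S Z S (B o * S) (x o) 0 /\ normc (x o) <= 1.
    move=> _; split; first by apply: apx_real => //; rewrite -[X in (_ <= X)%N]mul1n leq_mul.
    by rewrite /x; case: (B o) (hB o) => [|[|]] // _; rewrite ?normc0 ?normc1.
  have H := @nfft_apx R S Z K W w _ _ x S 0 1 S0 c1 w1 hd0 hd1 (lexx 0) hW hX K (leqnn K).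
  split=> o ho; have [h1 h2] := H o ho; last first.
    by rewrite -(xfft_dft _ hw ho); apply: le_trans h2 _; rewrite mulr1.
  rewrite -(xfft_dft _ hw ho); apply: apx_weak h1 _ _; first by rewrite hn4.
  rewrite add0r mulr1 [2 ^+ K.+1]exprS -/N N2K.
  have -> : 2 * N * (4 * N ^+ 2 / S%:R) + 8 / S%:R = (8 * N ^+ 3 + 8) / S%:R by field; rewrite gt_eqF.
  have : (8 * N ^+ 3 + 8) / S%:R * N ^+ 2 <= 16 * N ^+ 5 / S%:R.
    rewrite mulrAC ler_pM2r ?invr_gt0 // mulrDl -mulrA -exprD.
    have := hpow 2%N 5%N isT; lra.
  have : 0 <= (8 * N ^+ 3 + 8) / S%:R.
    by rewrite divr_ge0 ?addr_ge0 ?mulr_ge0 ?exprn_ge0 // ltW.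
  lra.
set X1 := nfft _ _ _ _ _ _ in first1 *.
have hE1 : 0 <= 16 * N ^+ 5 / S%:R by rewrite divr_ge0 ?mulr_ge0 ?exprn_ge0 // ltW.
have hE1' : 16 * N ^+ 5 / S%:R <= 1.
  rewrite ler_pdivrMr // mul1r SN; apply: le_trans (hpow 7 16 isT).
  by have := big 5%N 7%N isT; rewrite (_ : 4 ^+ _ = 16) //; rewrite -natrX.
have c2 : (4 * (n ^ 4 * S) * (n ^ 4 * S) + 1 < Z)%N.
  apply: leq_ltn_trans hZ1; rewrite leq_add2r.
  have -> : (4 * (n ^ 4 * S) * (n ^ 4 * S) = 4 * (n ^ 8 * S * S))%N.
    by rewrite (_ : 8 = 4 + 4)%N // expnD; ring.
  lia.
have second o : (o < 2 ^ K)%N ->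
  apx S Z (4 * n ^ 8 * S) (cmul S Z (X1 o) (X1 o))
    (dft w (2 ^ K) x o * dft w (2 ^ K) x o) (49 * N ^+ 6 / S%:R) /\
  normc (dft w (2 ^ K) x o * dft w (2 ^ K) x o) <= N ^+ 2.
  move=> ho; have h1 := first1 o ho; have h2 := first2 o ho; split; last first.
    by rewrite normcM expr2 ler_pM ?normc_ge0.
  apply: apx_weak (apx_mul S0 c2 h1 h1) _ _.
    have -> : (4 * (n ^ 4 * S) * (n ^ 4 * S) = 4 * n ^ 8 * S * S)%N.
      by rewrite (_ : 8 = 4 + 4)%N // expnD; ring.
    by rewrite mulnK.
  set v := normc _ in h2 *; set E := 16 * _ / _ in hE1 hE1' *.
  have hEv : E * v <= E * N by rewrite ler_wpM2l.
  have hEE : E * E <= E by rewrite ler_piMl.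
  have hEN : E <= E * N by rewrite ler_peMr //; lra.
  have eE : E * N = 16 * N ^+ 6 / S%:R by rewrite /E; field; rewrite gt_eqF.
  have : 4 / S%:R <= N ^+ 6 / S%:R.
    by rewrite ler_pM2r ?invr_gt0 //; apply: le_trans (hpow 1%N 6%N isT); rewrite expr1.
  rewrite [v * E]mulrC; lra.
have hE2 : 0 <= 49 * N ^+ 6 / S%:R by rewrite divr_ge0 ?mulr_ge0 ?exprn_ge0 // ltW.
have c3 : (4 * (16 ^ K * (4 * n ^ 8 * S)) * (2 * S) + 1 < Z)%N.
  apply: leq_ltn_trans hZ1; rewrite leq_add2r -hn4.
  by rewrite (_ : 12 = 4 + 8)%N // expnD; apply/eq_leq; ring.
exists (n ^ 4 * (4 * n ^ 8 * S))%N.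
  apply: leq_ltn_trans c3; rewrite -hn4.
  have := leq_pmulr (n ^ 4 * (4 * n ^ 8 * S)) S0; lia.
have [h _] := @nfft_apx R S Z K W w _ _ _ _ _ (N ^+ 2) S0 c3 w1 hd0 hd1 hE2 hW second K (leqnn K) m hm.
rewrite (xfft_dft _ hw hm) -hn4 in h; apply: apx_weak h (leqnn _) _.
rewrite [2 ^+ K.+1]exprS -/N N2K.
have -> : 2 * N * N ^+ 2 * (4 * N ^+ 2 / S%:R) + 8 / S%:R = (8 * N ^+ 5 + 8) / S%:R by field; rewrite gt_eqF.
have h0 : 0 <= (8 * N ^+ 5 + 8) / S%:R.
  by rewrite divr_ge0 ?addr_ge0 ?mulr_ge0 ?exprn_ge0 // ltW.
suff : N ^+ 2 * (49 * N ^+ 6 / S%:R + (8 * N ^+ 5 + 8) / S%:R) <= 1 / 4 by lra.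
have -> : N ^+ 2 * (49 * N ^+ 6 / S%:R + (8 * N ^+ 5 + 8) / S%:R) =
   (49 * N ^+ 8 + 8 * N ^+ 7 + 8 * N ^+ 2) / S%:R by field; rewrite gt_eqF.
rewrite ler_pdivrMr // SN.
have p1 := hpow 7%N 8%N isT; have p2 := hpow 2%N 8%N isT.
have p3 := big 8%N 13%N isT; have p4 := hpow 13%N 16%N isT.
have e4 : 4 ^+ (13 - 8) = 1024 :> R by rewrite -natrX.
rewrite e4 in p3; have p5 : 0 <= N ^+ 8 by rewrite exprn_ge0.
lra.
Qed.

(** The exact value is [2^K] times the number of pairs with the given sum, so it is either 0 or at
    least 1, and an error of 1/4 cannot blur the two cases. *)
Lemma conv_spec K (B : nat -> nat) m : (2 <= K)%N ->
  (forall o, B o <= 1)%N -> (m < 2 ^ K)%N ->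
  (conv K B m <= 1)%N /\
  (conv K B m != 0%N <-> exists p q,
     [/\ (p < 2 ^ K)%N, (q < 2 ^ K)%N, B p != 0%N, B q != 0%N & ((p + q) %% 2 ^ K = m)%N]).
Proof.
move=> hK hB hm; rewrite /conv.
set m' := ((2 ^ K - m) %% 2 ^ K)%N.
have N0 : (0 < 2 ^ K)%N by rewrite expn_gt0.
have hm' : (m' < 2 ^ K)%N by rewrite ltn_mod.
have hdvd s : (2 ^ K %| s + m')%N = (s %% 2 ^ K == m)%N.
  rewrite /dvdn /m' modnDmr -[RHS]/(s %% 2 ^ K == m)%N.
  rewrite -[X in _ = (_ == X)](modn_small hm) -(eqn_modDr (2 ^ K - m) s m).
  by rewrite subnKC 1?ltnW // modnn.
have hprim : (2 ^ K).-primitive_root (zeta R (K - 2)).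
  apply: prim_root_of_half; [lia | | exact: zeta_half].
  apply/eqP => -[] h; have : (0 : R) < 1 by exact: ltr01.
  by lra.
have [D hD] := conv_raw_apx hK hB hm'.
rewrite (dft_sqr_dft _ _ hprim).
set y := conv_raw _ _ _.
pose cnt := (\sum_(0 <= p < 2 ^ K) \sum_(0 <= q < 2 ^ K)
   B p * B q * ((p + q) %% 2 ^ K == m))%N.
have -> : \sum_(0 <= p < 2 ^ K) \sum_(0 <= q < 2 ^ K)
    (B p)%:R * (B q)%:R * (if (2 ^ K %| p + q + m')%N then (2 ^ K)%:R else 0)
    = (cnt * 2 ^ K)%:R :> R[i].
  rewrite natrM /cnt natr_sum mulr_suml; apply: eq_bigr => p _.
  rewrite natr_sum mulr_suml; apply: eq_bigr => q _.
  by rewrite hdvd !natrM; case: eqP => _; rewrite ?mulr1 // !mulr0 mul0r.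
have [n [S [Z [en eS eZ hn [S0 _ _ _ _]]]]] := scale_facts hK.
rewrite -eS -eZ in hD *; have Sp : 0 < S%:R :> R by rewrite ltr0n.
move=> [c0 [c1 [c2 [c3 [-> [h0 h1 h2 h3] he]]]]].
have [|||| -> _ -> _] := @dig_pack Z c0 c1 c2 c3; try lia.
have hcnt : cnt != 0%N <-> exists p q,
     [/\ (p < 2 ^ K)%N, (q < 2 ^ K)%N, B p != 0%N, B q != 0%N & ((p + q) %% 2 ^ K = m)%N].
  rewrite /cnt !big_mkord; split.
    rewrite sum_nat_eq0 negb_forall => /existsP[p].
    rewrite /= big_mkord sum_nat_eq0 negb_forall => /existsP[q] /=.
    rewrite !muln_eq0 !negb_or eqb0 negbK => /andP[/andP[b1 b2] /eqP b3].
    by exists p, q.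
  move=> [p [q [hp hq bp bq e]]].
  rewrite sum_nat_eq0 negb_forall; apply/existsP; exists (Ordinal hp) => /=.
  rewrite big_mkord sum_nat_eq0 negb_forall; apply/existsP; exists (Ordinal hq) => /=.
  by rewrite e eqxx !muln_eq0 !negb_or bp bq.
split; first by lia.
rewrite -hcnt.
have hre := le_trans (normc_Re _) he.
have eRe : complex.Re ((cnt * 2 ^ K)%:R : R[i]) = (cnt * 2 ^ K)%:R.
  by rewrite -(rmorph_nat (real_complex R)).
have hre' : `|(c0%:R - c2%:R) / S%:R - (cnt * 2 ^ K)%:R| <= 1 / 4 :> R.
  have ReB (a b : R[i]) : complex.Re (a - b) = complex.Re a - complex.Re b by case: a; case: b.
  by rewrite ReB eRe in hre.
have [dif [hd1 hd2]] : exists d : R, `|d| <= 1 / 4 /\ c0%:R = c2%:R + S%:R * ((cnt * 2 ^ K)%:R + d).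
  exists ((c0%:R - c2%:R) / S%:R - (cnt * 2 ^ K)%:R); split=> //.
  by field; rewrite gt_eqF.
rewrite ler_norml in hd1; case/andP: hd1 => hd1 hd3.
case: (eqVneq cnt 0%N) => hc.
  rewrite hc mul0n add0r in hd2.
  have : (((c0 - c2) * 2) < S)%N.
    rewrite -(ltr_nat R) natrM.
    case: (leqP c0 c2) => hcc; first by rewrite (eqP (hcc : (c0 - c2 == 0)%N)) mul0r.
    rewrite natrB 1?ltnW // hd2.
    have : S%:R * dif <= S%:R * (1 / 4) by rewrite ler_wpM2l // ltW.
    lra.
  by move=> h; rewrite divn_small //.
have : (S <= ((c0 - c2) * 2))%N.
  have h1c : 1 <= (cnt * 2 ^ K)%:R :> R by rewrite (ler_nat R 1) muln_gt0 N0 andbT; lia.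
  have hlo : S%:R * (3 / 4) <= S%:R * ((cnt * 2 ^ K)%:R + dif) by rewrite ler_wpM2l //; lra.
  have hcc : (c2 <= c0)%N by rewrite -(ler_nat R); lra.
  rewrite -(ler_nat R) natrM natrB // hd2; lra.
rewrite -{1}[S]mul1n -leq_divRL // => h.
by split=> // _; case: (_ %/ S)%N h => // k _; rewrite subnS /= .
Qed.

End Convolution.

(** * Sums of generators and the Frobenius number *)

Section Doubling.
Import GRing.Theory.
Variable G : finZmodType.
Local Open Scope ring_scope.
Implicit Types X H : {set G}.

Definition sumset X : {set G} := [set p.1 + p.2 | p in setX X X].

Lemma sumsetP X g : reflect (exists2 x, x \in X & exists2 y, y \in X & g = x + y) (g \in sumset X).
Proof.
apply: (iffP imsetP) => [[[x y] /setXP[hx hy] ->]|[x hx [y hy ->]]]; first by exists x => //; exists y.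
by exists (x, y) => //; apply/setXP.
Qed.

Lemma sets_meet X (A B : {set G}) : A \subset X -> B \subset X ->
  (#|X| < #|A| + #|B|)%N -> exists2 v, v \in A & v \in B.
Proof.
move=> hA hB h; have := cardsUI A B.
have : (#|A :|: B| <= #|X|)%N by rewrite subset_leq_card // subUset hA hB.
case: (set_0Vmem (A :&: B)) => [->|[v]]; first by rewrite cards0; lia.
by rewrite inE => /andP[h1 h2] _ _; exists v.
Qed.

(* If the sumset is small then every difference of [X] has more than [#|X| / 2]
   representations, so the differences form a subgroup. *)
Lemma sumset_growth X : 0 \in X ->
  (forall H, 0 \in H -> (forall x y, x \in H -> y \in H -> x - y \in H) ->
     X \subset H -> H = setT) ->
  sumset X = setT \/ (3 * #|X| <= 2 * #|sumset X|)%N.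
Proof.
move=> X0 hgen; case: (leqP (3 * #|X|) (2 * #|sumset X|)) => hs; [by right | left].
pose reps d := [set v in X | v + d \in X].
pose H : {set G} := [set d | (#|X| < 2 * #|reps d|)%N].
pose tr (x : G) : {set G} := [set a + x | a in X].
have card_tr (x : G) : #|tr x| = #|X|.
  by apply: card_imset; exact: addIr.
(* The translates of [X] by [x] and by [y] lie in a sumset with fewer than [3/2 |X|] elements, so
   they overlap in more than [|X| / 2]; every common element represents [x - y]. *)
have hdiff x y : x \in X -> y \in X -> x - y \in H.
  move=> hx hy; rewrite inE.
  have sub z : z \in X -> tr z \subset sumset X.
    move=> hz; apply/subsetP => _ /imsetP[a ha ->]; apply/sumsetP.
    by exists a => //; exists z.
  have hU : (#|tr x :|: tr y| <= #|sumset X|)%N.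
    by rewrite subset_leq_card // subUset !sub.
  have := cardsUI (tr x) (tr y).
  rewrite !card_tr => hUI.
  have : (#|tr x :&: tr y| <= #|reps (x - y)%R|)%N.
    rewrite -(card_imset (reps (x - y)) (addIr x)); apply: subset_leq_card.
    apply/subsetP => z; rewrite inE => /andP[/imsetP[a ha ->] /imsetP[b hb e]].
    apply/imsetP; exists a => //; rewrite inE ha /=.
    by rewrite addrA e addrK.
  lia.
have hH : H = setT.
  apply: hgen.
  - by rewrite -(subrr 0); exact: hdiff.
  - move=> d1 d2; rewrite !inE => h1 h2.
    (* Two subsets that each contain more than half of [X] share some [v]; then [d1 - d2] is the
       difference of the elements [v + d1] and [v + d2] of [X]. *)
    have [|||v] := @sets_meet X (reps d1) (reps d2).
    + by apply/subsetP => v; rewrite inE => /andP[].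
    + by apply/subsetP => v; rewrite inE => /andP[].
    + lia.
    rewrite !inE => /andP[_ v1] /andP[_ v2].
    by have := hdiff _ _ v1 v2; rewrite inE opprD addrACA subrr add0r.
  - by apply/subsetP => x hx; rewrite -(subr0 x); exact: hdiff.
have hsum : (\sum_(d : G) #|reps d| = #|X| * #|X|)%N.
  transitivity (\sum_(d : G) \sum_(v in X) ((v + d)%R \in X))%N.
    apply: eq_bigr => d _; rewrite -sum1dep_card big_mkcondr /=.
    by apply: eq_bigr => v _; case: (_ \in _).
  rewrite exchange_big /= -sum_nat_const; apply: eq_bigr => v _.
  have <- : #|[set x - v | x in X]| = #|X| by apply: card_imset; exact: addIr.
  rewrite -sum1_card [RHS]big_mkcond /=; apply: eq_bigr => d _.
  have -> : (d \in [set x - v | x in X]) = ((v + d)%R \in X); last by case: (_ \in _).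
  apply/imsetP/idP => [[x hx ->]|h]; first by rewrite addrC subrK.
  by exists (v + d)%R; rewrite // addrC addKr.
(* All group elements are now differences with more than [|X| / 2] representations, while [X] has
   only [|X|^2] pairs. Hence [|G| < 2 |X|], and [X] meets each set [g - X]. *)
have hG : (#|G| * (#|X| + 1) <= 2 * (#|X| * #|X|))%N.
  rewrite -hsum big_distrr /= -sum_nat_const; apply: leq_sum => d _.
  have : d \in H by rewrite hH inE.
  by rewrite inE addn1.
have hX0 : (0 < #|X|)%N by apply/card_gt0P; exists 0.
have hX : (#|G| < 2 * #|X|)%N.
  by move: hG hX0; move: #|G| #|X| => g x; nia.
apply/setP => g; rewrite [RHS]inE; apply/sumsetP.
have cB : #|[set g - x | x in X]| = #|X|.
  by apply: card_imset => x y /addrI /oppr_inj.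
have [||| v vX /imsetP[x hx e]] := @sets_meet setT X [set g - x | x in X].
- exact: subsetT.
- exact: subsetT.
- by rewrite cardsT cB addnn -mul2n.
by exists x => //; exists v => //; rewrite e addrC subrK.
Qed.

End Doubling.

(** * The numerical semigroup and its residues modulo the largest generator *)

Section Semigroup.
Import GRing.Theory.
Variables (n : nat) (a : nat -> nat).
Hypothesis va : valid_instance n a.

Lemma rep0 : representable n a 0.
Proof. by exists (fun=> 0); rewrite big1 // => i _; rewrite muln0. Qed.

Lemma repD s t : representable n a s -> representable n a t -> representable n a (s + t).
Proof.
move=> [x <-] [y <-]; exists (fun i => x i + y i); rewrite -big_split /=.
by apply: eq_bigr => i _; rewrite mulnDr.
Qed.

Lemma rep_gen i : i <= n -> representable n a (a i).
Proof.
move=> hi; exists (fun j => j == i); rewrite (bigD1 (Ordinal (hi : i < n.+1))) //= eqxx muln1.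
by rewrite big1 ?addn0 // => j hj; rewrite (_ : nat_of_ord j == i = false) ?muln0 //; apply: negbTE hj.
Qed.

Lemma gen_gt0 i : i <= n -> 0 < a i.
Proof.
have [h0 hmono _] := va; case: i => // i hi; have := hmono 0 i.+1; lia.
Qed.

Lemma gen_le i : i <= n -> a i <= a n.
Proof.
have [_ hmono _] := va; rewrite leq_eqVlt => /orP[/eqP->//|hi].
by have := hmono i n; lia.
Qed.

Lemma size_lt_max : n < a n.
Proof.
have [h0 hmono _] := va; suff h i : i <= n -> i < a i by exact: h.
by elim: i => // i IH hi; have := hmono i i.+1; have := IH (ltnW hi); lia.
Qed.

Lemma rep_step s : representable n a s -> s = 0 \/
  exists i, [/\ i <= n, a i <= s & representable n a (s - a i)].
Proof.
move=> [x hx]; case: (boolP [forall i : 'I_n.+1, x i == 0]) => [/forallP h0|].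
  by left; rewrite -hx big1 // => i _; rewrite (eqP (h0 i)) muln0.
rewrite negb_forall => /existsP[i hi]; right; exists i.
have hs : s = a i + \sum_(j < n.+1) a j * (x j - (j == i)).
  rewrite -hx (bigD1 i) //= [in RHS](bigD1 i) //= eqxx addnA; congr (_ + _).
    by rewrite -mulnS; congr (_ * _); lia.
  by apply: eq_bigr => j hj; rewrite (negbTE hj) subn0.
split; [by rewrite -ltnS | lia |].
exists (fun j => x j - (j == i)); rewrite hs addKn.
by apply: eq_bigr => j _.
Qed.

(** If the generators of a representation are added one at a time, exactly one of them carries the
    partial sum from below [u] to [u] or beyond. *)
Lemma rep_split u s : representable n a s -> 0 < u <= s ->
  exists s1 i s2, [/\ representable n a s1, representable n a s2, i <= n,
    s = s1 + a i + s2 & s1 < u <= s1 + a i].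
Proof.
elim/ltn_ind: s => s IH hs hu; have [h0|[i [hi his hr]]] := rep_step hs; first by lia.
have ai := gen_gt0 hi.
case: (ltnP (s - a i) u) => hlt.
  by exists (s - a i), i, 0; split; rewrite ?addn0 ?subnK //; [exact: rep0 | lia].
have [||s1 [j [s2 [r1 r2 hj e hb]]]] := IH (s - a i) _ hr; [lia | lia |].
exists s1, j, (s2 + a i); split=> //; [exact: repD r2 (rep_gen hi) | lia].
Qed.

Lemma rep_double u s : 0 < u -> s < 2 * u -> representable n a s ->
  exists x y z, [/\ representable n a x /\ x < u, representable n a z /\ z < u,
    y = 0 \/ (exists2 i, i <= n & y = a i) & s = x + y + z].
Proof.
move=> u0 hs hr; case: (ltnP s u) => hsu.
  by exists s, 0, 0; split; rewrite ?addn0 //; [split; first exact: rep0 | left].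
have [|s1 [i [s2 [r1 r2 hi e hb]]]] := rep_split hr (u := u); first by lia.
exists s1, (a i), s2; split=> //; [split=> //; lia | split=> //; lia | by right; exists i].
Qed.

Lemma rep_halve s : representable n a s ->
  exists s1 s2, [/\ representable n a s1, representable n a s2, s = s1 + s2 &
    s1 <= s %/ 2 < s1 + a n].
Proof.
move=> hr; have := size_lt_max; case: (posnP s) => hs hn.
  by exists 0, 0; rewrite hs; split=> //; try exact: rep0; lia.
have [|s1 [i [s2 [r1 r2 hi e hb]]]] := rep_split hr (u := s %/ 2 + 1); first by lia.
have := gen_le hi.
by exists s1, (a i + s2); split=> //; [exact: repD (rep_gen hi) r2 | lia | lia].
Qed.

Lemma rep_iter i k : i <= n -> representable n a (a i * k).
Proof.
move=> hi; elim: k => [|k IH]; first by rewrite muln0; exact: rep0.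
by rewrite mulnS; apply: repD (rep_gen hi) IH.
Qed.

Section Residues.
Variable m : nat.
Hypothesis hm : a n = m.+1.
Local Open Scope ring_scope.

Definition resid (x : nat) : 'I_m.+1 := inZp x.

Lemma residD x y : resid (x + y) = resid x + resid y.
Proof. by apply: val_inj; rewrite /= modnDm. Qed.

Lemma resid_eq x y : resid x = resid y -> (x = y %[mod m.+1])%N.
Proof. by move/(congr1 val). Qed.

(** Such an [H] is a subgroup. By Bezout it contains the residue of the gcd of any two integers
    whose residues it contains, hence that of the gcd of all generators, which is 1. *)
Lemma gen_full (H : {set 'I_m.+1}) : 0 \in H ->
  (forall x y, x \in H -> y \in H -> x - y \in H) ->
  (forall i, (i <= n)%N -> resid (a i) \in H) -> H = setT.
Proof.
move=> H0 hsub hgen.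
have hopp x : x \in H -> - x \in H by move=> hx; rewrite -sub0r; exact: hsub.
have hadd x y : x \in H -> y \in H -> x + y \in H.
  by move=> hx hy; rewrite -[y]opprK; apply: hsub => //; exact: hopp.
have hmul x k : resid x \in H -> resid (k * x) \in H.
  move=> hx; elim: k => [|k IH]; first by rewrite mul0n (_ : resid 0 = 0) //; apply: val_inj.
  by rewrite mulSn residD; exact: hadd.
have hgcd x y : resid x \in H -> resid y \in H -> resid (gcdn x y) \in H.
  move=> hx hy; case: (posnP x) => [->|x0]; first by rewrite gcd0n.
  have [u v e _] := egcdnP y x0.
  have -> : resid (gcdn x y) = resid (u * x) - resid (v * y).
    by rewrite e residD addrAC subrr add0r.
  by apply: hsub; exact: hmul.
have h1 : resid (\big[gcdn/0%N]_(i < n.+1) a i) \in H.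
  elim/big_ind: _ => [|x y|i _]; [| exact: hgcd | by apply: hgen; rewrite -ltnS].
  by rewrite (_ : resid 0 = 0) //; apply: val_inj.
have [_ _ hg] := va; rewrite hg in h1.
apply/setP => g; rewrite inE; have := hmul _ (val g) h1; rewrite muln1.
by rewrite (_ : resid (val g) = g) //; exact: valZpK.
Qed.

(** Residues of sums of [2^k] generators. As [a n] has residue 0, these sets increase with [k],
    while each residue keeps a representable representative of size at most [2^k * a n]. *)
Fixpoint reach_set (k : nat) : {set 'I_m.+1} :=
  if k is k'.+1 then sumset (reach_set k') else [set resid (a i) | i : 'I_n.+1].

Lemma reach_set0 k : 0 \in reach_set k.
Proof.
elim: k => [|k IH] /=; last by apply/sumsetP; exists 0 => //; exists 0; rewrite ?addr0.
apply/imsetP; exists ord_max => //=; rewrite hm; apply: val_inj => /=.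
by rewrite modnn.
Qed.

Lemma reach_set_gen k i : (i <= n)%N -> resid (a i) \in reach_set k.
Proof.
move=> hi; elim: k => [|k IH] /=.
  by apply/imsetP; exists (Ordinal (hi : (i < n.+1)%N)).
by apply/sumsetP; exists 0; [exact: reach_set0 | exists (resid (a i)); rewrite ?add0r].
Qed.

Lemma reach_set_rep k g : g \in reach_set k ->
  exists s, [/\ representable n a s, (s <= 2 ^ k * a n)%N & g = resid s].
Proof.
elim: k g => [|k IH] g /=.
  case/imsetP=> i _ ->; exists (a i); rewrite mul1n; split=> //; [apply: rep_gen|apply: gen_le]; by rewrite -ltnS.
case/sumsetP=> x /IH[s [rs bs ->]] [y /IH[t [rt bt ->]] ->].
by exists (s + t)%N; rewrite residD; split=> //; [exact: repD | rewrite expnS; lia].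
Qed.

(** Only [a n] is reduced, to 0; the other generators lie strictly between 0 and [a n] and are
    distinct. *)
Lemma card_reach_set0 : #|reach_set 0| = n.+1.
Proof.
rewrite /= card_imset ?card_ord // => i j /resid_eq.
have [_ hmono _] := va.
have hlt (i' : 'I_n.+1) : (a i' %% m.+1 = if i' == n :> nat then 0 else a i')%N.
  case: eqP => [->|hne]; first by rewrite hm modnn.
  by rewrite modn_small // -hm; apply: hmono; have := ltn_ord i'; lia.
have hinj i' j' : (i' <= n)%N -> (j' <= n)%N -> a i' = a j' -> i' = j'.
  move=> hi hj e; case: (ltngtP i' j') => // h; have := hmono _ _ (introT andP (conj h _)); lia.
rewrite !hlt => e; apply: val_inj => /=; move: e.
have hi := ltn_ord i; have hj := ltn_ord j.
have pi := @gen_gt0 i; have pj := @gen_gt0 j.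
case: eqP => [->|hi']; case: eqP => [->|hj'] //; try lia.
by apply: hinj; rewrite -ltnS.
Qed.

Lemma reach_set_large k : reach_set k = setT ->
  forall y, (2 ^ k * a n <= y)%N -> representable n a y.
Proof.
move=> hT y hy; have [|s [rs bs e]] := @reach_set_rep k (resid y); first by rewrite hT inE.
have hsy : (s <= y)%N by lia.
have : (m.+1 %| y - s)%N by rewrite -(eqn_mod_dvd _ hsy); apply/eqP; exact: resid_eq.
case/dvdnP=> q eq; rewrite -(subnKC hsy) eq; apply: repD => //.
by rewrite mulnC -hm; exact: rep_iter.
Qed.

Lemma reach_set_grow k : reach_set k != setT ->
  (3 ^ k * n.+1 <= 2 ^ k * #|reach_set k|)%N.
Proof.
elim: k => [|k IH] hk; first by rewrite card_reach_set0.
have [|h|h] := @sumset_growth _ (reach_set k) (reach_set0 k).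
- by move=> H H0 hs hX; apply: gen_full => // i hi; apply: (subsetP hX); exact: reach_set_gen.
- by rewrite /= h eqxx in hk.
have hk' : reach_set k != setT.
  apply: contra hk => /eqP e /=; rewrite e; apply/eqP/setP => g; rewrite !inE; apply/sumsetP.
  by exists g; rewrite ?inE //; exists 0; rewrite ?inE ?addr0.
have := IH hk'; move: h; rewrite !expnS [reach_set k.+1]/=.
by move: #|_| #|_| => c c'; move: (2 ^ k)%N (3 ^ k)%N => x y; nia.
Qed.

End Residues.

(** Let [k] be least such that all residues are reached. One step earlier, growth by 3/2 gives
    [(3/2)^(k-1) (n+1) <= a n]; squaring and using [9/4 >= 2] turns this into
    [2^(k-1) (n+1)^2 <= (a n)^2]. *)
Lemma frobenius_bound : exists k,
  2 ^ k * n.+1 ^ 2 <= 2 * a n ^ 2 /\ forall y, 2 ^ k * a n <= y -> representable n a y.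
Proof.
have [m hm] : exists m, a n = m.+1 by exists (a n).-1; have := gen_gt0 (leqnn n); lia.
have card_le k : #|reach_set m k| <= a n.
  by rewrite hm; apply: leq_trans (max_card _) _; rewrite card_ord.
have ex : exists k, reach_set m k == setT.
  (* After [2 * a n] steps a proper subset would have at least [(9/4)^(a n) >= 2^(a n)] elements,
     more than there are residues. *)
  exists (2 * a n); apply/negPn/negP => h; have := reach_set_grow hm h.
  have := card_le (2 * a n).
  have h1 : 9 ^ a n = 3 ^ (2 * a n) by rewrite expnM.
  have h2 : 4 ^ a n = 2 ^ (2 * a n) by rewrite expnM.
  have h3 : 2 ^ a n * 4 ^ a n <= 9 ^ a n.
    by rewrite -expnMn leq_exp2r // gen_gt0.
  have := ltn_expl (a n) (isT : 1 < 2); have : 0 < 4 ^ a n by rewrite expn_gt0.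
  rewrite -h1 -h2; nia.
have [k /eqP hk kmin] := ex_minnP ex.
exists k; split; last exact: reach_set_large hm _ hk.
have := size_lt_max; case: k hk kmin => [|k] hk kmin hn.
  rewrite expn0 mul1n; have : n.+1 ^ 2 <= a n ^ 2 by rewrite leq_exp2r.
  lia.
have hne : reach_set m k != setT by apply: contraTneq (ltnSn k) => /eqP /kmin; lia.
have := reach_set_grow hm hne; have hc := card_le k => hg.
have hg' : 3 ^ k * n.+1 <= 2 ^ k * a n by apply: leq_trans hg _; rewrite leq_mul2l hc orbT.
have : (3 ^ k * n.+1) ^ 2 <= (2 ^ k * a n) ^ 2 by rewrite leq_exp2r.
rewrite !expnMn -!expnM ![k * 2]mulnC !expnM (_ : 3 ^ 2 = 9) // (_ : 2 ^ 2 = 4) //.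
have h8 : 8 ^ k <= 9 ^ k by case: (k) => // k'; rewrite leq_exp2r.
have e8 : 8 ^ k = 2 ^ k * 4 ^ k by rewrite -expnMn.
have p4 : 0 < 4 ^ k by rewrite expn_gt0.
rewrite [2 ^ k.+1]expnS e8 in h8 *; move: (n.+1 ^ 2) (a n ^ 2) => A B.
move: (2 ^ k) (4 ^ k) (9 ^ k) h8 e8 p4 => x y z h8 _ p4 h.
have h' : x * y * A <= z * A by rewrite leq_mul2r h8 orbT.
have : (x * A) * y <= B * y by rewrite mulnAC [B * y]mulnC; exact: leq_trans h' h.
by rewrite leq_pmul2r //; lia.
Qed.

End Semigroup.

(** * The convolution program *)

Definition keep (R A : seq nat) (s s' : state) : Prop :=
  (forall r, r \notin R -> rg s' r = rg s r) /\
  (forall k x, k \notin A -> ar s' k x = ar s k x).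

Lemma keep_trans R A s1 s2 s3 : keep R A s1 s2 -> keep R A s2 s3 -> keep R A s1 s3.
Proof.
by move=> [h1 h2] [h3 h4]; split=> [r hr|k x hk]; rewrite ?h3 ?h1 ?h4 ?h2.
Qed.

Lemma keep_sub R A R' A' s s' :
  {subset R <= R'} -> {subset A <= A'} -> keep R A s s' -> keep R' A' s s'.
Proof.
move=> hR hA [h1 h2]; split=> [r hr|k x hk]; [apply: h1 | apply: h2].
  by apply: contra hr; exact: hR.
by apply: contra hk; exact: hA.
Qed.

Lemma kept R A R' A' s s' : keep R A s s' -> all (fun r => r \in R') R ->
  all (fun k => k \in A') A -> keep R' A' s s'.
Proof. by move=> hk /allP h /allP h'; exact: keep_sub hk. Qed.

Lemma keep_setr R A s s' r v : r \in R -> keep R A s s' -> keep R A s (setr s' r v).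
Proof.
move=> hr [h1 h2]; split=> // r' hr'; rewrite /= updN ?h1 //.
by apply: contraNneq hr' => ->.
Qed.

Lemma keep_seta R A s s' k x v : k \in A -> keep R A s s' -> keep R A s (seta s' k x v).
Proof.
move=> hk [h1 h2]; split=> // k' x' hk' /=; case: eqP => [e|_]; last exact: h2.
by rewrite e hk in hk'.
Qed.

Definition filled (s : state) (A : nat) (f : nat -> nat) (j : nat) (s' : state) : Prop :=
  forall x, ar s' A x = if x < j then f x else ar s A x.

Definition Tab (i : nat) (n : expr) (A : nat) (e : expr) : cmd :=
  For i n (Put A (Var i) e).

(** The body may read the array that is being filled: [filled] records that entries from [j] on
    still have their old values. This permits maps in place, such as the squaring of the
    spectrum. *)
Lemma runs_tab w raw i n A e (f : nat -> nat) k s :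
  1 < 2 ^ w -> k < 2 ^ w -> 8 * k + A + rg s 0 < 2 ^ w -> i != 0 ->
  (forall s', keep [:: i] [:: A] s s' -> safe w raw s' n /\ eval raw s' n = k) ->
  (forall j s', j < k -> keep [:: i] [:: A] s s' -> rg s' i = j -> filled s A f j s' ->
     safe w raw s' e /\ eval raw s' e = f j) ->
  runs w raw (Tab i n A e) s
    (k * (csize (Put A (Var i) e) + for_cost n) + for_cost n)
    (fun s' => keep [:: i] [:: A] s s' /\ filled s A f k s').
Proof.
move=> h1 hk hA hi hn he.
pose I j s' := [/\ keep [:: i] [:: A] s s', rg s' i = j & filled s A f j s'].
have := @runs_for w raw i n (Put A (Var i) e) I (csize (Put A (Var i) e)) k s h1 hk.
move=> H; apply: runs_weak (H _ _ _) (leqnn _) _.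
- by move=> j s' [h hr hf] hj; have [ha hb] := hn _ h; split.
- move=> j s' [h hr hf] hj; have [h2 h3] := he j s' hj h hr hf.
  apply: runs_put => //=.
    by rewrite hr (_ : rg s' 0 = rg s 0); [lia | case: h => -> //; rewrite inE eq_sym].
  split=> //; rewrite /I; split; last 2 first.
  + by rewrite /= updE.
  + move=> x; rewrite /= eqxx /upd hr ltnS leq_eqVlt.
    by case: (x =P j) => [->|_] /=; [exact: h3 | exact: hf].
  + by apply: keep_setr; [rewrite inE | apply: keep_seta => //; rewrite inE].
- split; [by apply: keep_setr; rewrite ?inE | by rewrite /= updE | by []].
- by move=> s' [].
Qed.

Lemma runs_tab_le w raw i n A e (f : nat -> nat) k b s :
  csize (Put A (Var i) e) <= b -> for_cost n <= 40 ->
  1 < 2 ^ w -> k < 2 ^ w -> 8 * k + A + rg s 0 < 2 ^ w -> i != 0 ->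
  (forall s', keep [:: i] [:: A] s s' -> safe w raw s' n /\ eval raw s' n = k) ->
  (forall j s', j < k -> keep [:: i] [:: A] s s' -> rg s' i = j -> filled s A f j s' ->
     safe w raw s' e /\ eval raw s' e = f j) ->
  runs w raw (Tab i n A e) s (k * (b + 40) + 40)
    (fun s' => keep [:: i] [:: A] s s' /\ filled s A f k s').
Proof.
move=> hb hc h1 hk hA hi hn he.
apply: runs_weak (runs_tab h1 hk hA hi hn he) _ (fun s' h => h).
by rewrite leq_add // leq_mul // leq_add.
Qed.

Definition eadd := Bin BAdd.
Definition esub := Bin BSub.
Definition emul := Bin BMul.
Definition ediv := Bin BDiv.
Definition emod := Bin BMod.

(* Registers 12 .. 16 hold the scale [S], the radix [Z], [Z^2], [Z^3] and [Z^4 - 1]. *)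
Definition digE (k : nat) (x : expr) : expr :=
  match k with
  | 0 => emod x (Var 13)
  | 1 => emod (ediv x (Var 13)) (Var 13)
  | 2 => emod (ediv x (Var 14)) (Var 13)
  | _ => emod (ediv x (Var 15)) (Var 13)
  end.

Definition packE (a b c d : expr) : expr :=
  eadd (eadd (eadd a (emul b (Var 13))) (emul c (Var 14))) (emul d (Var 15)).

Definition cmulE (x y : expr) : expr :=
  let r := emod (emul x y) (Var 16) in
  packE (ediv (digE 0 r) (Var 12)) (ediv (digE 1 r) (Var 12))
        (ediv (digE 2 r) (Var 12)) (ediv (digE 3 r) (Var 12)).

Definition cnormE (x : expr) : expr :=
  packE (esub (digE 0 x) (digE 2 x)) (esub (digE 1 x) (digE 3 x))
        (esub (digE 2 x) (digE 0 x)) (esub (digE 3 x) (digE 1 x)).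

Record radix_env (S Z : nat) (s : state) : Prop := RadixEnv {
  env12 : rg s 12 = S;
  env13 : rg s 13 = Z;
  env14 : rg s 14 = Z ^ 2;
  env15 : rg s 15 = Z ^ 3;
  env16 : rg s 16 = Z ^ 4 - 1 }.

Lemma eval_digE raw S Z s k x : radix_env S Z s -> k < 4 ->
  eval raw s (digE k x) = dig Z k (eval raw s x).
Proof.
case=> e12 e13 e14 e15 e16; case: k => [|[|[|[|k]]]] //= _;
  by rewrite /dig ?expn0 ?expn1 ?divn1 ?e13 ?e14 ?e15.
Qed.

Lemma safe_digE w raw s k x : safe w raw s x -> safe w raw s (digE k x).
Proof. by move=> h; case: k => [|[|[|k]]] /=; do ! split. Qed.

Lemma eval_cmulE raw S Z s x y : radix_env S Z s ->
  eval raw s (cmulE x y) = cmul S Z (eval raw s x) (eval raw s y).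
Proof.
move=> env; have [e12 e13 e14 e15 e16] := env.
rewrite /cmulE /packE /cmul /pack /=.
by rewrite e12 e13 e14 e15 e16 /dig expn0 expn1 divn1.
Qed.

Lemma eval_cnormE raw S Z s x : radix_env S Z s ->
  eval raw s (cnormE x) = cnorm Z (eval raw s x).
Proof.
move=> env; have [e12 e13 e14 e15 e16] := env.
rewrite /cnormE /packE /cnorm /pack /=.
by rewrite e13 e14 e15 /dig expn0 expn1 divn1.
Qed.

Lemma safe_packE w raw S Z s a b c d : radix_env S Z s ->
  Z ^ 4 <= 2 ^ w ->
  safe w raw s a -> safe w raw s b -> safe w raw s c -> safe w raw s d ->
  eval raw s a < Z -> eval raw s b < Z -> eval raw s c < Z -> eval raw s d < Z ->
  safe w raw s (packE a b c d).
Proof.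
case=> e12 e13 e14 e15 e16 hw ha hb hc hd va vb vc vd.
have h := pack_lt va vb vc vd; rewrite /pack in h.
rewrite /packE /= e13 e14 e15; move: h.
move: (eval _ _ a) (_ * Z) (_ * Z ^ 2) (_ * Z ^ 3) => x y z t h.
by do ! split=> //; lia.
Qed.

Lemma pack_dig_lt Z k x : 0 < Z -> dig Z k x < Z.
Proof. by move=> Z0; rewrite ltn_mod. Qed.

Lemma cmul_lt S Z x y : 0 < Z -> cmul S Z x y < Z ^ 4.
Proof.
by move=> Z0; apply: pack_lt; apply: leq_ltn_trans (leq_div _ _) _; exact: pack_dig_lt.
Qed.

Lemma cnorm_lt Z x : 0 < Z -> cnorm Z x < Z ^ 4.
Proof.
by move=> Z0; apply: pack_lt; apply: leq_ltn_trans (leq_subr _ _) _; exact: pack_dig_lt.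
Qed.

Lemma safe_cmulE w raw S Z s x y : radix_env S Z s -> 0 < Z -> Z ^ 4 <= 2 ^ w ->
  safe w raw s x -> safe w raw s y -> eval raw s x * eval raw s y < 2 ^ w ->
  safe w raw s (cmulE x y).
Proof.
move=> env Z0 hw hx hy hxy.
have hr : safe w raw s (emod (emul x y) (Var 16)) by [].
have hd k : safe w raw s (ediv (digE k (emod (emul x y) (Var 16))) (Var 12)).
  by split=> //; exact: safe_digE.
have hv k : k < 4 -> eval raw s (ediv (digE k (emod (emul x y) (Var 16))) (Var 12)) < Z.
  move=> hk; apply: (@leq_ltn_trans (eval raw s (digE k (emod (emul x y) (Var 16))))).
    exact: leq_div.
  by rewrite (eval_digE _ _ env) //; exact: pack_dig_lt.
by apply: (safe_packE env) => //; [exact: (hv 0) | exact: (hv 1) | exact: (hv 2) | exact: (hv 3)].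
Qed.

Lemma safe_cnormE w raw S Z s x : radix_env S Z s -> 0 < Z -> Z ^ 4 <= 2 ^ w ->
  safe w raw s x -> safe w raw s (cnormE x).
Proof.
move=> env Z0 hw hx.
have hd k k' : safe w raw s (esub (digE k x) (digE k' x)).
  by split=> //; exact: safe_digE.
have hv k k' : k < 4 -> eval raw s (esub (digE k x) (digE k' x)) < Z.
  move=> hk; apply: (@leq_ltn_trans (eval raw s (digE k x))); first exact: leq_subr.
  by rewrite (eval_digE _ _ env) //; exact: pack_dig_lt.
apply: (safe_packE env) => //.
- exact: (hv 0 2).
- exact: (hv 1 3).
- exact: (hv 2 0).
- exact: (hv 3 1).
Qed.

Record conv_env (K : nat) (s : state) : Prop := ConvEnv {
  env_radix : radix_env (scale K) (radix K) s;
  env10 : rg s 10 = K;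
  env11 : rg s 11 = 2 ^ K;
  env17 : rg s 17 = 2 ^ K %/ 2 }.

(** Words below [2 Z^4] are multiplied before reduction, so intermediate products stay below
    [4 Z^8], and [Z^9] is ample. The second bound is for array addresses. *)
Definition wide (w K : nat) (s : state) : Prop :=
  radix K ^ 9 <= 2 ^ w /\ 8 * (2 ^ K + 1) + rg s 0 < 2 ^ w.

Lemma conv_env_keep K R A s s' : keep R A s s' ->
  all (fun r => r \notin R) [:: 10; 11; 12; 13; 14; 15; 16; 17] -> conv_env K s -> conv_env K s'.
Proof.
move=> [hk _]; rewrite /= andbT => /andP[h10 /andP[h11 /andP[h12 /andP[h13 /andP[h14 /andP[h15 /andP[h16 h17]]]]]]].
move=> [[e12 e13 e14 e15 e16] e10 e11 e17].
by split; [split|..]; rewrite hk.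
Qed.

Lemma wide_keep w K R A s s' : keep R A s s' -> 0 \notin R -> wide w K s -> wide w K s'.
Proof. by move=> [hk _] h [h1 h2]; split; rewrite ?hk. Qed.

Lemma radix_facts K : 2 <= K ->
  [/\ 4 <= 2 ^ K, 2 ^ K <= scale K, 16 * scale K ^ 2 <= radix K & radix K = scale K ^ 3].
Proof.
move=> hK; have hN4 : 4 <= 2 ^ K by rewrite -[4]/(2 ^ 2) leq_exp2l.
have hS : 2 ^ K <= scale K by rewrite /scale -{1}[2 ^ K]expn1 leq_exp2l //; lia.
have e : radix K = scale K ^ 3 by rewrite /radix /scale -[RHS]expnM.
split=> //; rewrite e [_ ^ 3]expnS leq_mul2r; apply/orP; right.
apply: leq_trans (_ : (2 ^ K) ^ 2 <= _); first by rewrite -[16]/(4 ^ 2) leq_exp2r.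
by rewrite /scale leq_exp2l //; lia.
Qed.

Lemma wide_facts w K s : 2 <= K -> wide w K s ->
  [/\ 4 * radix K ^ 8 < 2 ^ w, radix K ^ 4 <= radix K ^ 8, radix K <= radix K ^ 4,
      32 * 2 ^ K <= radix K & 0 < radix K].
Proof.
move=> hK [hw _]; have [hN hS hR _] := radix_facts hK.
have hR' : 32 * 2 ^ K <= radix K.
  apply: leq_trans hR; rewrite -mulnn; nia.
have R0 : 0 < radix K by lia.
split=> //.
- by apply: leq_trans hw; rewrite [_ ^ 9]expnS ltn_mul2r expn_gt0 R0; lia.
- by rewrite leq_pexp2l.
- by rewrite -{1}[radix K]expn1 leq_pexp2l.
Qed.

Definition srcE : expr :=
  eadd (emul (ediv (Var 20) (emul (Cst 2) (Var 19))) (Var 19)) (emod (Var 20) (Var 19)).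

Definition halfE : expr := emul (Var 19) (ediv (Var 20) (emul (Cst 2) (Var 19))).

Definition bitE : expr := emod (ediv (Var 20) (Var 19)) (Cst 2).

Definition srcE' : expr := eadd srcE (Var 17).

Definition twE : expr := emul halfE bitE.

Definition twE' : expr := emul (eadd halfE (Var 17)) bitE.

Definition levE : expr :=
  eadd (cmulE (Get 2 srcE) (Get 4 twE))
      (cmulE (Get 2 srcE') (Get 4 twE')).

(** Stockham's levels do not work in place: an output may sit where a later output still reads. So
    the level is built in array 3 and copied back. *)
Definition LevelC : cmd :=
  Seq (Tab 20 (Var 11) 3 levE) (Tab 20 (Var 11) 2 (Get 3 (Var 20))).

Lemma nlev_ext S Z K W W' l x x' o : l < K -> o < 2 ^ K ->
  (forall j, j < 2 ^ K -> W j = W' j) -> (forall j, j < 2 ^ K -> x j = x' j) ->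
  nlev S Z (2 ^ K) W (2 ^ l) x o = nlev S Z (2 ^ K) W' (2 ^ l) x' o.
Proof.
move=> hl ho hW hx; have [h1 h2 h3 h4] := src_bounds hl ho.
by rewrite /nlev !hW ?hx //; apply: leq_trans h1 _; exact: leq_div.
Qed.

Lemma nfft_ext S Z K W W' l x x' o : l <= K -> o < 2 ^ K ->
  (forall j, j < 2 ^ K -> W j = W' j) -> (forall j, j < 2 ^ K -> x j = x' j) ->
  nfft S Z (2 ^ K) W l x o = nfft S Z (2 ^ K) W' l x' o.
Proof.
move=> hl ho hW hx; elim: l o hl ho => [|l IH] o hl ho; first exact: hx.
by apply: nlev_ext => // j hj; apply: IH => //; exact: ltnW.
Qed.

Lemma nfft_lt S Z K W l x o : 0 < Z -> l <= K -> o < 2 ^ K ->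
  (forall j, j < 2 ^ K -> x j < 2 * Z ^ 4) -> nfft S Z (2 ^ K) W l x o < 2 * Z ^ 4.
Proof.
move=> Z0 hl ho hx; case: l hl => [|l] hl; first exact: hx.
rewrite /= /nlev mul2n -addnn.
by rewrite -addSn leq_add ?cmul_lt // ltnW // cmul_lt.
Qed.

Lemma runs_level w raw K l s : 2 <= K -> l < K -> conv_env K s -> wide w K s ->
  rg s 19 = 2 ^ l ->
  (forall o, o < 2 ^ K -> ar s 2 o < 2 * radix K ^ 4) ->
  (forall o, o < 2 ^ K -> ar s 4 o < radix K ^ 4) ->
  runs w raw LevelC s (4000 * 2 ^ K)
    (fun s' => keep [:: 20] [:: 2; 3] s s' /\
       forall o, o < 2 ^ K -> ar s' 2 o =
         nlev (scale K) (radix K) (2 ^ K) (ar s 4) (2 ^ l) (ar s 2) o).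
Proof.
move=> hK hl env hw h19 hX hW.
have [w8 w4 w1 wN Z0] := wide_facts hK hw.
have [hN _ _ _] := radix_facts hK; have [_ hbase] := hw.
have hT : (2 ^ K * (csize (Put 3 (Var 20) levE) + for_cost (Var 11)) + for_cost (Var 11)) +
   (2 ^ K * (csize (Put 2 (Var 20) (Get 3 (Var 20))) + for_cost (Var 11)) + for_cost (Var 11))
   <= 4000 * 2 ^ K.
  have -> : for_cost (Var 11) = 33 by [].
  have -> : csize (Put 2 (Var 20) (Get 3 (Var 20))) = 18 by [].
  have : csize (Put 3 (Var 20) levE) <= 2000 by [].
  move: (csize _) => c hc; move: (2 ^ K) hN => N hN; nia.
apply: runs_weak _ hT (fun s' h => h).
apply: runs_seq.
  apply: (@runs_tab _ _ _ _ _ _ (nlev (scale K) (radix K) (2 ^ K) (ar s 4) (2 ^ l) (ar s 2)) (2 ^ K)) => //.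
  - lia.
  - lia.
  - lia.
  - by move=> s' hk /=; split=> //; case: (conv_env_keep hk isT env).
  - move=> o s' ho hk h20 _.
    have env' : conv_env K s' by apply: conv_env_keep hk isT env.
    have [[rk ak] [env1 e10 e11 e17]] := (hk, env').
    have e19 : rg s' 19 = 2 ^ l by rewrite rk.
    have e0 : rg s' 0 = rg s 0 by rewrite rk.
    have [b1 b2 b3 b4] := src_bounds hl ho.
    have hs : 0 < 2 ^ l by rewrite expn_gt0.
    have hs2 : 2 * 2 ^ l <= 2 ^ K by rewrite -expnS leq_exp2l.
    have vs : eval raw s' srcE = src (2 ^ l) o by rewrite /= h20 e19.
    have vh : eval raw s' halfE = 2 ^ l * (o %/ (2 * 2 ^ l)) by rewrite /= h20 e19.
    have vb : eval raw s' bitE = o %/ 2 ^ l %% 2 by rewrite /= h20 e19.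
    have hh : 2 ^ l * (o %/ (2 * 2 ^ l)) <= src (2 ^ l) o by rewrite /src mulnC leq_addr.
    have ss : safe w raw s' srcE.
      by rewrite /= h20 e19; move: b1; rewrite /src; do ! split=> //; lia.
    have sh : safe w raw s' halfE.
      by rewrite /= h20 e19; do ! split=> //; lia.
    have sb : safe w raw s' bitE by rewrite /=; do ! split=> //; lia.
    have v1 : eval raw s' (Get 2 srcE) = ar s 2 (src (2 ^ l) o).
      by rewrite -[LHS]/(ar s' 2 (eval raw s' srcE)) vs ak.
    have v2 : eval raw s' (Get 4 twE) = ar s 4 (twid (2 ^ l) o).
      by rewrite -[LHS]/(ar s' 4 (eval raw s' halfE * eval raw s' bitE)) vh vb ak.
    have v3 : eval raw s' (Get 2 srcE') = ar s 2 (src (2 ^ l) o + 2 ^ K %/ 2).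
      by rewrite -[LHS]/(ar s' 2 (eval raw s' srcE + rg s' 17)) vs e17 ak.
    have v4 : eval raw s' (Get 4 twE') = ar s 4 (twid' (2 ^ K) (2 ^ l) o).
      rewrite -[LHS]/(ar s' 4 ((eval raw s' halfE + rg s' 17) * eval raw s' bitE)).
      by rewrite vh vb e17 ak.
    have s1 : safe w raw s' (Get 2 srcE).
      by split=> //; rewrite vs e0; lia.
    have s2 : safe w raw s' (Get 4 twE).
      split.
        split=> //; rewrite -[X in X < _]/(eval raw s' halfE * eval raw s' bitE) vh vb -/(twid _ _); lia.
      rewrite -[eval _ _ _]/(eval raw s' halfE * eval raw s' bitE) vh vb -/(twid _ _) e0; lia.
    have s3 : safe w raw s' (Get 2 srcE').
      split.
        split=> //; rewrite -[X in X < _]/(eval raw s' srcE + rg s' 17) vs e17; lia.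
      rewrite -[eval _ _ _]/(eval raw s' srcE + rg s' 17) vs e17 e0; lia.
    have s4 : safe w raw s' (Get 4 twE').
      have sa : safe w raw s' (eadd halfE (Var 17)).
        split=> //; rewrite -[X in X < _]/(eval raw s' halfE + rg s' 17) vh e17; lia.
      split.
        split=> //; rewrite -[X in X < _]/((eval raw s' halfE + rg s' 17) * eval raw s' bitE) vh vb e17 -/(twid' _ _ _); lia.
      rewrite -[eval _ _ _]/((eval raw s' halfE + rg s' 17) * eval raw s' bitE) vh vb e17 -/(twid' _ _ _) e0; lia.
    have prod i j : i < 2 ^ K -> j < 2 ^ K -> ar s 2 i * ar s 4 j < 2 ^ w.
      move=> hi hj; apply: leq_trans (ltnW w8).
      apply: leq_ltn_trans (leq_mul (ltnW (hX _ hi)) (ltnW (hW _ hj))) _.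
      by rewrite -mulnA -expnD ltn_mul2r expn_gt0 Z0.
    have c1 := @cmul_lt (scale K) (radix K) (ar s 2 (src (2 ^ l) o)) (ar s 4 (twid (2 ^ l) o)) Z0.
    have c2 := @cmul_lt (scale K) (radix K) (ar s 2 (src (2 ^ l) o + 2 ^ K %/ 2))
                  (ar s 4 (twid' (2 ^ K) (2 ^ l) o)) Z0.
    have hw4 : radix K ^ 4 <= 2 ^ w by lia.
    have va : eval raw s' levE = nlev (scale K) (radix K) (2 ^ K) (ar s 4) (2 ^ l) (ar s 2) o.
      rewrite -[LHS]/(eval raw s' (cmulE (Get 2 srcE) (Get 4 twE)) + eval raw s' (cmulE (Get 2 srcE') (Get 4 twE'))).
      by rewrite !(eval_cmulE _ _ _ env1) v1 v2 v3 v4.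
    split=> //; split.
    + apply: (safe_cmulE env1) => //; rewrite v1 v2; apply: prod => //; lia.
    + apply: (safe_cmulE env1) => //; rewrite v3 v4; exact: prod.
    + rewrite -[X in X < _]/(eval raw s' levE) va /nlev; lia.
move=> s1 [k1 f1].
apply: runs_weak (leqnn _) _; first apply: (@runs_tab _ _ _ _ _ _ (ar s1 3) (2 ^ K)).
- lia.
- lia.
- by rewrite (_ : rg s1 0 = rg s 0) ?(proj1 k1) //; lia.
- by [].
- by move=> s' hk /=; split=> //; case: (conv_env_keep hk isT (conv_env_keep k1 isT env)).
- move=> o s' ho [rk ak] h20 _ /=; rewrite h20 ak // rk //.
  by split=> //; split=> //; rewrite ?(proj1 k1) //; lia.
move=> s2 [k2 f2]; split.
  by apply: keep_trans (keep_sub _ _ k1) (keep_sub _ _ k2) => // r; rewrite !inE => ->; rewrite ?orbT.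
by move=> o ho; rewrite f2 ho f1 ho.
Qed.

Lemma runs_let w raw r e c s T (Q : state -> Prop) :
  safe w raw s e -> runs w raw c (setr s r (eval raw s e)) T Q ->
  runs w raw (Seq (Assign r e) c) s (csize (Assign r e) + T) Q.
Proof.
move=> hs hr; apply: (runs_seq (Q1 := fun s' => s' = setr s r (eval raw s e))).
  exact: runs_assign.
by move=> s1 ->.
Qed.

Definition FftC : cmd :=
  Seq (Assign 19 (Cst 1))
    (For 18 (Var 10) (Seq LevelC (Assign 19 (emul (Var 19) (Cst 2))))).

Lemma keep_env_wide w K s R A s' :
  keep R A s s' -> all (fun r => r \notin R) [:: 0; 10; 11; 12; 13; 14; 15; 16; 17] ->
  conv_env K s -> wide w K s -> conv_env K s' /\ wide w K s'.
Proof.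
by move=> hk /andP[h0 h] he hw; split; [exact: conv_env_keep hk h he | exact: wide_keep hk h0 hw].
Qed.

Lemma runs_fft w raw K s : 2 <= K -> conv_env K s -> wide w K s ->
  (forall o, o < 2 ^ K -> ar s 2 o < 2 * radix K ^ 4) ->
  (forall o, o < 2 ^ K -> ar s 4 o < radix K ^ 4) ->
  runs w raw FftC s (4100 * (K * 2 ^ K))
    (fun s' => keep [:: 18; 19; 20] [:: 2; 3] s s' /\
       forall o, o < 2 ^ K -> ar s' 2 o =
         nfft (scale K) (radix K) (2 ^ K) (ar s 4) K (ar s 2) o).
Proof.
move=> hK env hw hX hW.
have [w8 w4 w1 wN Z0] := wide_facts hK hw; have [hN _ _ _] := radix_facts hK.
have hKN : K < 2 ^ K by exact: ltn_expl.
have hT : 3 + (K * ((4000 * 2 ^ K + 6) + 33) + 33) <= 4100 * (K * 2 ^ K).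
  move: (2 ^ K) hN => N hN; nia.
apply: runs_weak _ hT (fun s' h => h).
apply: runs_let => /=; first by lia.
set s0 := setr s 19 1.
pose I l s' := [/\ keep [:: 18; 19; 20] [:: 2; 3] s s', rg s' 18 = l, rg s' 19 = 2 ^ l &
  forall o, o < 2 ^ K -> ar s' 2 o = nfft (scale K) (radix K) (2 ^ K) (ar s 4) l (ar s 2) o].
apply: runs_weak (@runs_for _ _ _ _ _ I _ K _ _ _ _ _ _) (leqnn _) _.
- lia.
- lia.
- move=> l s' [hk h18 _ _] hl; have [env' _] := keep_env_wide hk isT env hw.
  by split=> //=; case: env'.
- move=> l s' [hk h18 h19 hx] hl.
  have [env' hw'] := keep_env_wide hk isT env hw.
  apply: runs_seq.
    apply: (runs_level _ hK hl env' hw' h19) => o ho.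
      by rewrite hx //; apply: nfft_lt => //; exact: ltnW.
    by rewrite (proj2 hk) //; exact: hW.
  move=> s2 [hk2 hx2]; apply: runs_assign => //=.
    rewrite (proj1 hk2) // h19; split=> //; first by lia.
    by rewrite mulnC -expnS; apply: leq_ltn_trans (_ : 2 ^ K < _); [rewrite leq_exp2l | lia].
  rewrite updN // (proj1 hk2) //; split=> //; split.
  + do 2 (apply: keep_setr; first by []).
    by apply: keep_trans hk (keep_sub _ _ hk2) => r; rewrite !inE; case/or3P=> /eqP-> || move=> ->; rewrite ?orbT.
  + by rewrite /= updE.
  + by rewrite /= !(updE, updN) // (proj1 hk2) // h19 expnS mulnC.
  + move=> o ho; rewrite -[LHS]/(ar s2 2 o) hx2 //=.
    by apply: nlev_ext => // j hj; rewrite ?hx // (proj2 hk).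
- split=> //; rewrite ?updE //; do 2 (apply: keep_setr => //).
- by move=> s' [].
Qed.

(** The root is found bit by bit, register 25 being the bit on trial. Its square fits exactly when
    [v + 1] minus that square is nonzero. The first bit is [2 S] because the argument is below
    [16 S^2]. *)
Definition SqrtC : cmd :=
  Seq (Assign 24 (Cst 0)) (Seq (Assign 25 (emul (Var 12) (Cst 2)))
   (While (Var 25)
     (Seq (Ite (esub (eadd (Var 26) (Cst 1))
                     (emul (eadd (Var 24) (Var 25)) (eadd (Var 24) (Var 25))))
               (Assign 24 (eadd (Var 24) (Var 25))) Skip)
          (Assign 25 (ediv (Var 25) (Cst 2)))))).

Lemma sqrt_unique d v : d * d <= v < d.+1 * d.+1 -> d = Nat.sqrt v.
Proof. by move=> h; have := sqrt_bounds v; rewrite -!mulnn; nia. Qed.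

Lemma runs_sqrt w raw k s : rg s 12 = 2 ^ k ->
  rg s 26 < 16 * 2 ^ k * 2 ^ k -> 64 * 2 ^ k * 2 ^ k < 2 ^ w ->
  runs w raw SqrtC s (100 * (k + 3))
    (fun s' => keep [:: 24; 25] [::] s s' /\ rg s' 24 = Nat.sqrt (rg s 26)).
Proof.
move=> h12 hv hw; set v := rg s 26 in hv *.
have k0 : 0 < 2 ^ k by rewrite expn_gt0.
have hk2 : 2 ^ k <= 2 ^ k * 2 ^ k by rewrite leq_pmulr.
(* The root lies in an interval of length [2^j], and register 25 holds half of that length. At
   [j = 0] the half rounds to 0, which ends the loop. *)
pose I j s' := [/\ keep [:: 24; 25] [::] s s', rg s' 25 = 2 ^ j %/ 2, j <= k + 2 &
   rg s' 24 * rg s' 24 <= v < (rg s' 24 + 2 ^ j) * (rg s' 24 + 2 ^ j)].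
have hT : 3 + (6 + (\sum_(j < k + 2) (ce (Var 25) + 60 + 1) + ce (Var 25))) <= 100 * (k + 3).
  rewrite sum_nat_const card_ord.
  have -> : ce (Var 25) = 3 by [].
  lia.
apply: runs_weak _ hT (fun s' h => h).
apply: runs_let => /=; first by lia.
apply: runs_let => /=.
  by rewrite updN // h12; do ! split=> //; lia.
rewrite updN // h12; set s1 := setr _ 25 _.
have hI : I (k + 2) s1.
  split=> //; first by do 2 (apply: keep_setr => //).
    by rewrite /= updE addn2 !expnS [2 * _]mulnC mulnK // mulnC.
  by rewrite /= updN // updE addn2 !expnS; lia.
apply: runs_weak (@runs_while _ _ _ _ I (fun=> 60) _ _ _ _ _ hI) (leqnn _) _.
- by [].
- by move=> s' [_ /= ->].
- move=> j s' [hk h25 hj hb] _.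
  have e26 : rg s' 26 = v by rewrite (proj1 hk).
  have h25' : rg s' 25 = 2 ^ j by rewrite h25 expnS mulKn.
  have j0 : 0 < 2 ^ j by rewrite expn_gt0.
  set d := rg s' 24 in hb *.
  have hd4 : d < 4 * 2 ^ k by nia.
  have hj4 : 2 * 2 ^ j <= 4 * 2 ^ k.
    by rewrite -expnS (_ : 4 * 2 ^ k = 2 ^ (k + 2)) ?leq_exp2l // addn2 !expnS; lia.
  have hsq : (d + 2 ^ j) * (d + 2 ^ j) < 64 * 2 ^ k * 2 ^ k.
    by apply: (@leq_ltn_trans (6 * 2 ^ k * (6 * 2 ^ k))); [apply: leq_mul; lia | lia].
  have hit : safe w raw s' (esub (eadd (Var 26) (Cst 1))
                     (emul (eadd (Var 24) (Var 25)) (eadd (Var 24) (Var 25)))).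
    by rewrite /= e26 h25' -/d; do ! split=> //; lia.
  pose d' := if (d + 2 ^ j) * (d + 2 ^ j) <= v then d + 2 ^ j else d.
  apply: runs_weak (_ : ce (esub (eadd (Var 26) (Cst 1))
      (emul (eadd (Var 24) (Var 25)) (eadd (Var 24) (Var 25)))) + 7 + 1 + 6 <= 60) (fun s' h => h) => //.
  apply: (runs_seq (Q1 := fun s2 => keep [:: 24; 25] [::] s s2 /\ rg s2 24 = d' /\ rg s2 25 = 2 ^ j)).
    apply: runs_ite => //.
    rewrite /= e26 h25' -/d addn1 subn_eq0.
    case: ltnP => hc.
      apply: runs_skip; rewrite -/d h25'; split=> //; split=> //.
      by rewrite /d' leqNgt hc.
    apply: runs_assign => //=; first by rewrite h25' -/d; do ! split=> //; lia.
    split; first by apply: keep_setr.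
    by rewrite updE updN // h25' /d' hc.
  move=> s2 [hk2' [h24 h25'']]; apply: runs_assign => //=; first by do ! split=> //; lia.
  rewrite h25''; split; [by apply: keep_setr | by rewrite /= updE | by lia |].
  rewrite /= updN // h24 /d'; case/andP: hb; rewrite expnS => hb1 hb2; case: (leqP ((d + 2 ^ j) * (d + 2 ^ j)) v) => hc.
    by rewrite hc /=; move: hb2; rewrite mul2n -addnn addnA.
  by rewrite hb1 hc.
- move=> s' [/= h0 [j [hk h25 hj hb]]]; split=> //.
  have j0 : j = 0.
    by case: j {hj hb} h25 => // j; rewrite h0 expnS mulKn // => e; have := expn_gt0 2 j; rewrite -e.
  by apply: sqrt_unique; rewrite j0 expn0 addn1 in hb.
Qed.

Definition RootC : cmd :=
  Seq (Assign 21 (Cst 0)) (Seq (Assign 22 (Var 12))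
   (For 18 (esub (Var 10) (Cst 2))
     (Seq (Assign 23 (eadd (Var 12) (Var 21)))
     (Seq (Assign 26 (eadd (emul (Var 23) (Var 23)) (emul (Var 22) (Var 22))))
     (Seq SqrtC
     (Seq (Assign 21 (ediv (emul (Var 23) (Var 12)) (Var 24)))
          (Assign 22 (ediv (emul (Var 22) (Var 12)) (Var 24))))))))).

Lemma rootp_le S k : 0 < S -> (rootp S k).1 <= S /\ (rootp S k).2 <= S.
Proof.
move=> S0; case: k => [|k]; first by rewrite /rootp.
rewrite /rootp iterS -/(rootp S k); case: (rootp S k) => a b; rewrite /rstep.
rewrite ![(_, _).1]/= ![(_, _).2]/=.
set v := (S + a) * (S + a) + b * b; have /andP[_ hd] := sqrt_bounds v.
have le_sqrt x : x * x <= v -> x <= Nat.sqrt v.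
  move=> hx; rewrite -ltnS -(ltn_exp2r _ _ (isT : 0 < 2)); apply: leq_ltn_trans hd.
  by rewrite -mulnn.
have hu : S + a <= Nat.sqrt v by apply: le_sqrt; exact: leq_addr.
have hb : b <= Nat.sqrt v by apply: le_sqrt; exact: leq_addl.
have hdiv x : x <= Nat.sqrt v -> x * S %/ Nat.sqrt v <= S.
  move=> hx; rewrite -[X in _ <= X](@mulKn S (Nat.sqrt v)); last by lia.
  by rewrite leq_div2r // leq_mul2r hx orbT.
by split; exact: hdiv.
Qed.

(** About [K] square roots of [O(K)] bits each cost [O(K^2)], which [K < 2^K] absorbs. *)
Lemma runs_root w raw K s : 2 <= K -> conv_env K s -> wide w K s ->
  runs w raw RootC s (5000 * (K * 2 ^ K))
    (fun s' => keep [:: 18; 21; 22; 23; 24; 25; 26] [::] s s' /\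
      rg s' 21 = (rootp (scale K) (K - 2)).1 /\ rg s' 22 = (rootp (scale K) (K - 2)).2).
Proof.
move=> hK env hw.
have [w8 w4 w1 wN Z0] := wide_facts hK hw; have [hN hS hR _] := radix_facts hK.
have hKN : K < 2 ^ K by exact: ltn_expl.
have eS : scale K = 2 ^ (K * 16) by rewrite /scale -expnM.
set S := scale K in eS hS hR *.
have S0 : 0 < S by rewrite eS expn_gt0.
have hS64 : 64 * S * S < 2 ^ w.
  rewrite -mulnn in hR.
  have : radix K < radix K ^ 4 by rewrite -{1}[radix K]expn1 ltn_exp2l //; lia.
  lia.
have hT : 3 + (4 + ((K - 2) * ((7 + (13 + (100 * (K * 16 + 3) + (10 + 10)))) + 35) + 35))
    <= 5000 * (K * 2 ^ K).
  move: (2 ^ K) hN hKN => N hN hKN; nia.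
apply: runs_weak _ hT (fun s' h => h).
have [[e12 _ _ _ _] e10 _ _] := env.
apply: runs_let => /=; first by lia.
apply: runs_let => //=; rewrite updN // e12.
pose I l s' := [/\ keep [:: 18; 21; 22; 23; 24; 25; 26] [::] s s', rg s' 18 = l,
   rg s' 21 = (rootp S l).1 & rg s' 22 = (rootp S l).2].
apply: runs_weak (@runs_for _ _ _ _ _ I _ (K - 2) _ _ _ _ _ _) (leqnn _) _.
- lia.
- lia.
- move=> l s' [hk h18 _ _] hl; have [env' _] := keep_env_wide hk isT env hw.
  by case: env' => _ e10' _ _; split=> //=; rewrite ?e10'; [split=> //; lia|].
- move=> l s' [hk h18 h21 h22] hl.
  have [env' hw'] := keep_env_wide hk isT env hw; have [[e12' _ _ _ _] _ _ _] := env'.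
  have [ha hb] := rootp_le l S0.
  set a := (rootp S l).1 in ha h21 *; set b := (rootp S l).2 in hb h22 *.
  have hu2 : (S + a) * (S + a) <= 4 * (S * S).
    by rewrite (_ : 4 * (S * S) = (S + S) * (S + S)); [apply: leq_mul; lia | lia].
  have hb2 : b * b <= S * S by exact: leq_mul.
  have hSS : S <= S * S by rewrite leq_pmulr.
  have hbS : b * S <= S * S by rewrite leq_mul2r hb orbT.
  apply: runs_let => /=; first by rewrite e12' h21 -/S; split=> //; lia.
  rewrite e12' h21 -/S.
  apply: runs_let => /=.
    by rewrite !(updE, updN) // h22; do ! split=> //; lia.
  rewrite !(updE, updN) // h22; set s2 := setr _ 26 _.
  have k2 : keep [:: 18; 21; 22; 23; 24; 25; 26] [::] s' s2.
    by do 2 (apply: keep_setr => //).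
  apply: runs_seq.
    apply: (@runs_sqrt _ _ (K * 16)); rewrite -?eS.
    + by rewrite /s2 /= !updN.
    + rewrite /s2 /= !updE; lia.
    + by rewrite -/S.
  move=> s3 [k3]; rewrite {1}/s2 /= updE => h24.
  have g r : r \notin [:: 24; 25] -> rg s3 r = rg s2 r by exact: (proj1 k3).
  apply: runs_let => /=.
    rewrite !g // /s2 /= !(updE, updN) // e12' -/S.
    do ! split=> //; apply: leq_ltn_trans (_ : 2 * (S * S) < _); [rewrite mulnA leq_mul2r; lia | lia].
  apply: runs_assign => //=.
    rewrite !updN // !g // /s2 /= !updN // e12' h22 -/S; do ! split=> //; lia.
  rewrite !updN //; split; first by rewrite g // /s2 /= !updN.
  have k3' : keep [:: 18; 21; 22; 23; 24; 25; 26] [::] s2 s3.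
    by apply: keep_sub k3 => // r; rewrite !inE => /orP[] /eqP->.
  split.
  + do 3 (apply: keep_setr; first by []).
    exact: keep_trans hk (keep_trans k2 k3').
  + by rewrite /= updE.
  + rewrite /= !(updE, updN) // h24 !g // /s2 /= !(updE, updN) // e12' -/S.
    by [].
  + rewrite /= !(updE, updN) // h24 !g // /s2 /= !(updE, updN) // e12' h22 -/S.
    by [].
- split; rewrite /= ?(updE, updN) // ?(updE, updN) // ?(updE, updN) //.
  by do 3 (apply: keep_setr => //).
- by move=> s' [h1 _ h2 h3].
Qed.

Definition ConstsC : cmd :=
  Seq (Assign 12 (emul (Var 11) (Var 11)))
  (Seq (Assign 12 (emul (Var 12) (Var 12)))
  (Seq (Assign 12 (emul (Var 12) (Var 12)))
  (Seq (Assign 12 (emul (Var 12) (Var 12)))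
  (Seq (Assign 13 (emul (emul (Var 12) (Var 12)) (Var 12)))
  (Seq (Assign 14 (emul (Var 13) (Var 13)))
  (Seq (Assign 15 (emul (Var 14) (Var 13)))
  (Seq (Assign 16 (esub (emul (Var 14) (Var 14)) (Cst 1)))
       (Assign 17 (ediv (Var 11) (Cst 2)))))))))).

Lemma runs_consts w raw K s : 2 <= K -> wide w K s -> rg s 10 = K -> rg s 11 = 2 ^ K ->
  runs w raw ConstsC s 200
    (fun s' => keep [:: 12; 13; 14; 15; 16; 17] [::] s s' /\ conv_env K s').
Proof.
move=> hK hw e10 e11.
have [w8 w4 w1 wN Z0] := wide_facts hK hw; have [hN hS hR eZ] := radix_facts hK.
have r4 i : i <= 4 -> radix K ^ i < 2 ^ w.
  move=> hi; have : radix K ^ i <= radix K ^ 4 by rewrite leq_pexp2l.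
  have : 0 < radix K ^ 8 by rewrite expn_gt0 Z0.
  lia.
have s3 i : i <= 3 -> scale K ^ i < 2 ^ w.
  move=> hi; apply: leq_ltn_trans (r4 1 isT); rewrite expn1 eZ leq_pexp2l //; lia.
have s16 i : i <= 16 -> (2 ^ K) ^ i < 2 ^ w.
  move=> hi; apply: leq_ltn_trans (s3 1 isT); rewrite expn1 /scale leq_pexp2l //; lia.
have sq x : x * x = x ^ 2 by rewrite mulnn.
apply: runs_weak (_ : 7 + (7 + (7 + (7 + (9 + (7 + (7 + (9 + 7))))))) <= 200) (fun s' h => h) => //.
have sqp i j : i + i = j -> (2 ^ K) ^ i * (2 ^ K) ^ i = (2 ^ K) ^ j by move=> <-; rewrite -expnD.
apply: runs_let => /=; rewrite e11 sq; first by split=> //; exact: (s16 2).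
apply: runs_let => /=; rewrite !updE (@sqp 2 4) //; first by split=> //; exact: (s16 4).
apply: runs_let => /=; rewrite !updE (@sqp 4 8) //; first by split=> //; exact: (s16 8).
apply: runs_let => /=; rewrite !updE (@sqp 8 16) //; first by split=> //; exact: (s16 16).
rewrite -/(scale K).
apply: runs_let => /=; rewrite !updE sq -expnSr.
  by do ! split=> //; [exact: (s3 2) | exact: (s3 3)].
rewrite -eZ.
apply: runs_let => /=; rewrite !updE sq; first by split=> //; exact: (r4 2).
apply: runs_let => /=; rewrite ?(updE, updN) // ?(updE, updN) // -expnSr; first by split=> //; exact: (r4 3).
apply: runs_let => /=; rewrite !(updE, updN) // sq -expnM.
  by do ! split=> //; [exact: (r4 4) | lia].
apply: runs_assign => //=; first by do ! split=> //; lia.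
rewrite !updN // e11; split.
  by do 9 (apply: keep_setr => //).
by split; [split|..]; rewrite /= !(updE, updN) // -expnM.
Qed.

Definition WtabC : cmd :=
  Seq (Assign 28 (eadd (Var 21) (emul (Var 22) (Var 13))))
  (Seq (Assign 21 (Var 12))
    (For 27 (Var 11)
      (Seq (Put 4 (Var 27) (Var 21))
      (Seq (Assign 22 (cmulE (Var 21) (Var 28)))
           (Assign 21 (cnormE (Var 22))))))).

Lemma runs_wtab w raw K s : 2 <= K -> conv_env K s -> wide w K s ->
  rg s 21 = (rootp (scale K) (K - 2)).1 -> rg s 22 = (rootp (scale K) (K - 2)).2 ->
  runs w raw WtabC s (3000 * 2 ^ K)
    (fun s' => keep [:: 21; 22; 27; 28] [:: 4] s s' /\
       forall j, j < 2 ^ K -> ar s' 4 j = rtab K j /\ ar s' 4 j < radix K ^ 4).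
Proof.
move=> hK env hw h21 h22.
have [w8 w4 w1 wN Z0] := wide_facts hK hw; have [hN hS hR eZ] := radix_facts hK.
have [_ hbase] := hw.
have S0 : 0 < scale K by lia.
have [ha hb] := rootp_le (K - 2) S0; rewrite -h21 -h22 in ha hb.
have hSZ : scale K <= radix K by rewrite eZ -{1}[scale K]expn1 leq_pexp2l.
have [[e12 e13 _ _ _] _ e11 _] := env.
have c1 : csize (Assign 22 (cmulE (Var 21) (Var 28))) <= 1000 by [].
have c2 : csize (Assign 21 (cnormE (Var 22))) <= 1000 by [].
have hT : 10 + (4 + (2 ^ K * ((11 + (csize (Assign 22 (cmulE (Var 21) (Var 28))) +
    csize (Assign 21 (cnormE (Var 22))))) + 33) + 33)) <= 3000 * 2 ^ K.
  move: (csize _) (csize _) c1 c2 (2 ^ K) hN => x y hx hy N hN; nia.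
apply: runs_weak _ hT (fun s' h => h).
have hZ2 : radix K * radix K <= radix K ^ 4 by rewrite mulnn leq_pexp2l.
have hr : rg s 22 * radix K <= radix K * radix K by rewrite leq_mul2r; apply/orP; right; lia.
set r := (rg s 21 + rg s 22 * radix K).
have hr2 : r <= 2 * (radix K * radix K).
  by have : radix K <= radix K * radix K; [rewrite leq_pmulr | rewrite /r; lia].
have er : r = (rootp (scale K) (K - 2)).1 + (rootp (scale K) (K - 2)).2 * radix K.
  by rewrite /r h21 h22.
have pos8 : 0 < radix K ^ 8 by rewrite expn_gt0 Z0.
have hw4 : radix K ^ 4 <= 2 ^ w by lia.
have wt j : wtab (scale K) (radix K) r j < radix K ^ 4 + 1.
  case: j => [|j] /=; first by lia.
  by rewrite addn1 ltnS ltnW // cnorm_lt.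
apply: runs_let => /=; first by rewrite e13; do ! split=> //; lia.
rewrite e13 -/r.
apply: runs_let => //=; rewrite updN // e12.
pose I j s' := [/\ keep [:: 21; 22; 27; 28] [:: 4] s s', rg s' 27 = j, rg s' 28 = r,
   rg s' 21 = wtab (scale K) (radix K) r j &
   forall x, x < j -> ar s' 4 x = wtab (scale K) (radix K) r x].
apply: runs_weak (@runs_for _ _ _ _ _ I _ (2 ^ K) _ _ _ _ _ _) (leqnn _) _.
- lia.
- lia.
- move=> l s' [hk h27 _ _ _] hl; have [env' _] := keep_env_wide hk isT env hw.
  by split=> //=; case: env'.
- move=> j s' [hk h27 h28 hx hf] hj.
  have [env' hw'] := keep_env_wide hk isT env hw.
  apply: (runs_seq (Q1 := fun s2 => s2 = seta s' 4 j (wtab (scale K) (radix K) r j))).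
    apply: runs_put => //=; rewrite ?h27 ?hx //.
    by rewrite (proj1 hk) //; lia.
  move=> s2 ->; set s3 := seta _ _ _ _.
  have env3 : radix_env (scale K) (radix K) s3 by case: env' => -[*]; split.
  have v22 : eval raw s3 (cmulE (Var 21) (Var 28)) =
      cmul (scale K) (radix K) (wtab (scale K) (radix K) r j) r.
    by rewrite (eval_cmulE _ _ _ env3) /= hx h28.
  apply: runs_let.
    apply: (safe_cmulE env3) => //=; rewrite hx h28.
    apply: leq_ltn_trans (_ : (radix K ^ 4 + radix K ^ 4) * (2 * radix K ^ 4) < _).
      by apply: leq_mul; [have := wt j; lia | lia].
    by have e8 : radix K ^ 4 * radix K ^ 4 = radix K ^ 8; [rewrite -expnD | lia].
  rewrite v22; set s4 := setr _ _ _.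
  have env4 : radix_env (scale K) (radix K) s4 by case: env3 => *; split.
  apply: runs_assign => //; first by apply: (safe_cnormE env4).
  rewrite (eval_cnormE _ _ env4) [eval _ _ _]/= updE.
  split; first by rewrite /= !updN.
  split.
  + do 3 (apply: keep_setr; first by []); exact: keep_seta.
  + by rewrite /= updE.
  + by rewrite /= !updN.
  + by rewrite /= !(updE, updN).
  + move=> x; rewrite ltnS leq_eqVlt /= /upd; case: eqP => [-> //|_] /=; exact: hf.
- split; rewrite /= ?(updE, updN) // ?(updE, updN) // ?(updE, updN) //.
  by do 3 (apply: keep_setr => //).
- move=> s' [hk _ _ _ hf]; split=> // j hj; rewrite hf // {1}er; split=> //.
  case: (j) => [|i] /=; last exact: cnorm_lt.
  by apply: leq_ltn_trans hSZ _; rewrite -{1}[radix K]expn1 ltn_exp2l //; lia.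
Qed.

Definition FillC : cmd := Tab 20 (Var 11) 2 (emul (Get 1 (Var 20)) (Var 12)).

Definition SquareC : cmd := Tab 20 (Var 11) 2 (cmulE (Get 2 (Var 20)) (Get 2 (Var 20))).

Definition outE : expr :=
  let y := Get 2 (emod (esub (Var 11) (Var 20)) (Var 11)) in
  esub (Cst 1) (esub (Cst 1) (ediv (emul (esub (digE 0 y) (digE 2 y)) (Cst 2)) (Var 12))).

Definition OutC : cmd := Tab 20 (Var 11) 5 outE.

Definition ConvC : cmd :=
  Seq ConstsC (Seq RootC (Seq WtabC (Seq FillC (Seq FftC (Seq SquareC (Seq FftC OutC)))))).

Lemma runs_fill w raw K s : 2 <= K -> conv_env K s -> wide w K s ->
  (forall o, o < 2 ^ K -> ar s 1 o <= 1) ->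
  runs w raw FillC s (100 * 2 ^ K)
    (fun s' => keep [:: 20] [:: 2] s s' /\
       forall o, o < 2 ^ K -> ar s' 2 o = ar s 1 o * scale K /\ ar s' 2 o < 2 * radix K ^ 4).
Proof.
move=> hK env hw hB.
have [w8 w4 w1 wN Z0] := wide_facts hK hw; have [hN hS hR eZ] := radix_facts hK.
have [_ hbase] := hw; have S0 : 0 < scale K by lia.
have hSZ : scale K <= radix K by rewrite eZ -{1}[scale K]expn1 leq_pexp2l.
have hT : 2 ^ K * (csize (Put 2 (Var 20) (emul (Get 1 (Var 20)) (Var 12))) + for_cost (Var 11))
   + for_cost (Var 11) <= 100 * 2 ^ K.
  have -> : csize (Put 2 (Var 20) (emul (Get 1 (Var 20)) (Var 12))) = 21 by [].
  have -> : for_cost (Var 11) = 33 by [].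
  lia.
have hv o : o < 2 ^ K -> ar s 1 o * scale K <= radix K.
  by move=> ho; apply: leq_trans hSZ; rewrite -[X in _ <= X]mul1n leq_mul2r hB ?orbT.
apply: runs_weak (@runs_tab _ _ _ _ _ _ (fun o => ar s 1 o * scale K) (2 ^ K) _ _ _ _ _ _ _) hT _ => //.
- lia.
- lia.
- lia.
- by move=> s' hk /=; split=> //; case: (conv_env_keep hk isT env).
- move=> o s' ho hk h20 _ /=; have [[e12 _ _ _ _] _ _ _] := conv_env_keep hk isT env.
  rewrite e12 h20 (proj2 hk) // (proj1 hk) //; have := hv _ ho.
  by split=> //; do ! split=> //; lia.
- move=> s' [hk hf]; split=> // o ho; rewrite hf ho; split=> //.
  by have := hv _ ho; lia.
Qed.

Lemma runs_square w raw K s : 2 <= K -> conv_env K s -> wide w K s ->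
  (forall o, o < 2 ^ K -> ar s 2 o < 2 * radix K ^ 4) ->
  runs w raw SquareC s (3000 * 2 ^ K)
    (fun s' => keep [:: 20] [:: 2] s s' /\
       forall o, o < 2 ^ K -> ar s' 2 o = cmul (scale K) (radix K) (ar s 2 o) (ar s 2 o)).
Proof.
move=> hK env hw hX.
have [w8 w4 w1 wN Z0] := wide_facts hK hw; have [hN hS hR eZ] := radix_facts hK.
have [_ hbase] := hw.
have hT : 2 ^ K * (csize (Put 2 (Var 20) (cmulE (Get 2 (Var 20)) (Get 2 (Var 20)))) + for_cost (Var 11))
   + for_cost (Var 11) <= 3000 * 2 ^ K.
  have : csize (Put 2 (Var 20) (cmulE (Get 2 (Var 20)) (Get 2 (Var 20)))) <= 2000 by [].
  have -> : for_cost (Var 11) = 33 by [].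
  move: (csize _) => c hc; move: (2 ^ K) hN => N hN; nia.
apply: runs_weak (@runs_tab _ _ _ _ _ _ (fun o => cmul (scale K) (radix K) (ar s 2 o) (ar s 2 o)) (2 ^ K) _ _ _ _ _ _ _) hT _ => //.
- lia.
- lia.
- lia.
- by move=> s' hk /=; split=> //; case: (conv_env_keep hk isT env).
- move=> o s' ho hk h20 hf; have [env1 _ _ _] := conv_env_keep hk isT env.
  have hg : eval raw s' (Get 2 (Var 20)) = ar s 2 o by rewrite /= h20 hf ltnn.
  split; last by rewrite (eval_cmulE _ _ _ env1) hg.
  have sg : safe w raw s' (Get 2 (Var 20)) by split=> //=; rewrite h20 (proj1 hk) //; lia.
  apply: (safe_cmulE env1) => //; first by lia.
  rewrite hg; have hx := hX _ ho.
  apply: leq_ltn_trans (leq_mul (ltnW hx) (ltnW hx)) _.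
  by have e8 : radix K ^ 4 * radix K ^ 4 = radix K ^ 8; [rewrite -expnD | lia].
- by move=> s' [hk hf]; split=> // o ho; rewrite hf ho.
Qed.

Lemma runs_out w raw K s : 2 <= K -> conv_env K s -> wide w K s ->
  (forall o, o < 2 ^ K -> ar s 2 o < 2 * radix K ^ 4) ->
  runs w raw OutC s (3000 * 2 ^ K)
    (fun s' => keep [:: 20] [:: 5] s s' /\
       forall m, m < 2 ^ K -> ar s' 5 m =
         let y := ar s 2 ((2 ^ K - m) %% 2 ^ K) in
         1 - (1 - (dig (radix K) 0 y - dig (radix K) 2 y) * 2 %/ scale K)).
Proof.
move=> hK env hw hX.
have [w8 w4 w1 wN Z0] := wide_facts hK hw; have [hN hS hR eZ] := radix_facts hK.
have [_ hbase] := hw.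
have hT : 2 ^ K * (csize (Put 5 (Var 20) outE) + for_cost (Var 11)) + for_cost (Var 11)
   <= 3000 * 2 ^ K.
  have : csize (Put 5 (Var 20) outE) <= 2000 by [].
  have -> : for_cost (Var 11) = 33 by [].
  move: (csize _) => c hc; move: (2 ^ K) hN => N hN; nia.
apply: runs_weak (@runs_tab _ _ _ _ _ _ (fun m => let y := ar s 2 ((2 ^ K - m) %% 2 ^ K) in
         1 - (1 - (dig (radix K) 0 y - dig (radix K) 2 y) * 2 %/ scale K)) (2 ^ K) _ _ _ _ _ _ _) hT _ => //.
- lia.
- lia.
- lia.
- by move=> s' hk /=; split=> //; case: (conv_env_keep hk isT env).
- move=> o s' ho hk h20 hf; have [env1 _ e11 _] := conv_env_keep hk isT env.
  set y := ar s 2 ((2 ^ K - o) %% 2 ^ K).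
  have ho' : (2 ^ K - o) %% 2 ^ K < 2 ^ K by rewrite ltn_mod expn_gt0.
  pose yE := Get 2 (emod (esub (Var 11) (Var 20)) (Var 11)).
  have hg : eval raw s' yE = y by rewrite /= h20 e11 (proj2 hk).
  have sg : safe w raw s' yE.
    by do ! split=> //=; rewrite h20 e11 (proj1 hk) //; lia.
  have [e12 e13 e14 _ _] := env1.
  have d0 : dig (radix K) 0 y - dig (radix K) 2 y < radix K.
    by apply: leq_ltn_trans (leq_subr _ _) _; exact: pack_dig_lt.
  have v : eval raw s' (esub (digE 0 yE) (digE 2 yE)) = dig (radix K) 0 y - dig (radix K) 2 y.
    by rewrite -[LHS]/(eval raw s' (digE 0 yE) - eval raw s' (digE 2 yE)) !(eval_digE _ _ env1) // hg.
  have sv : safe w raw s' (esub (digE 0 yE) (digE 2 yE)) by split=> //; apply: safe_digE.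
  split; last first.
    rewrite -[LHS]/(1 - (1 - eval raw s' (esub (digE 0 yE) (digE 2 yE)) * 2 %/ rg s' 12)).
    by rewrite v e12.
  have s1 : safe w raw s' (Cst 1) by rewrite /=; lia.
  have s2 : safe w raw s' (Cst 2) by rewrite /=; lia.
  have sm : safe w raw s' (emul (esub (digE 0 yE) (digE 2 yE)) (Cst 2)).
    have hlt : eval raw s' (esub (digE 0 yE) (digE 2 yE)) * 2 < 2 ^ w by rewrite v; lia.
    by split; [exact: sv | exact: s2 | exact: hlt].
  split; [exact: s1 | | by []].
  split; [exact: s1 | | by []].
  by split; [exact: sm | | ].
- by move=> s' [hk hf]; split=> // o ho; rewrite hf ho.
Qed.

(** [conv_spec] wants a 0-1 function on all of [nat], whereas an array may hold anything beyond
    [2^K]. *)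
Definition trunc (N : nat) (B : nat -> nat) (o : nat) : nat := if o < N then B o else 0.

Lemma runs_conv w raw K s : 2 <= K -> wide w K s -> rg s 10 = K -> rg s 11 = 2 ^ K ->
  (forall o, o < 2 ^ K -> ar s 1 o <= 1) ->
  runs w raw ConvC s (20 * 1000 * (K * 2 ^ K))
    (fun s' => keep (iota 12 17) [:: 2; 3; 4; 5] s s' /\
       forall m, m < 2 ^ K -> ar s' 5 m = conv K (trunc (2 ^ K) (ar s 1)) m).
Proof.
move=> hK hw e10 e11 hB.
have [w8 w4 w1 wN Z0] := wide_facts hK hw; have [hN hS hR eZ] := radix_facts hK.
have hT : 200 + (5000 * (K * 2 ^ K) + (3000 * 2 ^ K + (100 * 2 ^ K + (4100 * (K * 2 ^ K) +
   (3000 * 2 ^ K + (4100 * (K * 2 ^ K) + 3000 * 2 ^ K)))))) <= 20 * 1000 * (K * 2 ^ K).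
  have : 2 * 2 ^ K <= K * 2 ^ K by rewrite leq_mul2r hK orbT.
  lia.
apply: runs_weak _ hT (fun s' h => h).
apply: runs_seq (runs_consts raw hK hw e10 e11) _ => s1 [k1 env1].
have hw1 := wide_keep k1 isT hw.
apply: runs_seq (runs_root raw hK env1 hw1) _ => s2 [k2 [h21 h22]].
have [env2 hw2] := keep_env_wide k2 isT env1 hw1.
apply: runs_seq (runs_wtab raw hK env2 hw2 h21 h22) _ => s3 [k3 hW].
have [env3 hw3] := keep_env_wide k3 isT env2 hw2.
have hB3 o : o < 2 ^ K -> ar s3 1 o <= 1.
  by move=> ho; rewrite (proj2 k3) // (proj2 k2) // (proj2 k1) //; exact: hB.
apply: runs_seq (runs_fill raw hK env3 hw3 hB3) _ => s4 [k4 hX4].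
have [env4 hw4] := keep_env_wide k4 isT env3 hw3.
have hW4 j : j < 2 ^ K -> ar s4 4 j = rtab K j /\ ar s4 4 j < radix K ^ 4.
  by move=> hj; rewrite (proj2 k4) //; exact: hW.
apply: runs_seq (runs_fft raw hK env4 hw4 (fun o ho => proj2 (hX4 o ho)) (fun o ho => proj2 (hW4 o ho))) _.
move=> s5 [k5 hX5]; have [env5 hw5] := keep_env_wide k5 isT env4 hw4.
have hS5 o : o < 2 ^ K -> ar s5 2 o = spectrum K (trunc (2 ^ K) (ar s 1)) o.
  move=> ho; rewrite hX5 // /spectrum; apply: nfft_ext => // j hj; first by case: (hW4 j hj).
  rewrite (proj1 (hX4 j hj)) /trunc hj (proj2 k3) // (proj2 k2) // (proj2 k1) //.
have hX5' o : o < 2 ^ K -> ar s5 2 o < 2 * radix K ^ 4.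
  move=> ho; rewrite hX5 //; apply: nfft_lt => // j hj; exact: (proj2 (hX4 j hj)).
apply: runs_seq (runs_square raw hK env5 hw5 hX5') _ => s6 [k6 hX6].
have [env6 hw6] := keep_env_wide k6 isT env5 hw5.
have hW6 j : j < 2 ^ K -> ar s6 4 j = rtab K j /\ ar s6 4 j < radix K ^ 4.
  by move=> hj; rewrite (proj2 k6) // (proj2 k5) //; exact: hW4.
have hX6' o : o < 2 ^ K -> ar s6 2 o < 2 * radix K ^ 4.
  move=> ho; rewrite hX6 //; have := @cmul_lt (scale K) (radix K) (ar s5 2 o) (ar s5 2 o) Z0; lia.
apply: runs_seq (runs_fft raw hK env6 hw6 hX6' (fun o ho => proj2 (hW6 o ho))) _.
move=> s7 [k7 hX7]; have [env7 hw7] := keep_env_wide k7 isT env6 hw6.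
have hX7' o : o < 2 ^ K -> ar s7 2 o < 2 * radix K ^ 4.
  by move=> ho; rewrite hX7 //; exact: nfft_lt.
apply: runs_weak (runs_out raw hK env7 hw7 hX7') (leqnn _) _ => s8 [k8 hX8]; split.
  apply: (keep_trans (kept k1 _ _)) => //.
  apply: (keep_trans (kept k2 _ _)) => //.
  apply: (keep_trans (kept k3 _ _)) => //.
  apply: (keep_trans (kept k4 _ _)) => //.
  apply: (keep_trans (kept k5 _ _)) => //.
  apply: (keep_trans (kept k6 _ _)) => //.
  apply: (keep_trans (kept k7 _ _)) => //.
  exact: kept k8 _ _.
move=> m hm; rewrite hX8 // /conv.
have hm' : (2 ^ K - m) %% 2 ^ K < 2 ^ K by rewrite ltn_mod expn_gt0.
have -> : ar s7 2 ((2 ^ K - m) %% 2 ^ K) = conv_raw K (trunc (2 ^ K) (ar s 1)) ((2 ^ K - m) %% 2 ^ K).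
  rewrite hX7 // /conv_raw; apply: nfft_ext => // j hj; first by case: (hW6 j hj).
  by rewrite hX6 // hS5.
by [].
Qed.

(** * Deciding representability *)

Lemma runs_sumset w raw K s : 2 <= K -> wide w K s -> rg s 10 = K -> rg s 11 = 2 ^ K ->
  (forall o, o < 2 ^ K -> ar s 1 o <= 1) ->
  runs w raw ConvC s (20 * 1000 * (K * 2 ^ K))
    (fun s' => keep (iota 12 17) [:: 2; 3; 4; 5] s s' /\
       forall m, m < 2 ^ K -> ar s' 5 m <= 1 /\
         (ar s' 5 m != 0 <-> exists p q, [/\ p < 2 ^ K, q < 2 ^ K, ar s 1 p != 0,
            ar s 1 q != 0 & (p + q) %% 2 ^ K = m])).
Proof.
move=> hK hw e10 e11 hB.
apply: runs_weak (runs_conv raw hK hw e10 e11 hB) (leqnn _) _ => s' [hk hc]; split=> // m hm.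
have hT o : trunc (2 ^ K) (ar s 1) o <= 1 by rewrite /trunc; case: ifP => // /hB.
(* The program computes with natural numbers only; the field occurs just in the analysis, and the
   real algebraic numbers are a concrete real closed field. *)
rewrite hc //; have [h1 h2] := conv_spec realalg hK hT hm; split=> //.
apply: (iff_trans h2); split=> -[p [q [hp hq]]]; rewrite /trunc ?hp ?hq => bp bq e; exists p, q; split=> //.
  by rewrite hp.
by rewrite hq.
Qed.

(** Tests become 0-1 valued arithmetic, so that they can be multiplied into table entries without
    branching. *)
Definition nzE (e : expr) : expr := esub (Cst 1) (esub (Cst 1) e).

Definition ltE (x y : expr) : expr := nzE (esub y x).

Lemma eval_nzE raw s e : eval raw s (nzE e) = (eval raw s e != 0).
Proof. by rewrite /=; case: eval => //= n; rewrite subnS /= sub0n. Qed.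

Lemma eval_ltE raw s x y : eval raw s (ltE x y) = (eval raw s x < eval raw s y).
Proof. by rewrite eval_nzE /= subn_eq0 -ltnNge. Qed.

Lemma safe_nzE w raw s e : 1 < 2 ^ w -> safe w raw s e -> safe w raw s (nzE e).
Proof. by move=> h1 h; do ! split. Qed.

Lemma safe_ltE w raw s x y : 1 < 2 ^ w -> safe w raw s x -> safe w raw s y ->
  safe w raw s (ltE x y).
Proof. by move=> h1 hx hy; apply: safe_nzE => //; split. Qed.

(** * Windows and the descent through the levels *)

Section Main.
Variables (w n : nat) (a : nat -> nat) (t c : nat) (raw : nat -> nat).
Hypothesis va : valid_instance n a.
Hypothesis hc : c = 8 * 432.
Hypothesis hw : (t + a n + 2) ^ c <= 2 ^ w.

Let M := a n.
Let rep := representable n a.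
Let base := 64 * (n + 2).

Lemma M_gt : n < M. Proof. exact: size_lt_max va. Qed.

Lemma small_words : 4096 * ((t + M + 2) * (t + M + 2) * (t + M + 2) * (t + M + 2)) < 2 ^ w.
Proof.
apply: leq_trans hw; apply: (@leq_ltn_trans ((t + M + 2) ^ (12 + 4))).
  rewrite expnD; apply: leq_mul.
    by rewrite -[4096]/(2 ^ 12) leq_exp2r //; lia.
  by rewrite !expnS expn0 muln1 !mulnA.
by rewrite ltn_exp2l //; lia.
Qed.

(** Here [432 = 9 * 48] rewrites [radix K ^ 9] as [(2^K)^432], and [128 = 2^7] gives
    [2^K <= 128 M <= (t + M + 2)^8]. This is where [c = 8 * 432] comes from. *)
Lemma wide_main K s : 2 ^ K <= 128 * M -> rg s 0 = base -> wide w K s.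
Proof.
move=> hK h0; have hM := M_gt; split.
  have -> : radix K ^ 9 = (2 ^ K) ^ 432 by rewrite /radix -[LHS]expnM.
  apply: leq_trans hw; rewrite hc expnM leq_exp2r //.
  apply: leq_trans hK _; rewrite [_ ^ 8]expnSr; apply: leq_mul; last by lia.
  by rewrite -[128]/(2 ^ 7) leq_exp2r //; lia.
rewrite h0 /base; have := small_words; set B := t + M + 2.
have hB : B <= B * B * B * B by rewrite -!mulnA leq_pmulr // /B; lia.
by move: hB; rewrite /B; lia.
Qed.

(** Marks are nonzero words up to [M] and not just 1, because the prelude marks generators with the
    value [M]. *)
Record env_ok (s : state) : Prop := EnvOk {
  inv0 : rg s 0 = base;
  inv1 : rg s 1 = M;
  inv2 : rg s 2 = t;
  inv_chi : forall x, ar s 0 x <= M /\ (ar s 0 x != 0 <-> x = 0 \/ exists2 i, i <= n & x = a i) }.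

Lemma env_ok_keep R A s s' : keep R A s s' -> all (fun r => r \notin R) [:: 0; 1; 2] -> 0 \notin A ->
  env_ok s -> env_ok s'.
Proof.
move=> [hr ha]; rewrite /= andbT => /and3P[h0 h1 h2] hA [i0 i1 i2 i3].
by split; rewrite ?hr // => x; rewrite ha.
Qed.

Definition window (s : state) (off u : nat) : Prop :=
  forall x, x < u -> ar s 6 x <= 1 /\ (ar s 6 x != 0 <-> rep (off + x)).

Definition baseT : expr :=
  emul (ltE (Var 8) (emul (Cst 2) (Var 4)))
       (nzE (eadd (Get 0 (Var 8)) (emul (ltE (Var 8) (Var 4)) (Get 6 (Var 8))))).

(** [rep_double] asks for three summands, each 0, a generator or an element below [u]. Two sumsets
    yield four summands, one of which can be 0. Cutting at [2 u] before each sumset keeps sums below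
    [4 u = 2^K], so nothing wraps around. *)
Definition BaseStepC : cmd :=
  Seq (Tab 8 (Var 11) 1 baseT)
  (Seq ConvC
  (Seq (Tab 8 (Var 11) 1 (emul (ltE (Var 8) (emul (Cst 2) (Var 4))) (Get 5 (Var 8))))
  (Seq ConvC
  (Seq (Tab 8 (emul (Cst 2) (Var 4)) 6 (Get 5 (Var 8)))
  (Seq (Assign 4 (emul (Var 4) (Cst 2)))
  (Seq (Assign 10 (eadd (Var 10) (Cst 1)))
       (Assign 11 (emul (Var 11) (Cst 2))))))))).

Definition base_regs : seq nat := [:: 4; 8; 10; 11] ++ iota 12 17.

Lemma runs_base_step k s : env_ok s -> 2 ^ k < 16 * M ->
  rg s 4 = 2 ^ k -> rg s 10 = k + 2 -> rg s 11 = 2 ^ (k + 2) -> window s 0 (2 ^ k) ->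
  runs w raw BaseStepC s (60 * 1000 * ((k + 2) * 2 ^ (k + 2)))
    (fun s' => [/\ keep base_regs [:: 1; 2; 3; 4; 5; 6] s s', rg s' 4 = 2 ^ k.+1,
       rg s' 10 = k.+1 + 2, rg s' 11 = 2 ^ (k.+1 + 2) & window s' 0 (2 ^ k.+1)]).
Proof.
move=> hi hk e4 e10 e11 hV.
have hM := M_gt; have hsw := small_words; set u := 2 ^ k in hk e4 hV *.
have hKu : 2 ^ (k + 2) = 4 * u by rewrite expnD mulnC.
have u0 : 0 < u by rewrite expn_gt0.
have hKM : 2 ^ (k + 2) <= 128 * M by rewrite hKu; lia.
have hB : t + M + 2 <= (t + M + 2) * (t + M + 2) * (t + M + 2) * (t + M + 2).
  by rewrite -!mulnA leq_pmulr // ; lia.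
have hMw : 4096 * (t + M + 2) < 2 ^ w by lia.
have h1w : 1 < 2 ^ w by lia.
have hT : (4 * u * (200 + 40) + 40) + (20 * 1000 * ((k + 2) * 2 ^ (k + 2)) +
   ((4 * u * (100 + 40) + 40) + (20 * 1000 * ((k + 2) * 2 ^ (k + 2)) +
   ((2 * u * (100 + 40) + 40) + (7 + (7 + 7)))))) <= 60 * 1000 * ((k + 2) * 2 ^ (k + 2)).
  have : 2 * (4 * u) <= (k + 2) * (4 * u) by rewrite leq_mul2r; lia.
  rewrite hKu; lia.
apply: runs_weak _ hT (fun s' h => h).
pose b1 x := if x < 2 * u then ((ar s 0 x != 0) || ((x < u) && (ar s 6 x != 0)) : nat) else 0.
apply: (runs_seq (Q1 := fun s' => keep [:: 8] [:: 1] s s' /\ filled s 1 b1 (4 * u) s')).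
  apply: runs_tab_le => //.
  - lia.
  - by rewrite (inv0 hi) /base; lia.
  - by move=> s' hkp /=; rewrite (proj1 hkp) // e11 hKu.
  move=> x s' hx hkp h8 _.
  have i' : env_ok s' by apply: env_ok_keep hkp _ _ hi.
  have r4 : rg s' 4 = u by rewrite (proj1 hkp).
  have a0 : ar s' 0 x = ar s 0 x by rewrite (proj2 hkp).
  have a6 : ar s' 6 x = ar s 6 x by rewrite (proj2 hkp).
  have b0 := inv0 i'; have [c1 c2] := inv_chi i' x; rewrite /base in b0.
  have sl2 : safe w raw s' (ltE (Var 8) (emul (Cst 2) (Var 4))).
    by apply: safe_ltE => //=; rewrite r4; do ! split=> //; lia.
  have sl1 : safe w raw s' (ltE (Var 8) (Var 4)) by exact: safe_ltE.
  have v2 : eval raw s' (ltE (Var 8) (emul (Cst 2) (Var 4))) = (x < 2 * u) by rewrite eval_ltE /= h8 r4.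
  have v1 : eval raw s' (ltE (Var 8) (Var 4)) = (x < u) by rewrite eval_ltE /= h8 r4.
  have sg0 : safe w raw s' (Get 0 (Var 8)) by split=> //=; rewrite h8 b0; lia.
  have sg6 : safe w raw s' (Get 6 (Var 8)) by split=> //=; rewrite h8 b0; lia.
  have hlv : (x < u) * ar s 6 x <= 1.
    by case: ltnP => hxu; rewrite ?mul0n // mul1n; case: (hV x hxu).
  set e6 := emul (ltE (Var 8) (Var 4)) (Get 6 (Var 8)).
  have v6 : eval raw s' e6 = (x < u) * ar s 6 x.
    by rewrite -[LHS]/(eval raw s' (ltE (Var 8) (Var 4)) * ar s' 6 (rg s' 8)) v1 h8 a6.
  have s6 : safe w raw s' e6.
    by split=> //; rewrite -[X in X < _]/(eval raw s' e6) v6; lia.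
  set e06 := eadd (Get 0 (Var 8)) e6.
  have v06 : eval raw s' e06 = ar s 0 x + (x < u) * ar s 6 x.
    by rewrite -[LHS]/(ar s' 0 (rg s' 8) + eval raw s' e6) v6 h8 a0.
  have s06 : safe w raw s' e06.
    by split=> //; rewrite -[X in X < _]/(eval raw s' e06) v06 -a0; lia.
  have sn := safe_nzE h1w s06.
  have vn : eval raw s' (nzE e06) = ((ar s 0 x != 0) || ((x < u) && (ar s 6 x != 0))).
    rewrite eval_nzE v06 addn_eq0 muln_eq0 negb_and negb_or eqb0 negbK //.
  have vT : eval raw s' baseT = b1 x.
    rewrite -[LHS]/(eval raw s' (ltE (Var 8) (emul (Cst 2) (Var 4))) * eval raw s' (nzE e06)) v2 vn /b1.
    by case: ifP; rewrite ?mul1n ?mul0n.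
  split=> //; split=> //; rewrite -[X in X < _]/(eval raw s' baseT) vT /b1.
  by case: ifP => _; [case: (_ || _) | ]; lia.
move=> s1 [k1 f1].
have i1 : env_ok s1 by apply: env_ok_keep k1 _ _ hi.
have r1 r : r != 8 -> rg s1 r = rg s r by move=> hr; rewrite (proj1 k1) // inE.
have b1le o : o < 2 ^ (k + 2) -> ar s1 1 o <= 1.
  by rewrite hKu => ho; rewrite f1 ho /b1; case: ifP => // _; case: (_ || _).
have b1E x : x < 4 * u -> (ar s1 1 x != 0 <->
    x < 2 * u /\ (x = 0 \/ (exists2 i, i <= n & x = a i) \/ (x < u /\ rep x))).
  move=> hx; rewrite f1 hx /b1; case: (ltnP x (2 * u)) => h2; last by split=> // -[].
  rewrite eqb0 negbK; have [_ hchi] := inv_chi hi x; split.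
    case/orP=> [/hchi [->|hx']|/andP[hxu /(proj1 (proj2 (hV x hxu)))]].
    - by split=> //; left.
    - by split=> //; right; left.
    - by rewrite add0n => hr; split=> //; right; right.
  case=> _ [h0|[h0|[hxu hr]]]; apply/orP.
  - by left; apply/hchi; left.
  - by left; apply/hchi; right.
  - by right; rewrite hxu /=; apply/(proj2 (hV x hxu)).
have rep1 x : x < 4 * u -> ar s1 1 x != 0 -> rep x.
  move=> hx /(b1E x hx) [_ [->|[[i hin ->]|[]//]]]; [exact: rep0 | exact: rep_gen].
apply: runs_seq (runs_sumset raw _ (wide_main hKM (inv0 i1)) _ _ b1le) _; rewrite ?r1 //; first by lia.
move=> s2 [k2 f2].
have i2 : env_ok s2 by apply: env_ok_keep k2 _ _ i1.
have r2 r : r < 12 -> r != 8 -> rg s2 r = rg s r.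
  by move=> hr hr8; rewrite (proj1 k2) ?r1 // mem_iota; lia.
pose b2 x := (x < 2 * u) * ar s2 5 x.
apply: (runs_seq (Q1 := fun s' => keep [:: 8] [:: 1] s2 s' /\ filled s2 1 b2 (4 * u) s')).
  set eB := emul _ (Get 5 _).
  apply: runs_tab_le => //.
  - lia.
  - by rewrite (inv0 i2) /base; lia.
  - by move=> s' hkp /=; rewrite (proj1 hkp) // r2 // e11 hKu.
  move=> x s' hx hkp h8 _.
  have r4 : rg s' 4 = u by rewrite (proj1 hkp) // r2.
  have b0 : rg s' 0 = base by rewrite (proj1 hkp) // (inv0 i2).
  rewrite /base in b0.
  have sl2 : safe w raw s' (ltE (Var 8) (emul (Cst 2) (Var 4))).
    by apply: safe_ltE => //=; rewrite r4; do ! split=> //; lia.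
  have v2 : eval raw s' (ltE (Var 8) (emul (Cst 2) (Var 4))) = (x < 2 * u) by rewrite eval_ltE /= h8 r4.
  have sg : safe w raw s' (Get 5 (Var 8)) by split=> //=; rewrite h8 b0; lia.
  have v : eval raw s' eB = b2 x.
    rewrite -[LHS]/(eval raw s' (ltE (Var 8) (emul (Cst 2) (Var 4))) * ar s' 5 (rg s' 8)) v2 h8.
    by rewrite (proj2 hkp).
  split=> //; split=> //; rewrite -[X in X < _]/(eval raw s' eB) v /b2.
  have [|h1 _] := f2 x; first by rewrite hKu.
  by case: (x < _); lia.
move=> s3 [k3 f3].
have i3 : env_ok s3 by apply: env_ok_keep k3 _ _ i2.
have r3 r : r < 12 -> r != 8 -> rg s3 r = rg s r.
  by move=> hr hr8; rewrite (proj1 k3) ?r2 // inE.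
have b2le o : o < 2 ^ (k + 2) -> ar s3 1 o <= 1.
  rewrite hKu => ho; rewrite f3 ho /b2; have [|h1 _] := f2 o; first by rewrite hKu.
  by case: (o < _); lia.
have b2E x : x < 4 * u -> (ar s3 1 x != 0 <-> x < 2 * u /\
    exists p q, [/\ p + q = x, p < 2 * u, q < 2 * u, ar s1 1 p != 0 & ar s1 1 q != 0]).
  move=> hx; rewrite f3 hx /b2; have [|_ hE] := f2 x; first by rewrite hKu.
  case: (ltnP x (2 * u)) => h2; last by rewrite mul0n; split=> // -[].
  rewrite mul1n; apply: (iff_trans hE); rewrite hKu; split.
    case=> p [q [hp hq bp bq e]]; split=> //.
    have [hp2 _] := proj1 (b1E p hp) bp; have [hq2 _] := proj1 (b1E q hq) bq.
    by exists p, q; rewrite modn_small in e; [split | lia].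
  case=> _ [p [q [e hp hq bp bq]]]; exists p, q; split=> //; try lia.
  by rewrite modn_small; lia.
apply: runs_seq (runs_sumset raw _ (wide_main hKM (inv0 i3)) _ _ b2le) _; rewrite ?r3 //; first by lia.
move=> s4 [k4 f4].
have i4 : env_ok s4 by apply: env_ok_keep k4 _ _ i3.
have r4 r : r < 12 -> r != 8 -> rg s4 r = rg s r.
  by move=> hr hr8; rewrite (proj1 k4) ?r3 // mem_iota; lia.
apply: (runs_seq (Q1 := fun s' => keep [:: 8] [:: 6] s4 s' /\ filled s4 6 (ar s4 5) (2 * u) s')).
  apply: runs_tab_le => //.
  - lia.
  - by rewrite (inv0 i4) /base; lia.
  - move=> s' hkp /=; rewrite (proj1 hkp) // r4 // e4; do ! split=> //; lia.
  move=> x s' hx hkp h8 _.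
  have b0 : rg s' 0 = base by rewrite (proj1 hkp) // (inv0 i4).
  rewrite /base in b0.
  by split; [split=> //=; rewrite h8 b0; lia | rewrite /= h8 (proj2 hkp)].
move=> s5 [k5 f5].
have r5 r : r < 12 -> r != 8 -> rg s5 r = rg s r.
  by move=> hr hr8; rewrite (proj1 k5) ?r4 // inE.
have hfin x : x < 2 * u -> ar s5 6 x <= 1 /\ (ar s5 6 x != 0 <-> rep (0 + x)).
  move=> hx; rewrite f5 hx add0n; have [|h1 hE] := f4 x; first by rewrite hKu; lia.
  split=> //; apply: (iff_trans hE); rewrite hKu; split.
    case=> p [q [hp hq bp bq e]].
    have [hp2 [p1 [p2 [ep lp1 lp2 bp1 bp2]]]] := proj1 (b2E p hp) bp.
    have [hq2 [q1 [q2 [eq lq1 lq2 bq1 bq2]]]] := proj1 (b2E q hq) bq.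
    rewrite modn_small in e; last by lia.
    rewrite -e -ep -eq; apply: repD; apply: repD; apply: rep1 => //; lia.
  move=> hr; have [x1 [y1 [z1 [[rx lx] [rz lz] hy e]]]] := rep_double va u0 hx hr.
  have bx : ar s1 1 x1 != 0 by apply/b1E; [lia | split; [lia | right; right]].
  have bz : ar s1 1 z1 != 0 by apply/b1E; [lia | split; [lia | right; right]].
  have b0 : ar s1 1 0 != 0 by apply/b1E; [lia | split; [lia | left]].
  have by1 : ar s1 1 y1 != 0.
    by apply/b1E; [lia | split; [lia | case: hy => hy; [left | right; left]]].
  exists (x1 + y1), z1; split; try lia.
  - apply/b2E; first by lia.
    by split; [lia | exists x1, y1; split=> //; lia].
  - apply/b2E; first by lia.
    by split; [lia | exists z1, 0; split=> //; lia].
  - by rewrite modn_small; lia.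
apply: runs_let => /=; first by rewrite r5 // e4; do ! split=> //; lia.
apply: runs_let => /=.
  rewrite updN // r5 // e10; do ! split=> //.
  by have := ltn_expl (k + 2) (isT : 1 < 2); lia.
apply: runs_assign => //=.
  rewrite !updN // r5 // e11 hKu; do ! split=> //; lia.
split.
- do 3 (apply: keep_setr; first by []).
  apply: (keep_trans (kept k1 _ _)) => //; apply: (keep_trans (kept k2 _ _)) => //.
  apply: (keep_trans (kept k3 _ _)) => //; apply: (keep_trans (kept k4 _ _)) => //.
  exact: kept k5 _ _.
- by rewrite /= !(updE, updN) // r5 // e4 expnS mulnC.
- by rewrite /= !(updE, updN) // r5 // e10 addn1 addSn.
- by rewrite /= !(updE, updN) // r5 // e11 addSn expnS mulnC.
- by move=> x; rewrite expnS; exact: hfin.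
Qed.

Lemma word_facts : [/\ 4096 * (t + M + 2) < 2 ^ w,
  4096 * ((t + M + 2) * (t + M + 2)) < 2 ^ w & 1 < 2 ^ w].
Proof.
have := small_words; have := M_gt; set B := t + M + 2 => hM h.
have h1 : B <= B * B by rewrite leq_pmulr // /B; lia.
have h2 : B * B <= B * B * B * B by rewrite -[B * B * B * B]mulnA leq_pmulr // muln_gt0 /B; lia.
by split; lia.
Qed.

Definition BaseC : cmd :=
  Seq (Assign 4 (Cst 1)) (Seq (Assign 10 (Cst 2)) (Seq (Assign 11 (Cst 4))
    (Seq (Put 6 (Cst 0) (Cst 1))
      (While (esub (emul (Cst 16) (Var 1)) (Var 4)) BaseStepC)))).

Let kk := up_log 2 (16 * M).
Let U := 2 ^ kk.

Lemma U_bounds : 16 * M <= U < 32 * M.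
Proof.
have hM := M_gt; have := @up_log_bounds 2 (16 * M) isT; rewrite -/kk => /(_ _)/andP[|h1 h2]; first by lia.
apply/andP; split=> //; rewrite /U; case: (kk) h1 h2 => [|k] /= h1 h2; first by rewrite expn0; lia.
by rewrite expnS; lia.
Qed.

Lemma sum_pow2 k : \sum_(j < k) 2 ^ (k - j) < 2 ^ k.+1.
Proof.
elim: k => [|k IH]; first by rewrite big_ord0.
rewrite big_ord_recl subn0 [2 ^ k.+2]expnS mul2n -addnn -addnS leq_add2l.
exact: IH.
Qed.

(** Window lengths double, so the costs of the sumsets form a geometric series of the order of its
    last term. *)
Lemma runs_base s : env_ok s ->
  runs w raw BaseC s (70 * 1000 * ((kk + 2) * 2 ^ (kk + 2)))
    (fun s' => [/\ keep base_regs [:: 1; 2; 3; 4; 5; 6] s s', rg s' 4 = U,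
       rg s' 10 = kk + 2, rg s' 11 = 2 ^ (kk + 2) & window s' 0 U]).
Proof.
move=> hi; have hM := M_gt; have [hB hB2 h1w] := word_facts; have /andP[hU1 hU2] := U_bounds.
pose e := esub (emul (Cst 16) (Var 1)) (Var 4).
pose T j := 60 * 1000 * ((kk - j.+1 + 2) * 2 ^ (kk - j.+1 + 2)).
have hT : 3 + (3 + (3 + (10 + (\sum_(j < kk) (ce e + T j + 1) + ce e)))) <=
    70 * 1000 * ((kk + 2) * 2 ^ (kk + 2)).
  have -> : ce e = 8 by [].
  have [A eA] : exists A, A = 60 * 1000 * (kk + 2) * 2 by eexists.
  have hs : \sum_(j < kk) (8 + T j + 1) <= \sum_(j < kk) (9 + A * 2 ^ (kk - j)).
    apply: leq_sum => j _; have hj := ltn_ord j; rewrite /T.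
    have -> : kk - j.+1 + 2 = (kk - j).+1 by lia.
    rewrite expnS.
    have : (kk - j).+1 * (2 * 2 ^ (kk - j)) <= (kk + 2) * (2 * 2 ^ (kk - j)) by rewrite leq_mul2r; lia.
    lia.
  have := sum_pow2 kk; rewrite expnS -/U => h2.
  have eR : \sum_(j < kk) (9 + A * 2 ^ (kk - j)) = kk * 9 + A * \sum_(j < kk) 2 ^ (kk - j).
    by rewrite big_split /= sum_nat_const card_ord big_distrr.
  rewrite eR in hs.
  have h3 : (kk + 2) * \sum_(j < kk) 2 ^ (kk - j) <= (kk + 2) * (2 * U) by rewrite leq_mul2l ltnW ?orbT.
  have eU : 2 ^ (kk + 2) = 4 * U by rewrite expnD mulnC.
  have h4 : kk + 2 <= (kk + 2) * U by rewrite leq_pmulr //; lia.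
  rewrite eU; lia.
apply: runs_weak _ hT (fun s' h => h).
apply: runs_let => /=; first by lia.
apply: runs_let => /=; first by lia.
apply: runs_let => /=; first by lia.
set s0 := setr _ 11 4; pose s1 := seta s0 6 0 1.
apply: (runs_seq (Q1 := fun s' => s' = s1)).
  apply: runs_put => //=; try lia.
  by rewrite !updN // (inv0 hi) /base; lia.
move=> _ ->.
have k1 : keep base_regs [:: 1; 2; 3; 4; 5; 6] s s1.
  by apply: keep_seta => //; do 3 (apply: keep_setr => //).
pose I j s' := [/\ j <= kk, keep base_regs [:: 1; 2; 3; 4; 5; 6] s s', rg s' 4 = 2 ^ (kk - j),
   rg s' 10 = kk - j + 2 & rg s' 11 = 2 ^ (kk - j + 2) /\ window s' 0 (2 ^ (kk - j))].
apply: runs_weak (@runs_while _ _ e BaseStepC I T kk _ _ _ _ _) (leqnn _) _.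
- move=> j s' [_ hk h4 _ _]; have i' : env_ok s' by apply: env_ok_keep hk _ _ hi.
  by rewrite /= (inv1 i'); do ! split=> //; rewrite -/M; lia.
- move=> s' [_ hk h4 _ _]; have i' : env_ok s' by apply: env_ok_keep hk _ _ hi.
  by rewrite /= (inv1 i') h4 subn0 -/U -/M; lia.
- move=> j s' [hj hk h4 h10 [h11 hV]] hne; have i' : env_ok s' by apply: env_ok_keep hk _ _ hi.
  have ej : kk - j = (kk - j.+1).+1 by lia.
  have hlt : 2 ^ (kk - j.+1) < 16 * M.
    by move: hne; rewrite /= (inv1 i') h4 -/M; lia.
  apply: runs_weak (runs_base_step i' hlt h4 h10 h11 hV) (leqnn _) _.
  move=> s2 [hk2 h42 h102 h112 hV2]; split; rewrite ?ej //; first by lia.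
  exact: keep_trans hk hk2.
- split=> //; rewrite ?subnn //= ?updE ?updN //.
  split=> // x; rewrite expn0 ltnS leqn0 => /eqP -> /=; rewrite updE; split=> //.
  by split=> // _; rewrite addn0; exact: rep0.
- move=> s' [/= he [j [hj hk h4 h10 [h11 hV]]]]; have i' : env_ok s' by apply: env_ok_keep hk _ _ hi.
  have j0 : j = 0.
    case: j hj h4 {h10 h11 hV} => // j hj h4; exfalso.
    have : 2 ^ (kk - j.+1) < 16 * M.
      have hkk : 0 < kk by lia.
      have := @up_log_bounds 2 (16 * M) isT; rewrite -/kk => /(_ _)/andP[|h _]; first by lia.
      by apply: leq_ltn_trans h; rewrite leq_exp2l //; lia.
    by move: he; rewrite (inv1 i') h4 -/M; lia.
  by rewrite j0 subn0 in h4 h10 h11 hV.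
Qed.

Definition excessE : expr := esub (ediv (Var 2) (Var 5)) (emul (Cst 4) (Var 1)).

Definition PowC : cmd :=
  Seq (Assign 5 (Cst 1)) (While excessE (Assign 5 (emul (Var 5) (Cst 2)))).

(** At this level truncated subtraction gives [off J = 0], so the window obtained by doubling is the
    window of level [J]. The second clause later forces [off j] above the Frobenius number within
    few levels. *)
Definition top_level (J : nat) : Prop :=
  t %/ 2 ^ J <= 4 * M /\ (J = 0 \/ 4 * M < t %/ 2 ^ J.-1).

Lemma top_level_exists : exists J, top_level J.
Proof.
have hM := M_gt; have ex : exists J, t %/ 2 ^ J <= 4 * M.
  exists t; rewrite divn_small //; exact: ltn_expl.
have [J hJ hmin] := ex_minnP ex; exists J; split=> //.
case: J hJ hmin => [|J] hJ hmin; [by left | right].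
by rewrite ltnNge /=; apply/negP => /hmin; rewrite ltnn.
Qed.

Lemma top_level_pow J : top_level J -> 2 ^ J <= 2 * t + 1.
Proof.
case=> _ [->|]; first by rewrite expn0; lia.
case: J => [|J] /= h; first by rewrite expn0; lia.
have : 2 ^ J <= t by case: (leqP (2 ^ J) t) h => // h'; rewrite divn_small.
by rewrite expnS; lia.
Qed.

Lemma runs_pow J s : env_ok s -> top_level J ->
  runs w raw PowC s (40 * (J + 1)) (fun s' => keep [:: 5] [::] s s' /\ rg s' 5 = 2 ^ J).
Proof.
move=> hi hJ; have hM := M_gt; have [hB hB2 h1w] := word_facts.
have hJp := top_level_pow hJ.
pose I j s' := [/\ j <= J, keep [:: 5] [::] s s' & rg s' 5 = 2 ^ (J - j)].
have hT : 3 + (\sum_(j < J) (ce excessE + 6 + 1) + ce excessE) <= 40 * (J + 1).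
  by rewrite sum_nat_const card_ord (_ : ce excessE = 11) //; lia.
have lt_level j : j < J -> 4 * M < t %/ 2 ^ j.
  move=> hj; case: hJ => _ [e|h]; first by lia.
  apply: leq_trans h _; apply: leq_div2l; first by rewrite expn_gt0.
  by rewrite leq_exp2l //; lia.
apply: runs_weak _ hT (fun s' h => h).
apply: runs_let => //=; set s1 := setr s 5 1.
apply: runs_weak (@runs_while _ _ _ _ I (fun=> 6) J s1 _ _ _ _) (leqnn _) _.
- move=> j s' [_ hk _]; have i' : env_ok s' by apply: env_ok_keep hk _ _ hi.
  by rewrite /= (inv1 i') -/M; do ! split=> //; lia.
- move=> s' [_ hk h5]; have i' : env_ok s' by apply: env_ok_keep hk _ _ hi.
  by rewrite /= (inv1 i') (inv2 i') h5 subn0 -/M; case: hJ; lia.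
- move=> j s' [hj hk h5] _; apply: runs_assign => //=.
    have : 2 ^ (J - j.+1) <= 2 ^ J by rewrite leq_exp2l //; lia.
    by rewrite h5; do ! split=> //; lia.
  split; [lia | exact: keep_setr | rewrite /= updE h5 mulnC -expnS; congr expn; lia].
- by split=> //; [apply: keep_setr | rewrite /= updE subnn].
- move=> s' [/= he [j [hj hk h5]]]; split=> //; have i' : env_ok s' by apply: env_ok_keep hk _ _ hi.
  rewrite h5; case: j hj h5 => [|j] hj h5; first by rewrite subn0.
  have := lt_level (J - j.+1); move: he; rewrite (inv1 i') (inv2 i') h5 -/M; lia.
Qed.

(** Register 29 is the loop guard. As a product it vanishes exactly when level 0 is reached or when
    the first [M] entries of the window are all representable. *)
Definition CheckC : cmd :=
  Seq (Assign 30 (Cst 0))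
  (Seq (For 8 (Var 1) (Assign 30 (eadd (Var 30) (Get 6 (Var 8)))))
       (Assign 29 (emul (esub (Var 5) (Cst 1)) (esub (Var 1) (Var 30))))).

Lemma sum_bits (f : nat -> nat) m : (forall x, x < m -> f x <= 1) ->
  \sum_(x < m) f x <= m /\ (\sum_(x < m) f x = m <-> forall x, x < m -> f x != 0).
Proof.
elim: m => [|m IH] hf; first by rewrite big_ord0.
have [h1 h2] := IH (fun x hx => hf x (ltnW hx)); have h3 := hf m (ltnSn m).
rewrite big_ord_recr /=; move: (\sum_(x < m) f x) h1 h2 => A h1 h2.
split; first by lia.
split=> [e x|h].
  rewrite ltnS leq_eqVlt => /orP[/eqP->|hx]; first by lia.
  by apply: (proj1 h2) => //; lia.
by have := h m (ltnSn m); rewrite (proj2 h2) => [|x hx]; [lia | exact: h (ltnW hx)].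
Qed.

Lemma runs_check s j off : env_ok s -> rg s 5 = 2 ^ j -> 2 ^ j <= 2 * t + 1 -> window s off U ->
  runs w raw CheckC s (100 * M)
    (fun s' => [/\ keep [:: 8; 29; 30] [::] s s', rg s' 30 <= M,
       rg s' 30 = M <-> forall x, x < M -> rep (off + x) &
       rg s' 29 = (2 ^ j - 1) * (M - rg s' 30)]).
Proof.
move=> hi h5 hj hV; have hM := M_gt; have [hB hB2 h1w] := word_facts; have /andP[hU1 hU2] := U_bounds.
have hbit x : x < M -> ar s 6 x <= 1 by move=> hx; have [] := hV x; lia.
have [cnt1 cnt2] := sum_bits hbit; set cnt := \sum_(x < M) _ in cnt1 cnt2.
have hT : 3 + ((M * (14 + for_cost (Var 1)) + for_cost (Var 1)) + 12) <= 100 * M.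
  by rewrite (_ : for_cost (Var 1) = 33) //; lia.
apply: runs_weak _ hT (fun s' h => h).
apply: runs_let => /=; first by lia.
set s0 := setr s 30 0.
pose I i s' := [/\ keep [:: 8; 29; 30] [::] s s', rg s' 8 = i & rg s' 30 = \sum_(x < i) ar s 6 x].
apply: (runs_seq (Q1 := I M)).
  apply: runs_for => //.
  - lia.
  - move=> i s' [hk h8 _] hi'; split=> //=; rewrite (proj1 hk) // (inv1 hi) //.
  - move=> i s' [hk h8 h30] hiM.
    have i' : env_ok s' by apply: env_ok_keep hk _ _ hi.
    have [s_le _] := @sum_bits (ar s 6) i (fun x hx => hbit x (ltn_trans hx hiM)).
    have hb := hbit i hiM.
    apply: runs_assign => //=; rewrite h8 h30 (proj2 hk) //.
      by rewrite (inv0 i'); do ! split=> //; lia.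
    rewrite updN //; split=> //; split.
    + by do 2 (apply: keep_setr; first by []).
    + by rewrite /= updE.
    + by rewrite /= updN // updE big_ord_recr.
  - split; rewrite ?big_ord0 /= ?(updE, updN) // ?(updE, updN) // ?(updE, updN) //.
    by do 2 (apply: keep_setr => //).
move=> s1 [hk h8 h30]; rewrite -/cnt in h30.
have hk5 : rg s1 5 = 2 ^ j by rewrite (proj1 hk).
have hk1 : rg s1 1 = M by rewrite (proj1 hk) // (inv1 hi).
have hprod : (2 ^ j - 1) * (M - cnt) <= (2 * (t + M + 2)) * (t + M + 2) by apply: leq_mul; lia.
apply: runs_assign => //=; rewrite hk5 hk1 h30.
  by do ! split=> //; lia.
rewrite !(updE, updN) // h30; split=> //; first exact: keep_setr.
rewrite cnt2; have hxU x : x < M -> x < U by lia.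
by split=> h x hx; have [_ hr] := hV x (hxU x hx); apply/hr; exact: h.
Qed.

(** The window starts [4 M] below [t / 2^j]. Halving keeps [2 M] of this margin and an uneven split
    costs up to [M], so both halves stay above the next offset, [4 M] below half the target. At the
    other end they reach about [U / 2 + 3 M], which [U >= 16 M] keeps inside the window. *)
Definition off (j : nat) : nat := t %/ 2 ^ j - 4 * M.

Lemma off_step j : let d := off j - 2 * off j.+1 in
  off j = 2 * off j.+1 + d /\ d <= 4 * M + 1.
Proof. by rewrite /off expnSr divnMA; lia. Qed.

(* A sum is split greedily near its half; both halves fall into the window one
   level up. *)
Lemma window_split j x : x < U -> let d := off j - 2 * off j.+1 in
  rep (off j + x) <-> exists p q,
    [/\ p < U, q < U, rep (off j.+1 + p), rep (off j.+1 + q) & p + q = x + d].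
Proof.
move=> hx d; have [hd1 hd2] := off_step j; rewrite -/d in hd1 hd2.
have hM := M_gt; have /andP[hU1 hU2] := U_bounds.
split=> [hr|[p [q [hp hq rp rq e]]]]; last first.
  rewrite (_ : off j + x = (off j.+1 + p) + (off j.+1 + q)); last by lia.
  exact: repD rp rq.
have [s1 [s2 [r1 r2 e /andP[h1 h2]]]] := rep_halve va hr; rewrite -/M in h2.
have ho : off j.+1 = t %/ 2 ^ j %/ 2 - 4 * M by rewrite /off expnSr divnMA.
have ho' : off j = t %/ 2 ^ j - 4 * M by [].
have b1 : off j.+1 <= s1 by lia.
have b2 : off j.+1 <= s2 by lia.
by exists (s1 - off j.+1), (s2 - off j.+1); rewrite !subnKC //; split=> //; lia.
Qed.

(** Offsets do not halve exactly: indices in the sumset are relative to [2 * off j.+1], and register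
    31 holds the shift to [off j]. Only the first [U] entries are used, so sums stay below
    [2 U < 2^K]. *)
Definition StepC : cmd :=
  Seq (Tab 8 (Var 11) 1 (emul (ltE (Var 8) (Var 4)) (Get 6 (Var 8))))
  (Seq ConvC
  (Seq (Assign 5 (ediv (Var 5) (Cst 2)))
  (Seq (Assign 31 (esub excessE (emul (Cst 2) (Var 6))))
  (Seq (Assign 6 excessE)
  (Seq (Tab 8 (Var 4) 6 (Get 5 (eadd (Var 8) (Var 31))))
       CheckC))))).

Definition level (j : nat) (s : state) : Prop :=
  [/\ rg s 4 = U, rg s 10 = kk + 2, rg s 11 = 2 ^ (kk + 2), rg s 5 = 2 ^ j &
      rg s 6 = off j /\ window s (off j) U].

Definition checked (j : nat) (s : state) : Prop :=
  [/\ rg s 30 <= M, rg s 30 = M <-> (forall x, x < M -> rep (off j + x)) &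
      rg s 29 = (2 ^ j - 1) * (M - rg s 30)].

Definition main_regs : seq nat := [:: 4; 5; 6; 8; 9; 10; 11; 29; 30; 31] ++ iota 12 17.

Lemma level_keep R A j s s' : keep R A s s' ->
  all (fun r => r \notin R) [:: 4; 5; 6; 10; 11] -> 6 \notin A -> level j s -> level j s'.
Proof.
move=> [hr ha]; rewrite /= andbT => /and5P[h4 h5 h6 h10 h11] hA [e4 e10 e11 e5 [e6 hV]].
split; rewrite ?hr //; split=> // x hx; rewrite ha //; exact: hV.
Qed.

Lemma runs_step j s : env_ok s -> level j.+1 s -> 2 ^ j.+1 <= 2 * t + 1 ->
  runs w raw StepC s (30 * 1000 * ((kk + 2) * 2 ^ (kk + 2)))
    (fun s' => [/\ keep main_regs [:: 1; 2; 3; 4; 5; 6] s s', level j s' & checked j s']).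
Proof.
move=> hi [e4 e10 e11 e5 [e6 hV]] hj.
have hM := M_gt; have [hB hB2 h1w] := word_facts.
have /andP[hU1 hU2] := U_bounds.
have hKu : 2 ^ (kk + 2) = 4 * U by rewrite expnD mulnC.
have hKM : 2 ^ (kk + 2) <= 128 * M by rewrite hKu; lia.
have [hd1 hd2] := off_step j; set d := off j - 2 * off j.+1 in hd1 hd2.
rewrite -/M in hB hB2.
have hT : (4 * U * (100 + 40) + 40) + (20 * 1000 * ((kk + 2) * 2 ^ (kk + 2)) +
   (6 + (17 + (12 + ((U * (100 + 40) + 40) + 100 * M))))) <= 30 * 1000 * ((kk + 2) * 2 ^ (kk + 2)).
  have : 2 * (4 * U) <= (kk + 2) * (4 * U) by rewrite leq_mul2r; lia.
  rewrite hKu; lia.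
apply: runs_weak _ hT (fun s' h => h).
pose b1 x := (x < U) * ar s 6 x.
apply: (runs_seq (Q1 := fun s' => keep [:: 8] [:: 1] s s' /\ filled s 1 b1 (4 * U) s')).
  set eB := emul _ (Get 6 _).
  apply: runs_tab_le => //.
  - lia.
  - by rewrite (inv0 hi); lia.
  - by move=> s' hkp /=; rewrite (proj1 hkp) // e11 hKu.
  move=> x s' hx hkp h8 _.
  have r4 : rg s' 4 = U by rewrite (proj1 hkp).
  have b0 : rg s' 0 = base by rewrite (proj1 hkp) // (inv0 hi).
  rewrite /base in b0.
  have sl2 : safe w raw s' (ltE (Var 8) (Var 4)) by exact: safe_ltE.
  have v2 : eval raw s' (ltE (Var 8) (Var 4)) = (x < U) by rewrite eval_ltE /= h8 r4.
  have sg : safe w raw s' (Get 6 (Var 8)) by split=> //=; rewrite h8 b0; lia.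
  have v : eval raw s' eB = b1 x.
    rewrite -[LHS]/(eval raw s' (ltE (Var 8) (Var 4)) * ar s' 6 (rg s' 8)) v2 h8.
    by rewrite (proj2 hkp).
  split=> //; split=> //; rewrite -[X in X < _]/(eval raw s' eB) v /b1.
  case: (ltnP x U) => hxU; last by rewrite mul0n; lia.
  by have [] := hV x hxU; lia.
move=> s1 [k1 f1].
have i1 : env_ok s1 by apply: env_ok_keep k1 _ _ hi.
have b1le o : o < 2 ^ (kk + 2) -> ar s1 1 o <= 1.
  rewrite hKu => ho; rewrite f1 ho /b1; case: (ltnP o U) => hoU; last by rewrite mul0n.
  by rewrite mul1n; case: (hV o hoU).
have b1E x : x < 4 * U -> (ar s1 1 x != 0 <-> x < U /\ rep (off j.+1 + x)).
  move=> hx; rewrite f1 hx /b1; case: (ltnP x U) => h2; last by rewrite mul0n; split=> // -[].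
  by rewrite mul1n; have [_ hE] := hV x h2; apply: (iff_trans hE); split=> // -[].
have k1r r : r != 8 -> rg s1 r = rg s r by move=> hr; rewrite (proj1 k1) // inE.
apply: runs_seq (runs_sumset raw _ (wide_main hKM (inv0 i1)) _ _ b1le) _; rewrite ?k1r //; first by lia.
move=> s2 [k2 f2].
have i2 : env_ok s2 by apply: env_ok_keep k2 _ _ i1.
have r2 r : r \notin iota 12 17 -> r != 8 -> rg s2 r = rg s r.
  by move=> hr hr8; rewrite (proj1 k2) ?k1r.
have e52 : rg s2 5 = 2 ^ j.+1 by rewrite r2.
have vj : 2 ^ j.+1 %/ 2 = 2 ^ j by rewrite expnSr mulnK.
apply: runs_let => /=; first by do ! split=> //; lia.
rewrite e52 vj.
have vex s' : env_ok s' -> rg s' 5 = 2 ^ j -> eval raw s' excessE = off j /\ safe w raw s' excessE.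
  by move=> i' h5; rewrite /= (inv1 i') (inv2 i') h5; split=> //; do ! split=> //; rewrite -/M; lia.
set s3 := setr _ 5 _.
have [v3 sf3] : eval raw s3 excessE = off j /\ safe w raw s3 excessE.
  by apply: vex; [case: i2 => *; split | rewrite /= updE].
have e63 : rg s3 6 = off j.+1 by rewrite /= updN // r2.
apply: runs_let.
  have hm : 2 * rg s3 6 < 2 ^ w.
    by rewrite e63 /off -/M; have := leq_div t (2 ^ j.+1); lia.
  have h2 : 2 < 2 ^ w by lia.
  by split; [exact: sf3 | split; [exact: h2 | by [] | exact: hm] | by []].
rewrite [eval _ _ _](_ : _ = d); last first.
  by rewrite -[LHS]/(eval raw s3 excessE - 2 * rg s3 6) v3 e63.
set s4 := setr _ 31 _.
have [v4 sf4] : eval raw s4 excessE = off j /\ safe w raw s4 excessE.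
  by apply: vex; [case: i2 => *; split | rewrite /= updN // updE].
apply: runs_let; first exact: sf4.
rewrite v4; set s5 := setr _ 6 _.
have i5 : env_ok s5 by case: i2 => *; split.
pose f6 x := ar s2 5 (x + d).
apply: (runs_seq (Q1 := fun s' => keep [:: 8] [:: 6] s5 s' /\ filled s5 6 f6 U s')).
  set eV := Get 5 _.
  apply: runs_tab_le => //.
  - lia.
  - by rewrite (inv0 i5); lia.
  - by move=> s' hkp /=; rewrite (proj1 hkp) // /s5 /= !updN // r2.
  move=> x s' hx hkp h8 _.
  have b0 : rg s' 0 = base by rewrite (proj1 hkp) // (inv0 i5).
  have h31 : rg s' 31 = d by rewrite (proj1 hkp) // /s5 /= updN // updE.
  rewrite /base in b0; rewrite /= h8 h31 (proj2 hkp) //.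
  by split=> //; rewrite b0; do ! split=> //; lia.
move=> s6 [k6 f6E].
have i6 : env_ok s6 by apply: env_ok_keep k6 _ _ i5.
have r6 r : r != 8 -> rg s6 r = rg s5 r by move=> hr; rewrite (proj1 k6) // inE.
have l6 : level j s6.
  split; rewrite ?r6 // /s5 /= ?(updE, updN) // ?(updE, updN) // ?(updE, updN) // ?r2 //.
  split=> // x hx; rewrite f6E hx /f6; have [|h1 hE] := f2 (x + d); first by rewrite hKu; lia.
  split=> //; apply: (iff_trans hE); apply: iff_trans (iff_sym (window_split j hx)).
  rewrite hKu; split=> -[p [q [hp hq rp rq e]]].
    have [pU rp'] := proj1 (b1E p hp) rp; have [qU rq'] := proj1 (b1E q hq) rq.
    by exists p, q; split=> //; rewrite modn_small // in e; lia.
  exists p, q; split; try lia; last by rewrite modn_small; lia.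
    by apply/b1E; [lia | ].
  by apply/b1E; [lia | ].
have k56 : keep main_regs [:: 1; 2; 3; 4; 5; 6] s s6.
  apply: (keep_trans (kept k1 _ _)) => //; apply: (keep_trans (kept k2 _ _)) => //.
  apply: (@keep_trans _ _ _ s5); last exact: kept k6 _ _.
  by do 3 (apply: keep_setr => //).
have [_ _ _ e56 [_ hV6]] := l6.
apply: runs_weak (runs_check i6 e56 _ hV6) (leqnn _) _.
  by rewrite expnS in hj; lia.
move=> s7 [k7 c1 c2 c3]; split; last by split.
  by apply: (keep_trans k56); exact: kept k7 _ _.
by apply: level_keep k7 _ _ l6.
Qed.

Lemma run_saturates o : (forall x, x < M -> rep (o + x)) -> forall y, o <= y -> rep y.
Proof.
move=> h y hy; have hM := M_gt.
have -> : y = (o + (y - o) %% M) + M * ((y - o) %/ M).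
  by have := divn_eq (y - o) M; lia.
by apply: repD; [apply: h; rewrite ltn_mod; lia | exact: rep_iter].
Qed.

(* Above the Frobenius number the window is full, and below it the level cannot
   drop further than the scale of [min t F]. *)
Lemma stop_level J F : top_level J -> (forall y, F < y -> rep y) ->
  exists j, [/\ j <= J, j = 0 \/ F < off j & J - j <= lg (minn t F %/ M) + 3].
Proof.
move=> [h1 h2] hF; have hM := M_gt.
have [q eq] : exists q, q = minn t F %/ M by eexists.
have hq : minn t F < q.+1 * M by rewrite eq -ltn_divLR //; exact: leq_ltn_trans hM.
have pq : q < 2 ^ lg q by exact: trunc_log_ltn.
rewrite -eq; clear eq; have [l el] : exists l, l = lg q by eexists.
(* At [l + 3] levels below the top, [t / 2^j] is at least [4 M * 2^(l+2) >= 16 (q+1) M], far above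
   [min (t, F)]. As it is at most [t], the minimum must be [F], and subtracting [4 M] still leaves
   more than [F]. *)
rewrite -el in pq *; clear el; set r := l + 3.
case: (leqP J r) => hr; first by exists 0; split=> //; [left | rewrite subn0].
exists (J - r); split; [exact: leq_subr | right | by rewrite subKn // ltnW].
have h3 : 4 * M < t %/ 2 ^ J.-1 by case: h2 => // e; lia.
have hJ : J.-1 = (J - r) + (l + 2) by rewrite /r in hr *; lia.
have h4 : 4 * M * 2 ^ (l + 2) <= t %/ 2 ^ (J - r).
  rewrite leq_divRL ?expn_gt0 // -mulnA -expnD [l + 2 + _]addnC -hJ.
  by rewrite -leq_divRL ?expn_gt0 // ltnW.
rewrite expnD in h4.
have h5 : 16 * (q.+1 * M) <= t %/ 2 ^ (J - r).
  apply: leq_trans h4; rewrite (_ : 16 * (q.+1 * M) = 4 * M * (q.+1 * 4)); last by lia.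
  by rewrite leq_mul2l leq_mul ?orbT.
have h6 : t %/ 2 ^ (J - r) <= t by exact: leq_div.
have h7 : M <= q.+1 * M by rewrite leq_pmull.
rewrite /off -/M; move: (t %/ _) (q.+1 * M) h5 h6 h7 hq => x y h5 h6 h7.
by clear -h5 h6 h7; rewrite /minn; case: (ltnP t F) => h hq; lia.
Qed.

(** With [base = 64 (n + 2)], the target sits in cell [base - 64], and [base / 64 - 63 = n - 61] is
    the number of generators from index 62 on, which still lie in the raw cells from 64 on. *)
Definition MarkC : cmd :=
  Seq (Assign 2 (Raw (esub (Var 0) (Cst 64))))
  (Seq (Assign 3 (esub (ediv (Var 0) (Cst 64)) (Cst 63)))
  (Seq (Put 0 (Cst 0) (Cst 1))
       (For 8 (Var 3) (Put 0 (Raw (eadd (Var 8) (Cst 64))) (Cst 1))))).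

(* The state in which the prelude leaves the machine: only the first 62
   generators have been marked in array 0. *)
Record start_ok (s : state) : Prop := StartOk {
  start0 : rg s 0 = base;
  start1 : rg s 1 = M;
  start_t : raw (base - 64) = t;
  start_raw : forall i, 62 <= i <= n -> raw (i + 2) = a i;
  start_chi : forall x, ar s 0 x <= M /\
    (ar s 0 x != 0 -> x = 0 \/ exists2 i, i <= n & x = a i);
  start_head : forall i, i <= n -> i < 62 -> ar s 0 (a i) != 0 }.

Lemma runs_mark s : start_ok s -> runs w raw MarkC s (200 * M) env_ok.
Proof.
move=> [e0 e1 et er ec eh]; have hM := M_gt; have [hB hB2 h1w] := word_facts.
rewrite -/M in hB hB2.
have hT : 7 + (8 + (10 + ((n - 61) * (15 + for_cost (Var 3)) + for_cost (Var 3)))) <= 200 * M.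
  by rewrite (_ : for_cost (Var 3) = 33) //; lia.
apply: runs_weak _ hT (fun s' h => h).
have eb : base = 64 * (n + 2) by [].
apply: runs_let => /=; first by rewrite e0; do ! split=> //; lia.
rewrite e0 et; apply: runs_let => /=; first by do ! split=> //; lia.
rewrite updN // e0; set s2 := setr _ 3 _.
have e3 : base %/ 64 - 63 = n - 61 by rewrite eb mulKn //; lia.
pose s3 := seta s2 0 0 1.
apply: (runs_seq (Q1 := fun s' => s' = s3)).
  by apply: runs_put => //=; rewrite ?updN // ?e0; lia.
move=> _ ->.
pose I j s' := [/\ keep [:: 2; 3; 8] [:: 0] s s', rg s' 2 = t, rg s' 3 = n - 61, rg s' 8 = j &
  (forall x, ar s' 0 x <= M /\ (ar s' 0 x != 0 -> x = 0 \/ exists2 i, i <= n & x = a i)) /\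
  ar s' 0 0 != 0 /\ (forall i, i <= n -> i < 62 + j -> ar s' 0 (a i) != 0)].
apply: runs_weak (@runs_for _ _ _ _ _ I _ (n - 61) _ _ _ _ _ _) (leqnn _) _.
- lia.
- lia.
- by move=> j s' [hk _ h3 h8 _] hj; split.
- move=> j s' [hk h2 h3 h8 [hx [h00 hm]]] hj.
  have e0' : rg s' 0 = base by rewrite (proj1 hk).
  have ha : a (j + 62) <= M by apply: gen_le => //; lia.
  have hr : raw (j + 64) = a (j + 62) by have := er (j + 62); rewrite -addnA; apply; lia.
  apply: runs_put => //=.
  + by rewrite h8 e0'; do ! split=> //; lia.
  + by rewrite h8 hr e0'; lia.
  rewrite h8 hr; split=> //; split.
  + by apply: keep_setr => //; exact: keep_seta.
  + by rewrite /= updN.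
  + by rewrite /= updN.
  + by rewrite /= updE.
  + split=> /=; last split.
    * move=> x; rewrite /upd; case: eqP => [->|_]; last exact: hx.
      by split; [lia | move=> _; right; exists (j + 62) => //; lia].
    * by rewrite /upd; case: ifP => _; rewrite ?h00.
    * move=> i hin hi; rewrite /upd; case: (a i =P a (j + 62)) => // hne; apply: hm => //.
      case: (ltngtP i (j + 62)) => h; [lia | lia | by rewrite h in hne].
- split; rewrite /= ?(updE, updN) // ?(updE, updN) // ?(updE, updN) //.
  + apply: keep_setr => //; apply: keep_seta => //.
    by do 2 (apply: keep_setr => //).
  + split; last split=> //.
      move=> x; rewrite /upd; case: eqP => [->|_]; last exact: ec.
      by split; [lia | left].
    by move=> i hin hi; rewrite /upd; case: (a i =P 0) => // _; apply: eh => //; lia.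
- move=> s' [hk h2 h3 h8 [hx [h00 hm]]]; split=> //; try by rewrite (proj1 hk).
  move=> x; have [h1 hs] := hx x; split=> //; split; first exact: hs.
  by case=> [-> //|[i hi ->]]; apply: hm => //; lia.
Qed.

Lemma cost_arith m l y J d : 2 * (64 * m) <= y -> J <= 4 * m + 4 -> d <= l + 3 -> 0 < m ->
  70 * 1000 * y + (40 * (J + 1) + (3 + (100 * m + (d * (3 + 30 * 1000 * y + 1) + 3 +
    (6 + 20 + 1))))) <= 200 * m + (l + 6) * (80 * 1000 * y).
Proof.
move=> hy hJ hd hm.
have [z ez] : exists z, z = 1000 * y by eexists.
have -> : 70 * 1000 * y = 70 * z by lia.
have -> : 30 * 1000 * y = 30 * z by lia.
have -> : 80 * 1000 * y = 80 * z by lia.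
have hz : 1000 * (2 * (64 * m)) <= z by rewrite ez leq_mul2l hy orbT.
have h1 : d * (3 + 30 * z + 1) <= (l + 3) * (3 + 30 * z + 1) by rewrite leq_mul2r hd orbT.
have h2 : l <= l * z by rewrite leq_pmulr //; lia.
have e1 : (l + 3) * (3 + 30 * z + 1) = 30 * (l * z) + 4 * l + 90 * z + 12 by lia.
have e2 : (l + 6) * (80 * z) = 80 * (l * z) + 480 * z by lia.
clear ez hy hd; lia.
Qed.

Definition BigC : cmd :=
  Seq BaseC (Seq PowC (Seq (Assign 6 (Cst 0)) (Seq CheckC (Seq (While (Var 29) StepC)
    (Ite (esub (Var 1) (Var 30))
       (Assign 9 (Get 6 (esub (Var 2) (Var 6)))) (Assign 9 (Cst 1))))))).

(** By [frobenius_bound] every [t >= 2 M^3] is representable. Answering these at once bounds the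
    search for the top level in terms of [M], even when [F] is small and [t] enormous. *)
Definition MainC : cmd :=
  Seq MarkC
    (Ite (esub (emul (emul (emul (Cst 2) (Var 1)) (Var 1)) (Var 1)) (Var 2))
      BigC (Assign 9 (Cst 1))).

Definition answer (s : state) : Prop := rg s 9 <= 1 /\ (rg s 9 != 0 <-> rep t).

Lemma runs_big F s : env_ok s -> (forall y, F < y -> rep y) -> t < 2 * M * M * M ->
  runs w raw BigC s
    (200 * M + (lg (minn t F %/ M) + 6) * (80 * 1000 * ((kk + 2) * 2 ^ (kk + 2)))) answer.
Proof.
move=> hi hF ht; have hM := M_gt; have [hB hB2 h1w] := word_facts.
have /andP[hU1 hU2] := U_bounds.
have [J hJ] := top_level_exists; have hJp := top_level_pow hJ.
have [js [hj1 hj2 hj3]] := stop_level hJ hF.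
set L := lg _ in hj3 *; set Y := (kk + 2) * 2 ^ (kk + 2).
have hY : 2 * (64 * M) <= Y.
  by apply: leq_mul; [lia | rewrite expnD mulnC -/U; lia].
(* From [2^J <= 2 t + 1] and [t < 2 M^3], with the crude [M <= 2^M]: a bound on [J] linear in [M] is
   all that is needed to charge the search to the first window. *)
have hJM : J <= 4 * M + 4.
  have hJ3 : 2 ^ J <= 4 * (2 ^ M * 2 ^ M * 2 ^ M).
    apply: leq_trans hJp _; apply: (@leq_trans (4 * (M * M * M))); first by lia.
    by rewrite leq_mul2l /= !leq_mul // ltnW // ltn_expl.
  have : 2 ^ J <= 2 ^ (2 + M + M + M) by rewrite !expnD -!mulnA in hJ3 *.
  by rewrite leq_exp2l //; lia.
have hT : 70 * 1000 * Y + (40 * (J + 1) + (3 + (100 * M +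
   ((\sum_(j < J - js) (ce (Var 29) + 30 * 1000 * Y + 1) + ce (Var 29)) +
    (ce (esub (Var 1) (Var 30)) + 20 + 1))))) <= 200 * M + (L + 6) * (80 * 1000 * Y).
  have -> : ce (Var 29) = 3 by [].
  have -> : ce (esub (Var 1) (Var 30)) = 6 by [].
  rewrite sum_nat_const card_ord.
  by apply: cost_arith => //; apply: leq_ltn_trans hM.
apply: runs_weak _ hT (fun s' h => h).
apply: runs_seq (runs_base hi) _ => s1 [k1 e4 e10 e11 hV]; rewrite -/U in e4 hV.
have i1 : env_ok s1 by apply: env_ok_keep k1 _ _ hi.
apply: runs_seq (runs_pow i1 hJ) _ => s2 [k2 e5].
have i2 : env_ok s2 by apply: env_ok_keep k2 _ _ i1.
apply: runs_let => /=; first by lia.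
set s3 := setr s2 6 0.
have i3 : env_ok s3 by case: i2 => *; split.
have off0 : off J = 0 by case: hJ => h _; rewrite /off -/M; lia.
have l3 : level J s3.
  split; rewrite /= ?(updE, updN) // ?(proj1 k2) //.
  by split; rewrite -/off off0 // => x hx; rewrite /= (proj2 k2) //; exact: hV.
have [_ _ _ e53 [_ hV3]] := l3.
apply: runs_seq (runs_check i3 e53 hJp hV3) _ => s4 [k4 c1 c2 c3].
have i4 : env_ok s4 by apply: env_ok_keep k4 _ _ i3.
have l4 : level J s4 by apply: level_keep k4 _ _ l3.
(* Here [r] counts the levels left above the stopping level [js]. At [r = 0] the guard vanishes,
   since either [js = 0] or the whole window lies above [F]. *)
pose I r s' := [/\ js + r <= J, env_ok s', level (js + r) s' & checked (js + r) s'].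
apply: (runs_seq (Q1 := fun s' => rg s' 29 = 0 /\ exists r, I r s')).
  apply: runs_weak (@runs_while _ _ _ _ I (fun=> 30 * 1000 * Y) (J - js) s4 _ _ _ _) (leqnn _) _.
  - by [].
  - move=> s' [_ i' l' [d1 d2 d3]]; rewrite /= d3 addn0; case: hj2 => [->|hfull].
      by rewrite expn0.
    rewrite (proj2 d2) ?subnn ?muln0 // => x hx; apply: hF; rewrite addn0.
    by move: hfull; rewrite /off; lia.
  - move=> r s' [hr i' l' _] _; rewrite addnS in hr l'.
    have hp : 2 ^ (js + r).+1 <= 2 * t + 1.
      by apply: leq_trans hJp; rewrite leq_exp2l.
    apply: runs_weak (runs_step i' l' hp) (leqnn _) _ => s'' [k' l'' c''].
    split=> //; [lia | by apply: env_ok_keep k' _ _ i'].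
  - by rewrite /I subnKC //; split=> //; split.
  - by move=> s' [h1 h2].
move=> s5 [h29 [r [hr i5 [g4 g10 g11 g5 [g6 hV5]] [d1 d2 d3]]]].
have o_le : off (js + r) <= t by apply: leq_trans (leq_subr _ _) (leq_div _ _).
apply: runs_ite => //=; rewrite (inv1 i5) -/M.
case: eqP => hfull.
  apply: runs_assign => //=.
  rewrite /answer /= updE; split=> //; split=> // _.
  apply: (run_saturates (o := off (js + r))) => //; apply/d2; lia.
(* The guard is 0 although some of the first [M] entries are missing, so the factor [2^j - 1] is 0:
   the window is the exact one around [t], and one lookup answers. *)
have h0 : js + r = 0.
  move: h29; rewrite d3 => /eqP; rewrite muln_eq0 => /orP[|/eqP//].
  by case: (js + r) => // m; rewrite expnS; have := expn_gt0 2 m; clear; lia.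
have ht' : t - off (js + r) < U.
  by rewrite h0 /off expn0 divn1 -/M; clear -hU1 hM; lia.
apply: runs_assign => //=.
  rewrite (inv0 i5) (inv2 i5) g6 -/off; split=> //.
  by have : n < M by []; clear -ht' hU2 hB; move: (t - _) ht' => x hx; lia.
rewrite /answer /= updE (inv2 i5) g6 -/off.
by have := hV5 _ ht'; rewrite -/off subnKC.
Qed.

Lemma runs_main F s : start_ok s -> (forall y, F < y -> rep y) ->
  runs w raw MainC s
    (500 * M + (lg (minn t F %/ M) + 6) * (80 * 1000 * ((kk + 2) * 2 ^ (kk + 2)))) answer.
Proof.
move=> hs hF; have hM := M_gt; have [hB hB2 h1w] := word_facts.
have hsw := small_words; rewrite -/M in hsw.
set X := _ * (80 * 1000 * _).
have hT : 200 * M + (ce (esub (emul (emul (emul (Cst 2) (Var 1)) (Var 1)) (Var 1)) (Var 2)) +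
   (200 * M + X) + 1) <= 500 * M + X.
  by rewrite (_ : ce _ = 14) //; lia.
apply: runs_weak _ hT (fun s' h => h).
apply: runs_seq (runs_mark hs) _ => s1 i1.
have m2 : M * M <= (t + M + 2) * (t + M + 2) by apply: leq_mul; lia.
have m3 : M * M * M <= (t + M + 2) * (t + M + 2) * (t + M + 2) by apply: leq_mul; lia.
have m4 : (t + M + 2) * (t + M + 2) * (t + M + 2) <= (t + M + 2) * (t + M + 2) * (t + M + 2) * (t + M + 2).
  by rewrite leq_pmulr //; lia.
apply: runs_ite.
  by rewrite /= (inv1 i1) -/M; do ! split=> //; lia.
rewrite /= (inv1 i1) (inv2 i1) -/M subn_eq0.
case: leqP => ht; last exact: runs_big.
apply: runs_assign => //.
  by rewrite (_ : csize _ = 3) //; apply: leq_trans (leq_addr _ _); clear -hM; lia.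
rewrite /answer /= updE; split=> //; split=> // _.
have [k [hk hrep]] := frobenius_bound va; rewrite -/M in hk hrep.
apply: hrep; apply: leq_trans ht.
have : 2 ^ k <= 2 * M ^ 2 by apply: leq_trans hk; rewrite leq_pmulr ?expn_gt0.
by rewrite -mulnn => h; rewrite leq_mul2r -mulnA h orbT.
Qed.

End Main.

(** * Loading the input and assembling the program *)

Lemma smem_lt w l m : all straight l -> (forall x, m x < 2 ^ w) -> forall x, smem w l m x < 2 ^ w.
Proof.
have hlt v : v %% 2 ^ w < 2 ^ w by rewrite ltn_mod expn_gt0.
elim: l m => //= i l IH m /andP[hi hl] hm; apply: IH => // x.
by case: i hi => //= *; rewrite /upd; case: eqP.
Qed.

(* The input occupies the cells in which the registers live, so it is moved out
   of the way: [t] goes just below the arrays, and each of the first 62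
   generators is turned, in its own cell, into the address of its mark. *)
Definition header : seq instr :=
  nseq 6 (Add 0 0 0) ++
  [:: WriteInd 0 1; Const 1 64; Add 0 0 1; Div 1 0 1; ReadInd 1 1].

Definition mark_code (r : nat) : seq instr :=
  [:: Add r r r; Add r r r; Add r r r; Add r r 0; WriteInd r 1].

Definition prelude : seq instr := header ++ flatten [seq mark_code r | r <- iota 2 62].

Definition program : seq instr :=
  prelude ++ compile (size prelude) MainC ++ [:: Const 0 0; Add 0 0 9; Halt].

Lemma exec_mono w P T k pc m m' : exec w P T pc m = Some m' -> exec w P (T + k) pc m = Some m'.
Proof.
elim: T pc m => //= T IH pc m; case: (nth Halt P pc) => //= *; exact: IH.
Qed.

Lemma exec_halt w P pc m : nth Halt P pc = Halt -> exec w P 1 pc m = Some m.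
Proof. by move=> /= ->. Qed.

Lemma wf_main : wfc MainC.
Proof. by vm_compute. Qed.

Lemma straight_prelude : all straight prelude.
Proof. by vm_compute. Qed.

Section Run.
Variables (w n : nat) (a : nat -> nat) (t c : nat).
Hypothesis va : valid_instance n a.
Hypothesis hc : c = 8 * 432.
Hypothesis hw : (t + a n + 2) ^ c <= 2 ^ w.
Let M := a n.
Let base := 64 * (n + 2).
Let m0 := init_mem n a t.

Lemma header_words : 1200 * (t + M + 2) < 2 ^ w.
Proof. have [h _ _] := word_facts va hc hw; rewrite -/M in h; lia. Qed.

Lemma double_mem k m : 2 ^ k * m 0 < 2 ^ w ->
  smem w (nseq k (Add 0 0 0)) m 0 = 2 ^ k * m 0 /\
  forall x, x != 0 -> smem w (nseq k (Add 0 0 0)) m x = m x.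
Proof.
elim: k m => [|k IH] m h; first by rewrite mul1n.
have h1 : m 0 + m 0 < 2 ^ w.
  by apply: leq_ltn_trans h; rewrite addnn -mul2n expnS -mulnA leq_mul2l /= leq_pmull ?expn_gt0.
rewrite /= modn_small //; have [|e1 e2] := IH (upd m 0 (m 0 + m 0)).
  by rewrite updE addnn -mul2n mulnA -expnSr.
split; first by rewrite e1 updE addnn -mul2n mulnA -expnSr.
by move=> x hx; rewrite e2 // updN.
Qed.

Definition mem1 : nat -> nat := smem w header m0.

(** Six doublings of [n + 1] give an address beyond the input, where [t] is stored; 64 more is the
    base. Dividing the base by 64 yields [n + 2], the cell of the last generator, so one indirect
    read fetches [M]. *)
Lemma header_mem : [/\ mem1 0 = base, mem1 1 = M, mem1 (64 * (n + 1)) = t &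
  forall x, 2 <= x -> x != 64 * (n + 1) -> mem1 x = m0 x].
Proof.
have hM : n < M := size_lt_max va; have hww := header_words.
have emn : m0 (n + 2) = M by rewrite /m0 /init_mem !addn2 /= leqnn subn2.
have [|d1 d2] := @double_mem 6 m0.
  by rewrite (_ : m0 0 = n.+1) // (_ : 2 ^ 6 = 64) //; lia.
rewrite /mem1 /header smem_cat; set m := smem w _ m0 in d1 d2 *.
have {}d1 : m 0 = 64 * (n + 1) by rewrite d1 addn1.
have em1 : m 1 = t by rewrite d2.
have emn' : m (n + 2) = M by rewrite d2 // addn2.
have c64 : 64 %% 2 ^ w = 64 by rewrite modn_small; lia.
have cb : (64 * (n + 1) + 64) %% 2 ^ w = base by rewrite modn_small /base; lia.
have cd : (base %/ 64) %% 2 ^ w = n + 2 by rewrite /base mulKn // modn_small; lia.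
rewrite /= d1 em1 c64; set mA := upd m _ t.
have p0 : upd mA 1 64 0 = 64 * (n + 1) by rewrite updN // /mA updN ?d1 //; lia.
rewrite p0 updE cb; set mB := upd _ 0 base.
have p1 : mB 1 = 64 by rewrite /mB updN // updE.
rewrite updE p1 cd; set mC := upd mB 1 _.
have p2 : mC (n + 2) = M by rewrite /mC /mB /mA !updN //; lia.
rewrite updE p2 /mC /mB /mA; split.
- by rewrite !(updE, updN).
- by rewrite ?updE.
- by rewrite 4?updN ?updE //; lia.
- by move=> x hx hne; rewrite !updN ?d2 //; lia.
Qed.

Definition marked (done : seq nat) (m : nat -> nat) : Prop :=
  [/\ m 0 = base, m 1 = M,
      (forall r, 2 <= r < 64 -> r \notin done -> m r = m0 r),
      (forall x, 64 <= x < base -> m x = mem1 x) &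
      forall x, base <= x -> (m x = 0 /\ (forall r, r \in done -> x != base + 8 * m0 r)) \/
        (m x = M /\ exists2 r, r \in done & x = base + 8 * m0 r)].

Lemma m0_le r : 2 <= r -> m0 r <= M.
Proof.
move=> hr; rewrite /m0 /init_mem; case: r hr => [|[|r]] //= _; case: ifP => // h.
by rewrite subn2 /=; apply: gen_le.
Qed.

Lemma mark_mem done m r : 2 <= r < 64 -> r \notin done -> marked done m ->
  marked (r :: done) (smem w (mark_code r) m).
Proof.
move=> hr hd [h0 h1 hreg hlow hhigh]; have hww := header_words.
have hM : n < M := size_lt_max va.
have hv : m r = m0 r by exact: hreg.
have vle := @m0_le r (proj1 (andP hr)).
have r0 : (r == 0) = false by lia. have r1 : (r == 1) = false by lia.
have e1 v : v <= 4 * M -> (v + v) %% 2 ^ w = v + v by move=> h; rewrite modn_small; lia.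
have e2 : (m0 r + m0 r + (m0 r + m0 r) + (m0 r + m0 r + (m0 r + m0 r)) + base) %% 2 ^ w
   = base + 8 * m0 r by rewrite modn_small /base; lia.
set adr := base + 8 * m0 r in e2.
have -> : smem w (mark_code r) m = smem w [:: WriteInd r 1] (smem w [:: Add r r r; Add r r r; Add r r r; Add r r 0] m) by [].
set m4 := smem w [:: _; _; _; _] m.
have m4r : m4 r = adr.
  rewrite /m4 /= !updE hv !e1; try lia.
  by rewrite !updN ?h0 ?e2 // eq_sym r0.
have m4n x : x != r -> m4 x = m x by move=> hx; rewrite /m4 /= !updN.
rewrite /= m4r (m4n 1) ?h1; last by rewrite eq_sym r1.
have hadr : base <= adr by rewrite leq_addr.
have hb : 128 <= base by rewrite /base; lia.
split.
- by rewrite updN ?m4n // ?(eq_sym 0) ?r0 //; lia.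
- by rewrite updN ?m4n // ?(eq_sym 1) ?r1 //; lia.
- move=> r' hr'; rewrite inE negb_or => /andP[hne hd'].
  by rewrite updN ?m4n //; [exact: hreg | lia].
- by move=> x hx; rewrite updN ?m4n //; [exact: hlow | lia | lia].
- move=> x hx; rewrite /upd; case: eqP => [->|hne].
    by right; split=> //; exists r; rewrite ?inE ?eqxx.
  rewrite m4n; last by lia.
  case: (hhigh x hx) => [[e h]|[e [r' hr' ex]]]; [left | right]; split=> //.
    by move=> r'; rewrite inE => /orP[/eqP->|]; [apply/eqP | exact: h].
  by exists r' => //; rewrite inE hr' orbT.
Qed.

Lemma marks_mem rs done m : all (fun r => 2 <= r < 64) rs -> uniq (rs ++ done) ->
  marked done m -> marked (rev rs ++ done) (smem w (flatten [seq mark_code r | r <- rs]) m).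
Proof.
elim: rs done m => [|r rs IH] done m // /andP[hr hrs] /andP[hn hu] hm.
rewrite map_cons -[flatten _]/(mark_code r ++ flatten _) smem_cat rev_cons cat_rcons; apply: IH => //.
  by rewrite -cat1s (perm_uniq (permEl (perm_catCA rs [:: r] done))) /= hn.
by apply: mark_mem => //; move: hn; rewrite mem_cat negb_or => /andP[].
Qed.

Definition start_state (m : nat -> nat) : state :=
  State m (fun k x => m (base + 8 * x + k)).

Lemma m0_lt x : m0 x < 2 ^ w.
Proof.
have hww := header_words; have hM : n < M := size_lt_max va.
case: x => [|[|x]]; [rewrite /m0 /init_mem /=; lia | rewrite /m0 /init_mem /=; lia |].
by have := @m0_le x.+2 isT; lia.
Qed.

Lemma prelude_start : let m := smem w prelude m0 in
  holds_in w m (start_state m) m /\ start_ok n a t m (start_state m).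
Proof.
have hM : n < M := size_lt_max va; have hww := header_words.
have [q0 q1 qt qx] := header_mem; move=> m.
have hm0 : marked [::] mem1.
  split=> //.
    by move=> r /andP[hr1 hr2] _; apply: qx => //; lia.
  move=> x hx; left; split=> //; rewrite qx; [|rewrite /base in hx; lia | rewrite /base in hx; lia].
  by rewrite /m0 /init_mem; do 3 (case: ifP => [|_]; first by rewrite /base in hx; lia).
have [|| g0 g1 _ glow ghigh] := @marks_mem (iota 2 62) [::] mem1 _ _ hm0.
- by apply/allP => r; rewrite mem_iota; lia.
- by rewrite cats0 iota_uniq.
rewrite -smem_cat -/prelude -/m cats0 in g0 g1 glow ghigh.
have hlt : forall x, m x < 2 ^ w by apply: smem_lt straight_prelude m0_lt.
split.
  split=> //; rewrite /= g0 // /base; lia.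
split=> //=.
- by rewrite glow; [rewrite (_ : base - 64 = 64 * (n + 1)) // /base | rewrite /base]; lia.
- move=> i hi; rewrite glow; last by rewrite /base; lia.
  rewrite qx; [|lia|lia]; rewrite /m0 /init_mem !addn2 /= subn2 /=.
  by rewrite ifT //; lia.
- move=> x; rewrite addn0; case: (ghigh (base + 8 * x)); first exact: leq_addr.
    by case=> -> _.
  case=> -> [r]; rewrite mem_rev mem_iota => hr e; split=> // _.
  have -> : x = m0 r by lia.
  case: r hr {e} => [|[|r]] hr //; rewrite /m0 /init_mem /=.
  (* Among the first 62 cells, those beyond a short input contain 0 and mark entry 0, which is to be
     marked anyway. *)
  case: ifP => h; last by left.
  by right; exists r; rewrite ?subn2.
- move=> i hi hi'; rewrite addn0; case: (ghigh (base + 8 * a i)); first exact: leq_addr.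
    case=> _ /(_ (i + 2)); rewrite mem_rev mem_iota => /(_ _)/negP[]; first by lia.
    by rewrite /m0 /init_mem !addn2 /= subn2 /= ifT.
  by case=> -> _; lia.
Qed.

Lemma program_runs F : (forall y, F < y -> representable n a y) ->
  exists T m, [/\ T <= 500 + (500 * M + (lg (minn t F %/ M) + 6) *
      (80 * 1000 * ((up_log 2 (16 * M) + 2) * 2 ^ (up_log 2 (16 * M) + 2)))),
    exec w program T 0 m0 = Some m, m 0 <= 1 & m 0 != 0 <-> representable n a t].
Proof.
move=> hF; have [hrel hst] := prelude_start; set m1 := smem w prelude m0 in hrel hst.
have [T1 [s1 [hT1 hb [a1 a2]]]] := runs_main va hc hw hst hF.
set P := program.
have hP : code_at P 0 P by move=> k hk; rewrite add0n.
have [hp1 hp2] := code_at_cat hP; rewrite add0n in hp2.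
have [hp3 hp4] := code_at_cat hp2; rewrite size_compile in hp4.
have r1 : reach w P (size prelude) 0 m0 (size prelude) m1.
  by have := reach_straight w m0 straight_prelude hp1; rewrite add0n.
have [m2 [r2 hm2]] := compile_correct hb wf_main hrel hp3.
have [hp5 hp6] := @code_at_cat P _ [:: Const 0 0; Add 0 0 9] [:: Halt] hp4.
have r3 := reach_straight w m2 (isT : all straight [:: Const 0 0; Add 0 0 9]) hp5.
have r123 := reach_trans (reach_trans r1 r2) r3.
set pc := size prelude + csize MainC + 2 in r123 hp6.
set m3 := smem _ _ _ in r123.
exists (size prelude + T1 + 2 + 1), m3.
have e9 : m2 9 = rg s1 9 by case: hm2 => _ ->.
have e3 : m3 0 = rg s1 9.
  rewrite /m3 /= !updE !updN // mod0n add0n e9 modn_small //.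
  have := header_words; lia.
split.
- have -> : size prelude = 321 by [].
  by rewrite -/M in hT1; move: hT1; move: (500 * M + _) => X; clear; lia.
- by rewrite (r123 1); apply: exec_halt; have := hp6 0 isT; rewrite addn0.
- by rewrite e3.
- by rewrite e3.
Qed.

End Run.

(** * Final estimates *)

Lemma trunc_log_lg x : x < 2 ^ lg x.
Proof. exact: trunc_log_ltn. Qed.

Lemma lg_mono x y : x <= y -> lg x <= lg y.
Proof. by move=> h; rewrite ltnS leq_trunc_log. Qed.

Lemma log_size M : 0 < M ->
  (up_log 2 (16 * M) + 2) * 2 ^ (up_log 2 (16 * M) + 2) <= 900 * (M * lg M).
Proof.
move=> hM; have := @up_log_bounds 2 (16 * M) isT; set kk := up_log _ _ => /(_ _)/andP[|h1 h2]; first by lia.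
have hk : kk = kk.-1.+1 by case: (kk) h1 h2 => //; rewrite expn0; lia.
have h3 : 2 ^ (kk + 2) <= 128 * M.
  by rewrite hk addSn expnS expnD; lia.
have h4 : kk + 2 <= 7 * lg M.
  have hlt : 2 ^ kk.-1 < 2 ^ (4 + lg M).
    by rewrite expnD; apply: leq_trans h1 _; rewrite leq_mul2l /= ltnW // trunc_log_lg.
  rewrite ltn_exp2l // in hlt; have : 0 < lg M by []; lia.
apply: leq_trans (leq_mul h4 h3) _; lia.
Qed.

Lemma frobenius_lg n a k : valid_instance n a ->
  2 ^ k * n.+1 ^ 2 <= 2 * a n ^ 2 -> lg (2 ^ k) <= 5 * lg (a n %/ n).
Proof.
move=> va hk; rewrite /lg trunc_expnK //.
case: n va hk => [|n] va hk.
  (* A single generator of gcd 1 equals 1, whence [2^k <= 2]; the quotient by [n = 0] is 0, where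
     [lg] is still 1. *)
  have [_ _] := va; rewrite big_ord_recl big_ord0 gcdn0 => a1.
  move: hk; rewrite [a _]a1 !exp1n !muln1 => hk.
  have : 2 ^ k <= 2 ^ 1 by [].
  by rewrite leq_exp2l //; lia.
have hn := size_lt_max va; set M := a n.+1 in hk hn *; set f := M %/ n.+1.
have f0 : 0 < f by rewrite divn_gt0 //; lia.
(* As the quotient [f] is positive, rounding it down loses less than a factor 2; so [2^k] is below
   [8 f^2] and its logarithm is linear in [lg f]. *)
have hM : M < 2 * n.+1 * f.
  by have := divn_eq M n.+1; have := ltn_pmod M (ltn0Sn n); rewrite -/f; nia.
have hM2 : M ^ 2 < (2 * n.+1 * f) ^ 2 by rewrite ltn_exp2r.
have hn2 : n.+1 ^ 2 <= n.+2 ^ 2 by rewrite leq_exp2r.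
have hkf : 2 ^ k < 8 * f ^ 2.
  rewrite -(@ltn_pmul2r (n.+2 ^ 2)) ?expn_gt0 //.
  apply: leq_ltn_trans hk _; rewrite !expnMn in hM2.
  apply: (@leq_trans (2 * (2 ^ 2 * n.+1 ^ 2 * f ^ 2))); first by rewrite ltn_pmul2l.
  by rewrite (_ : 2 * _ = 8 * f ^ 2 * n.+1 ^ 2); [rewrite leq_mul2l hn2 orbT | lia].
have hff : f ^ 2 <= 2 ^ (2 * lg f).
  by rewrite mulnC expnM leq_exp2r // ltnW // trunc_log_lg.
have : 2 ^ k < 2 ^ (3 + 2 * lg f).
  by rewrite expnD; apply: leq_trans hkf _; rewrite leq_mul2l hff orbT.
rewrite ltn_exp2l // -/(lg f); have : 0 < lg f by []; lia.
Qed.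

Lemma total_cost D y M l q : D = 1000 * (1000 * 1000) -> 0 < M -> 0 < l -> 0 < q ->
  y <= 900 * (M * l) -> 500 + (500 * M + (q + 6) * (80 * 1000 * y)) <= D * M * l * q.
Proof.
move=> eD hM hl hq hy.
have h1 : M <= M * l by rewrite leq_pmulr.
have h2 : M * l <= M * l * q by rewrite leq_pmulr.
have h3 : (q + 6) * (80 * 1000 * y) <= 7 * q * (80 * 1000 * (900 * (M * l))).
  by apply: leq_mul; [lia | rewrite leq_mul2l hy orbT].
have -> : D * M * l * q = D * (M * l * q) by rewrite !mulnA.
have e : 7 * q * (80 * 1000 * (900 * (M * l))) = 504 * (1000 * 1000) * (M * l * q).
  by move: (M * l) => z; clear; lia.
rewrite e in h3; clear e hy.
move: (M * l * q) (_ * (80 * 1000 * y)) h2 h3 => X Y h2 h3.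
have hX : M <= X by exact: leq_trans h1 h2.
have : (504 * (1000 * 1000) + 1000) * X <= D * X by rewrite leq_mul2r eD; apply/orP; right; lia.
clear -hX h3 hM; lia.
Qed.

Theorem theorem5 :
  exists (P : seq instr) (c C : nat),
  forall (w n : nat) (a : nat -> nat) (t : nat),
    valid_instance n a ->
    (t + a n + 2) ^ c <= 2 ^ w ->
    exists (T : nat) (m : nat -> nat),
      [/\ exec w P T 0 (init_mem n a t) = Some m,
          (representable n a t -> m 0 = 1),
          (~ representable n a t -> m 0 = 0),
          (* T = O(a_n log a_n log(min(t/a_n, F/a_n))), F the Frobenius
             number; quantifying over every F' >= F (i.e. every bound
             above which everything is representable) is equivalent *)
          (forall F : nat, (forall y, F < y -> representable n a y) ->
             T <= C * a n * lg (a n) * lg (minn t F %/ a n)) &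
          (* T = O(a_n log a_n log(a_n/n)) *)
          T <= C * a n * lg (a n) * lg (a n %/ n)].
Proof.
(* Introduced through equations, the large constants stay opaque and are not expanded into unary
   numerals. *)
have [c hc] : exists c, c = 8 * 432 by eexists.
have [D hD] : exists D, D = 1000 * (1000 * 1000) by eexists.
exists program, c, (D * 5) => w n a t va hw.
have a0 : 0 < a n by apply: leq_ltn_trans (size_lt_max va).
have cost F : (forall y, F < y -> representable n a y) -> exists T m,
    [/\ T <= D * a n * lg (a n) * lg (minn t F %/ a n),
      exec w program T 0 (init_mem n a t) = Some m, m 0 <= 1 &
      m 0 != 0 <-> representable n a t].
  move=> hF; have [T [m [hT he h1 h2]]] := program_runs va hc hw hF.
  exists T, m; split=> //; apply: leq_trans hT _.
  by apply: (total_cost hD) => //; exact: log_size.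
have [k [hk hrep]] := frobenius_bound va.
have hF0 y : 2 ^ k * a n < y -> representable n a y by move=> /ltnW; exact: hrep.
have [T0 [m [_ he0 h1 h2]]] := cost _ hF0.
(* [cost] yields a running time that depends on [F], but a single [T] has to meet all the bounds;
   the least fuel on which the program halts lies below each of them. *)
have ex : exists T, isSome (exec w program T 0 (init_mem n a t)) by exists T0; rewrite he0.
have [T hT Tmin] := ex_minnP ex.
have [m' he] : exists m', exec w program T 0 (init_mem n a t) = Some m'.
  by case: (exec _ _ T _ _) hT => // m' _; exists m'.
have em : m' = m.
  have hle : T <= T0 by apply: Tmin; rewrite he0.
  by have := exec_mono (T0 - T) he; rewrite subnKC // he0 => -[].
have bound F : (forall y, F < y -> representable n a y) ->
    T <= D * a n * lg (a n) * lg (minn t F %/ a n).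
  by move=> /cost [T1 [m1 [hT1 he1 _ _]]]; apply: leq_trans hT1; apply: Tmin; rewrite he1.
exists T, m'; rewrite em in he *; split=> //.
- by move=> /h2; lia.
- by move=> hn; apply/eqP; apply/negPn/negP => /h2.
- move=> F /bound hF; apply: leq_trans hF _.
  by rewrite !leq_mul // leq_pmulr.
- apply: leq_trans (bound _ hF0) _.
  (* For the explicit bound [2^k * a n] in the role of [F], the quotient by [a n] is [2^k]; the
     factor 5 is the one set aside in [D * 5]. *)
  have hq : lg (minn t (2 ^ k * a n) %/ a n) <= 5 * lg (a n %/ n).
    apply: leq_trans (frobenius_lg va hk); apply: lg_mono.
    by rewrite -{2}(mulnK (2 ^ k) a0) leq_div2r // geq_minr.
  apply: leq_trans (leq_mul (leqnn _) hq) _.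
  by move: (a n) (lg (a n)) (lg _) => x y z; clear; lia.
Qed.
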